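(* (The strong wavefront lemma.) Let $G$ be a connected noncompact semisimple Lie group with finite center, $G=KA^+K$ a Cartan decomposition, and $M$ the centralizer of $A$ in $K$. Let $\mathcal C$ be any closed subset of $A^+$ with a positive distance from the walls of $A^+$. Then for any neighborhoods $U_1,U_2$ of $e$ in $K$ and any neighborhood $V$ of $e$ in $A$, there exists a neighborhood $\mathcal O$ of $e$ in $G$ such that for any $g=k_1ak_2\in K\mathcal CK$ (with $k_1,k_2\in K$, $a\in\mathcal C$): (1) $g\mathcal O\subset(k_1U_1)(aVM)(k_2U_2)$; (2) $\mathcal Og\subset(k_1U_1)(aVM)(k_2U_2)$.
   Context: In a Cartan decomposition $G=KA^+K$, $K$ is a maximal compact subgroup, $A$ is a split Cartan subgroup with respect to $K$ (a maximal connected abelian subgroup contained in $\exp(\mathfrak p)$, where $G=K\exp(\mathfrak p)$), and $A^+=\{a\in A:\alpha(\log a)\ge0\text{ for all }\alpha\in\Phi^+\}$ is the closed positive Weyl chamber for a set of positive roots $\Phi^+$. The set $\mathcal C\subset A^+$ has positive distance from the walls if there is $C_0>0$ with $\alpha(\log a)\ge C_0$ for all $a\in\mathcal C$ and all $\alpha\in\Phi^+$. *)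

(* Defs.v *)
From HB Require Import structures.
From mathcomp Require Import all_boot all_order all_algebra.
From mathcomp Require Import all_classical all_reals.
From mathcomp Require Import topology normedtype derive.

Set Implicit Arguments.
Unset Strict Implicit.
Unset Printing Implicit Defensive.

Import Order.TTheory GRing.Theory Num.Theory.
Import numFieldNormedType.Exports.

Local Open Scope classical_set_scope.
Local Open Scope ring_scope.

HB.mixin Record isTopologicalGroup G & Topological G & Group G := {
  continuous_mulg : continuous (fun xy : G * G => (xy.1 * xy.2)%g);
  continuous_invg : continuous (fun x : G => (x^-1)%g)
}.

#[short(type="topGroupType")]
HB.structure Definition TopologicalGroup :=
  {G of Topological G & Group G & isTopologicalGroup G}.

Section Subsets.
Context {G : topGroupType}.
Local Open Scope group_scope.

Definition mulS (A B : set G) : set G := [set a * b | a in A & b in B].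

Definition subgroup (H : set G) : Prop :=
  H 1 /\ forall x y, H x -> H y -> H (x * y^-1).

Definition abelian_subset (H : set G) : Prop :=
  forall x y, H x -> H y -> x * y = y * x.

Definition centralizer_in (K A : set G) : set G :=
  [set k | K k /\ forall a, A a -> k * a = a * k].

Definition group_center : set G := centralizer_in setT setT.

(* U is a subset of H and a neighborhood of 1 for the subspace topology of H *)
Definition nbhd1_in (H U : set G) : Prop :=
  U `<=` H /\ within H (nbhs (1 : G)) U.

Definition maximal_compact_subgroup (K : set G) : Prop :=
  [/\ subgroup K, compact K &
    forall L, subgroup L -> compact L -> K `<=` L -> L = K].

End Subsets.

Notation "A *s B" := (mulS A B) (at level 40, left associativity).

Section Smoothness.
Context {R : realType}.

(* f is of class C^k on the open set U; the values of f off U are irrelevant *)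
Fixpoint Ck (E F : normedModType R) (k : nat) (U : set E) (f : E -> F) : Prop :=
  if k is k'.+1 then
    (forall x, U x -> differentiable f x) /\ (forall v, Ck k' U ('D_v f))
  else forall x, U x -> {for x, continuous f}.

Definition smooth_on (E F : normedModType R) (U : set E) (f : E -> F) : Prop :=
  forall k, Ck k U f.

End Smoothness.

(* chart_map and chart_inv are total functions, meaningful only on chart_dom
   and chart_cod, between which they are inverse homeomorphisms *)
Record chart (R : realType) (n : nat) (G : topologicalType) := Chart {
  chart_dom : set G;
  chart_cod : set 'rV[R]_n;
  chart_map : G -> 'rV[R]_n;
  chart_inv : 'rV[R]_n -> G;
  open_chart_dom : open chart_dom;
  open_chart_cod : open chart_cod;
  chart_map_cod : forall g, chart_dom g -> chart_cod (chart_map g);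
  chart_inv_dom : forall x, chart_cod x -> chart_dom (chart_inv x);
  chart_mapK : forall g, chart_dom g -> chart_inv (chart_map g) = g;
  chart_invK : forall x, chart_cod x -> chart_map (chart_inv x) = x;
  chart_map_continuous :
    forall g, chart_dom g -> {for g, continuous chart_map};
  chart_inv_continuous :
    forall x, chart_cod x -> {for x, continuous chart_inv}
}.

Section LieGroup.
Context {R : realType} {n : nat} {G : topGroupType}.
Notation E := 'rV[R]_n.

Definition smooth_atlas (atlas : set (chart R n G)) : Prop :=
  (forall g, exists2 c, atlas c & chart_dom c g) /\
  (forall c d, atlas c -> atlas d ->
     smooth_on [set x | chart_cod c x /\ chart_dom d (chart_inv c x)]
               (chart_map d \o chart_inv c)).

Definition smooth_mul (atlas : set (chart R n G)) : Prop :=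
  forall b c d, atlas b -> atlas c -> atlas d ->
    smooth_on
      [set xy : E * E | [/\ chart_cod b xy.1, chart_cod c xy.2 &
         chart_dom d (chart_inv b xy.1 * chart_inv c xy.2)%g]]
      (fun xy => chart_map d (chart_inv b xy.1 * chart_inv c xy.2)%g).

Definition smooth_inv (atlas : set (chart R n G)) : Prop :=
  forall c d, atlas c -> atlas d ->
    smooth_on
      [set x | chart_cod c x /\ chart_dom d (chart_inv c x)^-1%g]
      (fun x => chart_map d (chart_inv c x)^-1%g).

Definition lie_group (atlas : set (chart R n G)) : Prop :=
  [/\ hausdorff_space G, @second_countable G, smooth_atlas atlas,
      smooth_mul atlas & smooth_inv atlas].

(* In what follows c is a chart at 1. The Lie algebra, i.e. the tangent space
   of G at 1, is identified with R^n by the differential of c at 1. *)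
Section LieAlgebra.
Variable c : chart R n G.

(* Ad g is the differential at 1 of x |-> g x g^-1 *)
Definition Ad (g : G) (Y : E) : E :=
  'D_Y (fun y => chart_map c (g * chart_inv c y * g^-1)%g) (chart_map c 1%g).

(* ad is the differential at 1 of Ad, and [X, Y] = ad X Y *)
Definition bracket (X Y : E) : E :=
  'D_X (fun x => Ad (chart_inv c x) Y) (chart_map c 1%g).

Definition one_parameter_subgroup (X : E) (gamma : R -> G) : Prop :=
  [/\ continuous gamma,
      forall s t, gamma (s + t) = (gamma s * gamma t)%g &
      is_derive (0 : R^o) (1 : R^o) (chart_map c \o gamma : R^o -> E) X].

Definition lie_exp (X : E) : G :=
  xget 1%g [set g | exists2 gamma, one_parameter_subgroup X gamma
                                 & gamma 1 = g].

Definition is_lie_algebra_of (H : set G) (h : {vspace E}) : Prop :=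
  forall X, X \in h <-> forall t : R, H (lie_exp (t *: X)).

Definition killing (X Y : E) : R :=
  \tr (lin1_mx (bracket X) *m lin1_mx (bracket Y)).

Definition bracketv (U V : {vspace E}) : {vspace E} :=
  <<[seq bracket X Y | X <- vbasis U, Y <- vbasis V]>>%VS.

Definition lie_ideal (I : {vspace E}) : Prop :=
  forall X Y, Y \in I -> bracket X Y \in I.

Definition lie_solvable (I : {vspace E}) : Prop :=
  exists k, iter k (fun J => bracketv J J) I = 0%VS.

Definition semisimple_lie_algebra : Prop :=
  forall I, lie_ideal I -> lie_solvable I -> I = 0%VS.

Definition cartan_decomposition_algebra (k p : {vspace E}) : Prop :=
  [/\ (k + p = fullv)%VS /\ (k :&: p = 0)%VS,
      [/\ (forall X Y, X \in k -> Y \in k -> bracket X Y \in k),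
          (forall X Y, X \in k -> Y \in p -> bracket X Y \in p) &
          (forall X Y, X \in p -> Y \in p -> bracket X Y \in k)],
      (forall X, X \in k -> X != 0 -> killing X X < 0) &
      (forall X, X \in p -> X != 0 -> 0 < killing X X)].

Definition exp_image (p : {vspace E}) : set G :=
  [set lie_exp X | X in [set X | X \in p]].

Definition split_cartan_subgroup (p : {vspace E}) (A : set G) : Prop :=
  let P (B : set G) :=
    [/\ subgroup B, connected B, abelian_subset B & B `<=` exp_image p] in
  P A /\ forall B, P B -> A `<=` B -> B = A.

Section Roots.
Variable a : {vspace E}.

Definition root_space (alpha : 'Hom(subvs_of a, R^o)) : set E :=
  [set X | forall H : subvs_of a, bracket (vsval H) X = alpha H *: X].

Definition restricted_roots : set 'Hom(subvs_of a, R^o) :=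
  [set alpha | alpha != 0 /\ exists2 X, X != 0 & root_space alpha X].

Definition positive_roots (Phi : set 'Hom(subvs_of a, R^o)) : Prop :=
  [/\ Phi `<=` restricted_roots,
      (forall alpha, restricted_roots alpha -> Phi alpha \/ Phi (- alpha)),
      (forall alpha, Phi alpha -> ~ Phi (- alpha)) &
      (forall alpha beta, Phi alpha -> Phi beta ->
         restricted_roots (alpha + beta) -> Phi (alpha + beta))].

(* the logarithm on exp a, inverse to the exponential map of a *)
Definition lie_log (g : G) : subvs_of a :=
  xget 0 [set H : subvs_of a | lie_exp (vsval H) = g].

Definition closed_chamber (A : set G) (Phi : set 'Hom(subvs_of a, R^o)) :
    set G :=
  [set g | A g /\ forall alpha, Phi alpha -> 0 <= alpha (lie_log g)].

Definition positive_distance_from_walls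
    (Phi : set 'Hom(subvs_of a, R^o)) (C : set G) : Prop :=
  exists2 C0 : R, 0 < C0 &
    forall g alpha, C g -> Phi alpha -> C0 <= alpha (lie_log g).

End Roots.

(* G = K A^+ K, where k, p, a are the spaces Lie(K), the complement of Lie(K)
   in the Cartan decomposition of the Lie algebra, and Lie(A) *)
Definition cartan_decomposition (K A : set G) (k p a : {vspace E})
    (Phi : set 'Hom(subvs_of a, R^o)) : Prop :=
  [/\ maximal_compact_subgroup K /\ is_lie_algebra_of K k,
      cartan_decomposition_algebra k p /\ [set: G] = K *s exp_image p,
      split_cartan_subgroup p A /\ is_lie_algebra_of A a,
      positive_roots Phi &
      [set: G] = K *s closed_chamber A Phi *s K].

End LieAlgebra.

Definition semisimple_lie_group (atlas : set (chart R n G)) : Prop :=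
  lie_group atlas /\
  forall c, atlas c -> chart_dom c 1%g -> semisimple_lie_algebra c.

End LieGroup.

(* C is closed for the subspace topology of S *)
Definition closed_subset_of (T : topologicalType) (S C : set T) : Prop :=
  exists2 F, closed F & C = S `&` F.

(* Main.v *)
(* It is enough to write [b o] as [u b v w] with [u], [w] in [K] and [v] in [A]
   near [1], uniformly in [b] of [C] and in [o] near [1]: inverting the equation
   for [b^-1] gives [o b], and the outer factors of [k1 b k2] are absorbed by
   conjugation, because [K] is compact.
     To first order at [1], with [b = exp H0] and [o = 1 + x], the equation reads
   [x = Ad (b^-1) T + H + Z] with [T], [Z] in [k] and [H] in [a]. The algebra
   [a] acts diagonalizably and its centralizer is the sum of [a] and of its
   centralizer in [k], so one solves the equation on each joint eigenvector [e].
   If [e] has weight [l] at [H0], its component in [p] is a combination of its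
   component in [k] and of the image of that by [Ad (b^-1)]; the coefficients are of
   order [1 / sinh l] and [coth l], hence bounded when [|l|] stays away from [0].
   This is where the distance from the walls enters.
     With bounds independent of [b], the remainder is quadratic in [x], also
   uniformly, and successive approximation (a perturbation of [H0] in [a] remains
   regular) gives the exact decomposition, by compactness of [K]. *)
Require Import Defs.
From HB Require Import structures.
From mathcomp Require Import all_boot all_order all_algebra.
From mathcomp Require Import all_classical all_reals.
From mathcomp Require Import topology normedtype derive landau sequences realfun exp.
From mathcomp Require Import ring lra.

Set Implicit Arguments.
Unset Strict Implicit.
Unset Printing Implicit Defensive.

Import Order.TTheory GRing.Theory Num.Theory.
Import numFieldNormedType.Exports.

Local Open Scope classical_set_scope.
Local Open Scope ring_scope.

(** The exponential shapes the proof. [lie_exp] is defined through one-parameter subgroups whose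
    existence is not given, and takes the value [1] where there is none. Uniqueness is proved
    directly, by doubling from small times. Existence is drawn from the Cartan decomposition: a
    vector without a one-parameter subgroup lies by default in the Lie algebra of every subgroup,
    hence in both [k] and [a], and noncompactness of [G] rules this out. Until then [[X, X] = 0] and
    the Jacobi identity are available only off [k], and are extended by multilinearity. Passing from
    commuting group elements to commuting vectors uses that [ad X] is diagonalizable for [X] in [p]
    and that the real exponential is injective on eigenvalues. Uniformity in [b] has one trap:
    [Ad (b^-1)] has no bound independent of [b]. Only the size of [Ad (b^-1) T] matters, and the
    first-order equation itself bounds it by the other terms. The successive factors are kept in
    compact sets while the remainder tends to [1]; the exact decomposition then holds because the
    set of products is closed. *)

Lemma row_unitmx_neq0 (F : fieldType) (m : nat) (P : 'M[F]_m) i :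
  P \in unitmx -> row i P != 0.
Proof.
rewrite -row_free_unit => /row_freeP[Q PQ]; apply/eqP => r0.
have := congr1 (row i) PQ; rewrite row_mul r0 mul0mx.
by move=> /rowP/(_ i); rewrite !mxE eqxx => /eqP; rewrite eq_sym oner_eq0.
Qed.

(** * Linear maps and symmetric matrices *)

Section FiniteDimension.
Context {R : realType}.

Lemma ler_coord m n (x : 'M[R]_(m, n)) i j : `|x i j| <= `|x|.
Proof.
rewrite [leRHS]/Num.norm /= mx_normrE.
by apply/bigmax_geP; right; exists (i, j).
Qed.

Lemma ler_mxnorm m n (x : 'M[R]_(m, n)) e :
  0 <= e -> (forall i j, `|x i j| <= e) -> `|x| <= e.
Proof.
move=> e0 xe; rewrite [leLHS]/Num.norm /= mx_normrE.
by apply/bigmax_leP; split=> // -[i j] _; exact: xe.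
Qed.

Lemma pack_linear (U V : lmodType R) (f : U -> V) :
  linear f -> exists g : {linear U -> V}, g = f :> (U -> V).
Proof.
move=> lf; pose g : {linear U -> V} :=
  HB.pack f (GRing.isLinear.Build R U V *:%R f lf).
by exists g.
Qed.

Lemma linear_bounded n (F : normedModType R) (f : 'rV[R]_n -> F) :
  linear f -> exists2 C : R, 0 <= C & forall x, `|f x| <= C * `|x|.
Proof.
move=> /pack_linear[g <-].
exists (\sum_i `|g (delta_mx 0 i)|); first exact: sumr_ge0.
move=> x; rewrite {1}(row_sum_delta x) linear_sum/=.
rewrite (le_trans (ler_norm_sum _ _ _))// mulr_suml ler_sum// => i _.
by rewrite linearZ/= normrZ mulrC ler_wpM2l// ler_coord.
Qed.

Lemma linear_fun_continuous n (F : normedModType R) (f : 'rV[R]_n -> F) :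
  linear f -> continuous f.
Proof.
move=> lf; have [C C0 fC] := linear_bounded lf.
move: lf fC => /pack_linear[g <-] gC.
move=> x; apply: bounded_linear_continuous.
exists (C + 1); split; first exact: num_real.
move=> M CM; near=> y; rewrite /= (le_trans (gC _))//.
have y1 : `|y| <= 1 by near: y; exact: (@nbhs0_le R 'rV[R]_n 1 ltr01).
by rewrite (le_trans _ (ltW CM))// ler_wpDr// ler_piMr.
Unshelve. all: by end_near. Qed.

End FiniteDimension.

(** * Self-adjoint matrices and functions of them *)

Section SpectralTheorem.
Context {R : realType} {n : nat}.
Implicit Types (A B M : 'M[R]_n) (u v w : 'rV[R]_n).

Definition mxform M u v : R := (u *m M *m v^T) 0 0.

Lemma mxformDl M u v w : mxform M (u + v) w = mxform M u w + mxform M v w.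
Proof. by rewrite /mxform !mulmxDl mxE. Qed.

Lemma mxformDr M u v w : mxform M u (v + w) = mxform M u v + mxform M u w.
Proof. by rewrite /mxform linearD mulmxDr mxE. Qed.

Lemma mxformZl M a u v : mxform M (a *: u) v = a * mxform M u v.
Proof. by rewrite /mxform -!scalemxAl mxE. Qed.

Lemma mxformZr M a u v : mxform M u (a *: v) = a * mxform M u v.
Proof. by rewrite /mxform linearZ -scalemxAr mxE. Qed.

Lemma mxform_sym M u v : M^T = M -> mxform M u v = mxform M v u.
Proof.
move=> MT; rewrite /mxform.
have -> : u *m M *m v^T = (v *m M *m u^T)^T by rewrite !trmx_mul trmxK MT mulmxA.
by rewrite mxE.
Qed.

Lemma continuous_mxform M : continuous (fun v => mxform M v v).
Proof.
have -> : (fun v => mxform M v v) =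
    (fun v => \sum_j (\sum_i v 0 i * M i j) * v 0 j).
  by apply/funext => v; rewrite /mxform mxE; apply: eq_bigr => j _; rewrite !mxE.
apply: (@continuous_big R^o _ _ _ _ add_continuous) => j _ v.
apply: (@cvgM R _ (nbhs v) (nbhs_filter v)); last exact: coord_continuous.
apply: (@continuous_big R^o _ _ _ _ add_continuous) => i _ w.
apply: (@cvgM R _ (nbhs w) (nbhs_filter w)); last exact: cvg_cst.
exact: coord_continuous.
Qed.

(* A maximum of the Rayleigh quotient [mxform (A *m B) v v / mxform B v v] on
   the unit sphere of [U]. *)
Lemma exists_eigenvector A B m (U : 'M[R]_(m, n)) :
  (forall v, v != 0 -> 0 < mxform B v v) -> B^T = B ->
  (A *m B)^T = A *m B -> stablemx U A -> U != 0 ->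
  exists v, [/\ v != 0, (v <= U)%MS & exists l, v *m A = l *: v].
Proof.
move=> Bpos BT ABT UA U0.
pose S := [set v : 'rV[R]_n | (v <= U)%MS /\ `|v| = 1].
have norm1 v : v != 0 -> `|(`|v|^-1 *: v)| = 1.
  move=> v0; rewrite normrZ normfV normr_id mulVf ?normr_eq0//.
have [S0 Scpt] : S !=set0 /\ compact S.
  split.
    have /matrix0Pn[i [j Uij]] := U0.
    have r0 : row i U != 0 by apply/rV0Pn; exists j; rewrite mxE.
    exists (`|row i U|^-1 *: row i U); split; last exact: norm1.
    by rewrite scalemx_sub// row_sub.
  apply: bounded_closed_compact.
    exists 1; split; first exact: num_real.
    by move=> x x1 v [_ v1]; move: (ltW x1); rewrite -v1.
  apply: closedI; last first.
    apply: (@closed_comp _ _ (fun v : 'rV[R]_n => `|v|) [set 1]) => [v _|].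
      exact: norm_continuous.
    exact: closed_eq.
  change (closed [set v : 'rV[R]_n | (v <= U)%MS]).
  have -> : [set v : 'rV[R]_n | (v <= U)%MS] =
     (fun v => v *m cokermx U) @^-1` [set 0].
    by apply/seteqP; split=> v /=; rewrite submxE => /eqP.
  apply: closed_comp => [v _|]; last first.
    exact/accessible_closed_set1/hausdorff_accessible/norm_hausdorff.
  apply: linear_fun_continuous => k x y; by rewrite mulmxDl scalemxAl.
pose f v := mxform (A *m B) v v / mxform B v v.
have fcont : {within S, continuous f}.
  apply: continuous_in_subspaceT => v; rewrite inE => -[_ v1].
  apply: (@cvgM R _ (nbhs v) (nbhs_filter v)); first exact: continuous_mxform.
  apply: cvgV; last exact: continuous_mxform.
  by rewrite gt_eqF// Bpos// -normr_eq0 v1 oner_neq0.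
have [v] := EVT_max_rV S0 Scpt fcont; rewrite inE => -[vU v1] fmax.
have v0 : v != 0 by rewrite -normr_eq0 v1 oner_neq0.
exists v; split => //; exists (f v); set l := f v.
(* [g] is nonnegative on [U] and vanishes at [v], so its first variation at [v] vanishes in every
   direction of [U]; the direction [l *: v - v *m A] gives the eigenvector equation. *)
pose g w := l * mxform B w w - mxform (A *m B) w w.
have gv : g v = 0 by rewrite /g /l /f divfK ?subrr// gt_eqF// Bpos.
have gpos w : (w <= U)%MS -> 0 <= g w.
  move=> wU; have [->|w0] := eqVneq w 0.
    by rewrite /g /mxform !mul0mx mxE mulr0 subrr.
  have wS : S (`|w|^-1 *: w) by split; [rewrite scalemx_sub|exact: norm1].
  have := fmax (`|w|^-1 *: w); rewrite inE => /(_ wS).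
  have nw : `|w|^-1 != 0 by rewrite invr_eq0 normr_eq0.
  rewrite {1}/f !mxformZl !mxformZr !mulrA -mulf_div divff ?mul1r; last first.
    by rewrite mulf_neq0.
  by rewrite -/l ler_pdivrMr ?Bpos// /g subr_ge0.
pose w := l *: v - v *m A.
have wU : (w <= U)%MS.
  rewrite addmx_sub ?scalemx_sub//.
  by rewrite (submx_trans _ UA)// eqmx_opp submxMr.
have cross w' : g (v + w') = g w' + 2 * (l * mxform B v w' - mxform (A *m B) v w').
  rewrite -[g w' in RHS]add0r -gv /g !mxformDl !mxformDr.
  rewrite (mxform_sym w' v BT) (mxform_sym w' v ABT); ring.
have gw : l * mxform B v w - mxform (A *m B) v w = mxform B w w.
  have -> : mxform (A *m B) v w = mxform B (v *m A) w.
    by rewrite /mxform mulmxA.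
  by rewrite {2}/w mxformDl mxformZl -[in RHS]scaleN1r mxformZl mulN1r.
have [w0|w0] := eqVneq w 0; first by apply/eqP; rewrite eq_sym -subr_eq0; apply/eqP.
have Bw := Bpos _ w0.
have quad t : 0 <= t * t * g w + 2 * (t * mxform B w w).
  have := gpos (v + t *: w).
  rewrite addmx_sub ?scalemx_sub// => /(_ isT); rewrite cross !mxformZr.
  rewrite -(mulrCA t) -mulrBr gw /g mxformZl !mxformZr mxformZl.
  by move=> h; apply: le_trans h _; rewrite le_eqVlt; apply/orP; left; apply/eqP; ring.
have gw0 : 0 <= g w by exact: gpos.
(* A small negative [t] contradicts [quad]; the [+ 1] covers the case [g w = 0]. *)
pose t := - (mxform B w w / (g w + 1)).
have := quad t; rewrite /t; set b := mxform B w w in Bw *; set c := g w in gw0 *.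
have c1 : 0 < c + 1 by lra.
have -> : - (b / (c + 1)) * - (b / (c + 1)) * c + 2 * (- (b / (c + 1)) * b) =
  (b / (c + 1))^+2 * (c - 2 * (c + 1)) by field; rewrite gt_eqF.
have : 0 < (b / (c + 1)) ^+ 2 by rewrite exprn_gt0 ?divr_gt0.
set d := (_ ^+ 2); move: d gw0; clear => d c0 d0 dc; exfalso; nra.
Qed.

(** Symmetry of [A *m B] says that [A] is self-adjoint for the inner product [B], so the
    [B]-orthogonal complement of an eigenvector is again stable. *)
Lemma symmetric_diagonalizable A B :
  (forall v, v != 0 -> 0 < mxform B v v) -> B^T = B ->
  (A *m B)^T = A *m B -> diagonalizable A.
Proof.
move=> Bpos BT ABT; apply/diagonalizablePeigen.
suff [rs rsP] : exists rs, (1%:M <= \sum_(r <- rs) eigenspace A r)%MS.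
  exists (undup rs); rewrite ?undup_uniq//; apply/eqmxP; rewrite submx1/=.
  apply: submx_trans rsP _; elim: rs => //= r rs IHrs; rewrite big_cons.
  rewrite addsmx_sub; apply/andP; split.
    have rrs : r \in undup (r :: rs) by rewrite mem_undup mem_head.
    by rewrite -/(undup (r :: rs)) (big_rem r rrs)/= addsmxSl.
  case: ifPn => in_rs //; apply: submx_trans IHrs _.
  by rewrite big_cons addsmxSr.
(* The induction runs over stable row spaces, by rank, because orthogonal complements inside the
   whole space are no longer the whole space. *)
suff main k m (U : 'M[R]_(m, n)) : (\rank U < k)%N -> stablemx U A ->
    exists rs, (U <= \sum_(r <- rs) eigenspace A r)%MS.
  exact: (main _ _ _ (ltnSn _) (submx1 _)).
elim: k m U => // k IHk m U rU UA.
have [->|U0] := eqVneq U 0; first by exists [::]; rewrite sub0mx.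
have [v [v0 vU [l vA]]] := exists_eigenvector Bpos BT ABT UA U0.
pose N := B *m v^T; pose U' := (U :&: kermx N)%MS.
have AN : A *m N = l *: N.
  by rewrite /N mulmxA -ABT trmx_mul BT -mulmxA -trmx_mul vA linearZ/= -scalemxAr.
have U'A : stablemx U' A.
  rewrite sub_capmx; apply/andP; split.
    by rewrite (submx_trans _ UA)// submxMr// capmxSl.
  apply/sub_kermxP; rewrite -mulmxA AN -scalemxAr.
  by rewrite (sub_kermxP (capmxSr _ _)) scaler0.
have vN w : w *m N = (mxform B w v)%:M by rewrite /N mulmxA [LHS]mx11_scalar.
have rU' : (\rank U' < \rank U)%N.
  apply: rank_ltmx; rewrite ltmxE capmxSl/=; apply/negP => UU'.
  have /sub_kermxP := submx_trans (submx_trans vU UU') (capmxSr _ _).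
  rewrite vN => /(congr1 (fun M : 'M_1 => M 0 0)); rewrite !mxE mulr1n => /eqP.
  by rewrite gt_eqF// Bpos.
have [rs rsP] := IHk _ U' (leq_trans rU' rU) U'A.
exists (l :: rs); rewrite big_cons; apply/row_subP => i.
set u := row i U; pose a := mxform B u v / mxform B v v.
have -> : u = a *: v + (u - a *: v) by rewrite addrC subrK.
rewrite addmx_sub_adds//.
  by rewrite scalemx_sub//; apply/eigenspaceP.
apply: submx_trans rsP; rewrite sub_capmx addmx_sub ?row_sub//=; last first.
  by rewrite eqmx_opp scalemx_sub.
apply/sub_kermxP; rewrite mulmxBl -scalemxAl !vN scale_scalar_mx.
by rewrite divfK ?subrr// gt_eqF// Bpos.
Qed.

Lemma codiagonalizable_basis (As : seq 'M[R]_n) :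
  {in As &, forall A B, A *m B = B *m A} ->
  {in As, forall A, diagonalizable A} ->
  exists2 P : 'M[R]_n, P \in unitmx &
    forall A, A \in As -> exists d : 'I_n -> R,
      forall i, row i P *m A = d i *: row i P.
Proof.
move=> Ac Ad; have [P Pu /allP PA] : codiagonalizable As.
  by apply/codiagonalizableP; split.
exists P => // A /PA /diagonalizable_forPex[d /(simmxP Pu) Pd].
by exists (d 0) => i; rewrite -row_mul Pd row_mul row_diag_mx -scalemxAl -rowE.
Qed.

Lemma diagonalizable_basis A : diagonalizable A ->
  exists2 P : 'M[R]_n, P \in unitmx &
    exists d : 'I_n -> R, forall i, row i P *m A = d i *: row i P.
Proof.
move=> Ad; have [|B|P Pu /(_ A)] := @codiagonalizable_basis [:: A].
- by move=> B C; rewrite !inE => /eqP-> /eqP->.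
- by rewrite inE => /eqP->.
- by rewrite mem_head => /(_ isT) PA; exists P.
Qed.

Lemma eq_mx_basis (P A B : 'M[R]_n) : P \in unitmx ->
  (forall i, row i P *m A = row i P *m B) -> A = B.
Proof.
move=> Pu PAB; apply: (can_inj (mulKmx Pu)); apply/row_matrixP => i.
by rewrite !row_mul.
Qed.

Section EigenvalueFunction.
Variables (A F : 'M[R]_n) (e : R -> R).
Hypothesis e_inj : injective e.
Hypothesis Adiag : diagonalizable A.
Hypothesis AF : forall v l, v *m A = l *: v -> v *m F = e l *: v.

(** If [c] are the coordinates of [w] in an eigenbasis of [A], then [c_j e(d_j) = c_j e(l)];
    injectivity of [e] leaves only the eigenvalue [l]. *)
Lemma eigenvector_of_function w l : w *m F = e l *: w -> w *m A = l *: w.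
Proof.
have [P Pu [d Pd]] := diagonalizable_basis Adiag.
pose c := w *m invmx P; have -> : w = c *m P by rewrite mulmxKV.
rewrite (mulmx_sum_row c P) => wF.
have : forall j, c 0 j * e (d j) = c 0 j * e l.
  move=> j; move: wF; rewrite mulmx_suml scaler_sumr.
  under eq_bigr do rewrite -scalemxAl (AF (Pd _)) scalerA.
  under [RHS]eq_bigr do rewrite scalerA mulrC.
  pose c1 := \row_j (c 0 j * e (d j)); pose c2 := \row_j (c 0 j * e l).
  move=> h; have : c1 *m P = c2 *m P.
    rewrite !mulmx_sum_row; under eq_bigr do rewrite mxE.
    by under [RHS]eq_bigr do rewrite mxE.
  by move=> /(can_inj (mulmxK Pu))/rowP/(_ j); rewrite !mxE.
move=> ce; rewrite mulmx_suml scaler_sumr; apply: eq_bigr => j _.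
rewrite -scalemxAl Pd !scalerA mulrC; congr (_ *: _).
have [->|cj] := eqVneq (c 0 j) 0; first by rewrite !mulr0.
by rewrite mulrC [RHS]mulrC; congr (_ * _); apply/e_inj/(mulfI cj)/ce.
Qed.

(** [Q] preserves the eigenspaces of [F], which are those of [A]. With [e = expR], commutation with
    [Ad (exp X)] descends to commutation with [ad X]. *)
Lemma comm_of_function Q : Q *m F = F *m Q -> Q *m A = A *m Q.
Proof.
move=> QF; have [P Pu [d Pd]] := diagonalizable_basis Adiag.
apply: (eq_mx_basis Pu) => i; rewrite !mulmxA Pd -scalemxAl.
by apply: eigenvector_of_function; rewrite -mulmxA QF mulmxA (AF (Pd i)) -scalemxAl.
Qed.

End EigenvalueFunction.

End SpectralTheorem.

(** * Differential calculus *)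

Section MeanValue.
Context {R : realType}.

Lemma derivable_along (V W : normedModType R) (f : V -> W) (p v : V) (t : R) :
  derivable f (p + t *: v) v ->
  is_derive (t : R^o) (1 : R^o) (fun s : R^o => f (p + (s : R) *: v))
    ('D_v f (p + t *: v)).
Proof.
move=> fv.
have eqf : (fun h : R => h^-1 *: (f (p + (h *: (1 : R^o) + t) *: v) - f (p + t *: v))) =
   (fun h : R => h^-1 *: (f (h *: v + (p + t *: v)) - f (p + t *: v))).
  apply/funext => h; congr (_ *: (f _ - _)).
  have -> : h *: (1 : R^o) + t = (h + t : R) by rewrite [_ *: _]mulr1.
  by rewrite scalerDl addrCA.
split; first by rewrite /derivable/= eqf.
by rewrite /derive/= eqf.
Qed.

Lemma coord_derive m n (f : R^o -> 'M[R]_(m, n)) (t : R^o) df i j :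
  is_derive t (1 : R^o) f df ->
  is_derive t (1 : R^o) (fun s : R^o => f s i j : R^o) (df i j).
Proof.
move=> [fd fE]; split; first exact: (proj1 (derivable_mxP f t 1) fd).
by rewrite -fE derive_mx// mxE.
Qed.

(** The norm is the maximum of the entries, so the scalar mean value theorem can be applied to each
    entry separately. *)
Lemma mean_value_bound m n (f df : R^o -> 'M[R]_(m, n)) (c : R) :
  (forall t : R, 0 <= t <= 1 -> is_derive (t : R^o) (1 : R^o) f (df t)) ->
  (forall t : R, 0 <= t <= 1 -> `|df t| <= c) ->
  `|f 1 - f 0| <= c.
Proof.
move=> fd dfc.
have c0 : 0 <= c by rewrite (le_trans _ (dfc 0 _))// lexx ler01.
apply: ler_mxnorm => // i j.
have fdi (t : R) : 0 <= t <= 1 ->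
    is_derive (t : R^o) (1 : R^o) (fun s : R^o => f s i j : R^o) (df t i j).
  by move=> t01; apply: coord_derive; exact: fd.
have [||t t01] := @MVT R (fun s => f s i j) (fun s => df s i j) 0 1 ltr01.
- by move=> t; rewrite in_itv/= => /andP[t0 t1]; apply: fdi; rewrite !ltW.
- apply: derivable_within_continuous => t; rewrite in_itv/= => t01.
  by have [] := fdi _ t01.
move: t01; rewrite in_itv/= => /andP[t0 t1].
rewrite !mxE subr0 mulr1 => ->.
by apply: le_trans (ler_coord _ _ _) (dfc _ _); rewrite !ltW.
Qed.

Lemma derive_linear n (V W : normedModType R) (i : {linear 'rV[R]_n -> V})
    (f : V -> W) (p : V) (v : 'rV[R]_n) :
  differentiable f p ->
  'D_(i v) f p = \sum_k v 0 k *: 'D_(i (delta_mx 0 k)) f p.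
Proof.
move=> fp; rewrite deriveE// {1}(row_sum_delta v) !linear_sum.
by apply: eq_bigr => k _; rewrite !linearZ deriveE.
Qed.

Lemma normm_segment (V : normedModType R) (q p v : V) (d t : R) :
  0 <= t <= 1 -> `|p - q| < d -> `|p + v - q| < d -> `|p + t *: v - q| < d.
Proof.
move=> /andP[t0 t1] pd vd.
have -> : p + t *: v - q = (1 - t) *: (p - q) + t *: (p + v - q).
  rewrite [p + v - q]addrAC scalerBl scale1r (scalerDr t (p - q)) addrA subrK.
  by rewrite addrAC.
rewrite (le_lt_trans (ler_normD _ _))// !normrZ (ger0_norm t0) ger0_norm ?subr_ge0//.
have [->|t0'] := eqVneq t 0; first by rewrite mul0r addr0 subr0 mul1r.
have -> : d = (1 - t) * d + t * d by ring.
apply: ler_ltD; first by apply: ler_wpM2l; [rewrite subr_ge0|exact: ltW].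
by rewrite ltr_pM2l// lt_neqAle eq_sym t0'.
Qed.

Lemma near_norm_bounded (V W : normedModType R) (f : V -> W) (p : V) :
  {for p, continuous f} -> \forall x \near p, `|f x| <= `|f p| + 1.
Proof.
move=> fp; near=> x.
have fx : `|f p - f x| <= 1.
  by near: x; move/cvgrPdist_le: fp; apply; exact: ltr01.
rewrite -[f x](subrK (f p)) (le_trans (ler_normD _ _))// addrC lerD2l.
by rewrite distrC.
Unshelve. all: by end_near. Qed.

(** Only displacements in the range of [i] are compared, typically those of one factor of a product;
    it is enough to bound the derivatives in finitely many directions near [q]. *)
Lemma C1_lipschitz n m (V : normedModType R) (i : {linear 'rV[R]_n -> V})
    (f : V -> 'rV[R]_m) (U : set V) (q : V) :
  nbhs q U -> Ck 1 U f ->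
  exists2 C : R, 0 <= C & exists2 d : R, 0 < d & forall p v,
    `|p - q| < d -> `|p + i v - q| < d -> `|f (p + i v) - f p| <= C * `|v|.
Proof.
move=> Uq [fdiff fcont].
pose e k := i (delta_mx 0 k).
pose c k := `|'D_(e k) f q| + 1.
exists (\sum_k c k); first by apply: sumr_ge0 => k _; rewrite addr_ge0.
have : \forall x \near q, U x /\ forall k, `|'D_(e k) f x| <= c k.
  apply: filterI => //; apply: filter_forall => k.
  apply: near_norm_bounded; apply: fcont; exact: nbhs_singleton Uq.
move=> /nbhs_normP[d /= d0 dP]; exists d => // p v pd vd.
pose g (t : R^o) := f (p + (t : R) *: i v).
have -> : f (p + i v) - f p = g 1 - g 0 by rewrite /g scale1r scale0r addr0.
have inU (t : R) : 0 <= t <= 1 ->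
    U (p + t *: i v) /\ forall k, `|'D_(e k) f (p + t *: i v)| <= c k.
  by move=> t01; apply: dP; rewrite /= distrC normm_segment.
apply: (@mean_value_bound _ _ g (fun t => 'D_(i v) f (p + t *: i v))) => t t01.
  by apply: derivable_along; apply: diff_derivable; apply: fdiff; exact: (inU _ t01).1.
have [Ut Dt] := inU _ t01.
rewrite derive_linear; last exact: fdiff.
rewrite (le_trans (ler_norm_sum _ _ _))// mulr_suml ler_sum// => k _.
by rewrite normrZ mulrC ler_pM// ?Dt// ler_coord.
Qed.

Lemma finite_min_pos n (d : 'I_n -> R) :
  (forall k, 0 < d k) -> exists2 e : R, 0 < e & forall k, e <= d k.
Proof.
move=> d0.
have : \forall e \near (0 : R)^'+, forall k, e <= d k.
  by apply: filter_forall => k; exact: nbhs_right_le.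
move=> dn; have [e [e0 ed]] : exists e : R, 0 < e /\ forall k, e <= d k.
  apply: (@filter_ex _ (0 : R)^'+); apply: filterI => //.
  exact: nbhs_right_gt.
by exists e.
Qed.

Lemma pairl_linear (V W : lmodType R) : linear (fun v : V => (v, 0 : W)).
Proof. by move=> l u v; congr pair; rewrite /= scaler0 addr0. Qed.

Lemma pairr_linear (V W : lmodType R) : linear (fun w : W => (0 : V, w)).
Proof. by move=> l u v; congr pair; rewrite /= scaler0 addr0. Qed.

(* Since [f (x, y) - f (x', y)] vanishes for [x = x'], its derivative in [y]
   is of size [|x - x'|]. *)
Lemma mixed_difference n m k (f : 'rV[R]_n * 'rV[R]_m -> 'rV[R]_k)
    (U : set ('rV[R]_n * 'rV[R]_m)) (a : 'rV[R]_n) (b : 'rV[R]_m) :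
  nbhs (a, b) U -> Ck 2 U f ->
  exists2 C : R, 0 <= C & exists2 d : R, 0 < d & forall x x' y y',
    `|x - a| < d -> `|x' - a| < d -> `|y - b| < d -> `|y' - b| < d ->
    `|f (x, y) - f (x', y) - f (x, y') + f (x', y')| <=
    C * (`|x - x'| * `|y - y'|).
Proof.
move=> Uq [fdiff fC1].
have [i1 i1E] := pack_linear (@pairl_linear 'rV[R]_n 'rV[R]_m).
have [i2 i2E] := pack_linear (@pairr_linear 'rV[R]_n 'rV[R]_m).
pose G j := 'D_(i2 (delta_mx 0 j)) f.
have /choice[Cd CdP] : forall j, exists Cd : R * R, [/\ 0 <= Cd.1, 0 < Cd.2 &
    forall p v, `|p - (a, b)| < Cd.2 -> `|p + i1 v - (a, b)| < Cd.2 ->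
      `|G j (p + i1 v) - G j p| <= Cd.1 * `|v|].
  move=> j; have [C C0 [d d0 Cd]] := C1_lipschitz i1 Uq (fC1 (i2 (delta_mx 0 j))).
  by exists (C, d).
have [d1 d10 d1P] : exists2 e : R, 0 < e & forall j, e <= (Cd j).2.
  by apply: finite_min_pos => j; have [] := CdP j.
have /nbhs_normP[d2 /= d20 d2P] := Uq.
exists (\sum_j (Cd j).1); first by apply: sumr_ge0 => j _; have [] := CdP j.
exists (Num.min d1 d2); first by rewrite lt_min d10.
move=> x x' y y' xa x'a yb y'b.
pose w := i2 (y - y').
have close z (t : R) : 0 <= t <= 1 -> `|z - a| < Num.min d1 d2 ->
    `|(z, y') + t *: w - (a, b)| < Num.min d1 d2.
  move=> t01 za; apply: normm_segment => //.
    by rewrite prod_normE/= gt_max za y'b.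
  by rewrite /w i2E prod_normE/= gt_max addr0 za/= (addrC y') subrK yb.
have diffz z (t : R) : 0 <= t <= 1 -> `|z - a| < Num.min d1 d2 ->
    differentiable f ((z, y') + t *: w).
  move=> t01 za; apply: fdiff; apply: d2P; rewrite /= distrC.
  by rewrite (lt_le_trans (close _ _ t01 za))// ge_min lexx orbT.
(* [g] moves [y'] to [y]; its derivative compares one partial derivative of [f] at [x] and at [x'],
   to which [C1_lipschitz] applies. *)
pose g (t : R^o) := f ((x, y') + (t : R) *: w) - f ((x', y') + (t : R) *: w).
have -> : f (x, y) - f (x', y) - f (x, y') + f (x', y') = g 1 - g 0.
  rewrite /g !scale1r !scale0r !addr0 /w i2E.
  have addw (z : 'rV[R]_n) : (z, y') + (0, y - y') = (z, y).
    by congr pair; rewrite /= ?addr0// (addrC y') subrK.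
  by rewrite !addw opprB addrA addrAC.
apply: (@mean_value_bound _ _ g
  (fun t => 'D_w f ((x, y') + t *: w) - 'D_w f ((x', y') + t *: w))) => t t01.
  by apply: is_deriveB; apply: derivable_along; apply: diff_derivable; exact: diffz.
rewrite /w !derive_linear -?/w; [|exact: diffz..].
rewrite -sumrB (le_trans (ler_norm_sum _ _ _))// mulr_suml ler_sum// => j _.
rewrite -scalerBr normrZ [leLHS]mulrC mulrA ler_pM// ?ler_coord//.
have [_ _] := CdP j; set p := (x', y') + t *: w.
have pE : (x, y') + t *: w = p + i1 (x - x').
  rewrite /p addrAC i1E; congr (_ + _).
  by congr pair; rewrite /= ?addr0// (addrC x') subrK.
rewrite pE; apply; first by rewrite (lt_le_trans (close _ _ t01 x'a))// ge_min d1P.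
by rewrite -pE (lt_le_trans (close _ _ t01 xa))// ge_min d1P.
Qed.

End MeanValue.

(** * First-order approximation *)

Section FirstOrder.
Context {R : realType}.

(** Differentiability with explicit [e] and [d], so that the estimates can be composed by hand. [L]
    is only linear; where its boundedness matters it is a separate hypothesis, automatic on row
    vectors. *)
Definition approx (V W : normedModType R) (f : V -> W) (x : V) (L : V -> W) : Prop :=
  linear L /\ forall e : R, 0 < e -> exists2 d : R, 0 < d &
    forall y, `|y - x| < d -> `|f y - f x - L (y - x)| <= e * `|y - x|.

Lemma approx_near (V W : normedModType R) (f g : V -> W) x L (r : R) :
  0 < r -> (forall y, `|y - x| < r -> f y = g y) -> approx f x L -> approx g x L.
Proof.
move=> r0 fg [Llin fL]; split=> // e /fL[d d0 fe].
exists (Num.min d r); first by rewrite lt_min d0.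
move=> y; rewrite lt_min => /andP[yd yr].
by rewrite -!fg ?subrr ?normr0//; exact: fe.
Qed.

Lemma approx_is_derive (V W : normedModType R) (f : V -> W) x L v :
  approx f x L -> is_derive x v f (L v).
Proof.
move=> [/pack_linear[g <-] fL].
suff cv : h^-1 *: (f (h *: v + x) - f x) @[h --> (0 : R)^'] --> g v.
  split; first exact: cvgP cv.
  by apply: cvg_lim cv; exact: norm_hausdorff.
apply/cvgrPdist_le => /= e e0.
have v0 : 0 < `|v| + 1 by rewrite ltr_wpDl.
have [d d0 fd] := fL _ (divr_gt0 e0 v0).
have dv0 : 0 < d / (`|v| + 1) by rewrite divr_gt0.
near=> h.
have h0 : h != 0 by near: h; exact: nbhs_dnbhs_neq.
have hd : `|h| * `|v| < d.
  rewrite (@le_lt_trans _ _ (`|h| * (`|v| + 1)))//.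
    by rewrite ler_wpM2l// lerDl.
  by rewrite -ltr_pdivlMr//; near: h; exact: (@dnbhs0_lt R R^o).
have -> : g v - h^-1 *: (f (h *: v + x) - f x) =
    - h^-1 *: (f (h *: v + x) - f x - g (h *: v)).
  have -> : g v = h^-1 *: g (h *: v) by rewrite linearZ/= scalerA mulVf// scale1r.
  by rewrite -scalerBr scaleNr -scalerN [in RHS]opprB.
have := fd (h *: v + x); rewrite addrK normrZ => /(_ hd) fh.
rewrite normrZ normrN normfV ler_pdivrMl ?normr_gt0//.
apply: le_trans fh _; rewrite mulrCA ler_wpM2l//.
by rewrite mulrAC ler_pdivrMr// ler_wpM2l ?ltW// ltrDl.
Unshelve. all: by end_near. Qed.

Lemma approx_derive (V W : normedModType R) (f : V -> W) x L v :
  approx f x L -> 'D_v f x = L v.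
Proof. by move=> /(@approx_is_derive _ _ _ _ _ v)[]. Qed.

Lemma is_derive_approx (W : normedModType R) (f : R^o -> W) (t : R^o) df :
  is_derive t (1 : R^o) f df -> approx f t (fun h : R^o => (h : R) *: df).
Proof.
move=> [fd fE]; split=> [l u v|e e0]; first by rewrite scalerDl scalerA.
have : h^-1 *: (f (h *: (1 : R^o) + t) - f t) @[h --> (0 : R)^'] --> df.
  by rewrite -fE; exact: fd.
move=> /cvgrPdist_le /(_ _ e0) /nbhs_normP[d /= d0 dP].
exists d => // y yd; have [->|yt] := eqVneq y t.
  by rewrite !subrr scale0r subrr !normr0 mulr0.
have h0 : y - t != 0 by rewrite subr_eq0.
have := dP (y - t); rewrite /= sub0r normrN => /(_ yd h0).
have -> : (y - t) *: (1 : R^o) + t = y by rewrite [_ *: _]mulr1 subrK.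
move=> fy; rewrite -normrN opprB.
have -> : (y - t) *: df - (f y - f t) = (y - t) *: (df - (y - t)^-1 *: (f y - f t)).
  by rewrite scalerBr scalerA mulfV// scale1r.
by rewrite normrZ mulrC ler_wpM2r.
Qed.

Lemma differentiable_approx (V W : normedModType R) (f : V -> W) x :
  differentiable f x -> approx f x (fun v => 'D_v f x).
Proof.
move=> fx; split=> [l u v|e e0]; first by rewrite !deriveE// linearP.
have /eqaddoP/(_ _ e0)/nbhs_normP[d /= d0 fd] := diff_locally fx.
exists d => // y yd; have := fd (y - x).
rewrite /= sub0r normrN => /(_ yd).
by rewrite !fctE/= subrK opprD addrA deriveE.
Qed.

Lemma approx_bounded (V W : normedModType R) (f : V -> W) x L :
  (exists2 C : R, 0 <= C & forall v, `|L v| <= C * `|v|) ->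
  approx f x L -> exists2 C : R, 0 < C & exists2 d : R, 0 < d &
    forall y, `|y - x| < d -> `|f y - f x| <= C * `|y - x|.
Proof.
move=> [C C0 LC] [Llin fL].
have [d d0 fd] := fL 1 ltr01.
exists (C + 1); first by rewrite ltr_wpDl.
exists d => // y yd; rewrite -[f y - f x](subrK (L (y - x))).
rewrite (le_trans (ler_normD _ _))// mulrDl addrC lerD//.
exact: fd.
Qed.

Lemma approx_comp m (V W : normedModType R) (f : V -> 'rV[R]_m)
    (h : 'rV[R]_m -> W) x Lf Lh :
  (exists2 C : R, 0 <= C & forall v, `|Lf v| <= C * `|v|) ->
  approx f x Lf -> approx h (f x) Lh -> approx (h \o f) x (Lh \o Lf).
Proof.
move=> bf fa ha; have [Cf Cf0 [df df0 fC]] := approx_bounded bf fa.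
move: fa ha => [Lfl fL] [Lhl hL].
split=> [l u v /=|e e0]; first by rewrite Lfl Lhl.
have [C C0 LC] := linear_bounded Lhl.
have e1 : 0 < e / (2 * Cf) by rewrite divr_gt0// mulr_gt0.
have e2 : 0 < e / (2 * (C + 1)) by rewrite divr_gt0// mulr_gt0// ltr_wpDl.
have [d1 d10 hd1] := hL _ e1; have [d2 d20 fd2] := fL _ e2.
exists (Num.min (Num.min df d2) (d1 / Cf)).
  by rewrite !lt_min df0 d20 divr_gt0.
move=> y; rewrite !lt_min => /andP[/andP[ydf yd2] yd1].
have fy := fC _ ydf.
have fyd : `|f y - f x| < d1.
  by rewrite (le_lt_trans fy)// mulrC -ltr_pdivlMr.
have -> : (h \o f) y - (h \o f) x - (Lh \o Lf) (y - x) =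
   (h (f y) - h (f x) - Lh (f y - f x)) + Lh (f y - f x - Lf (y - x)).
  move: Lhl LC => /pack_linear[g <-] _ /=.
  by rewrite (linearB g (f y - f x)) addrA subrK.
rewrite (le_trans (ler_normD _ _))// [e]splitr mulrDl lerD//.
  apply: le_trans (hd1 _ fyd) _.
  apply: le_trans (ler_wpM2l (ltW e1) fy) _.
  rewrite mulrA ler_wpM2r// le_eqVlt; apply/orP; left; apply/eqP.
  by field; rewrite gt_eqF.
apply: le_trans (LC _) _; rewrite (le_trans (ler_wpM2l C0 (fd2 _ yd2)))//.
rewrite mulrA ler_wpM2r//.
have C1 : 0 < C + 1 by rewrite ltr_wpDl.
rewrite mulrCA ler_wpM2l ?(ltW e0)// invfM mulrCA ler_piMr// ?invr_ge0//.
by rewrite ler_pdivrMr// mul1r lerDl.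
Qed.

Lemma approx_id (V : normedModType R) (x : V) : approx id x id.
Proof.
by split=> // e e0; exists 1 => // y _; rewrite subrr normr0 mulr_ge0// ltW.
Qed.

Lemma approx_lincomb (V W : normedModType R) (f h : V -> W) x Lf Lh (k : R) :
  approx f x Lf -> approx h x Lh ->
  approx (fun y => k *: f y + h y) x (fun v => k *: Lf v + Lh v).
Proof.
move=> [/pack_linear[gf <-] fL] [/pack_linear[gh <-] hL].
split=> [l u v|e e0]; first by rewrite (linearP gf) (linearP gh) /=
  !scalerDr !scalerA mulrC addrACA.
have k1 : 0 < 2 * (`|k| + 1) by rewrite mulr_gt0// ltr_wpDl.
have [d1 d10 fd] := fL _ (divr_gt0 e0 k1).
have [d2 d20 hd] := hL _ (divr_gt0 e0 (ltr0n R 2)).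
exists (Num.min d1 d2); first by rewrite lt_min d10.
move=> y; rewrite lt_min => /andP[/fd fy /hd hy].
have -> : k *: f y + h y - (k *: f x + h x) - (k *: gf (y - x) + gh (y - x)) =
    k *: (f y - f x - gf (y - x)) + (h y - h x - gh (y - x)).
  rewrite (scalerBr k (f y - f x)) (scalerBr k (f y)).
  by rewrite !opprD [k *: f y + _ + _]addrACA [LHS]addrACA.
rewrite (le_trans (ler_normD _ _))// [e]splitr mulrDl lerD//.
rewrite normrZ (le_trans (ler_wpM2l _ fy))// mulrA ler_wpM2r//.
rewrite mulrCA ler_wpM2l ?(ltW e0)// ler_pdivrMr// mulKf ?pnatr_eq0//.
by rewrite lerDl.
Qed.

Lemma approx_fst (V1 V2 W : normedModType R) (f : V1 * V2 -> W) a b L :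
  approx f (a, b) L -> approx (fun x => f (x, b)) a (fun v => L (v, 0)).
Proof.
move=> [Ll fL]; split=> [l u v|e /fL[d d0 fd]].
  by rewrite pairl_linear Ll.
exists d => // y yd; have := fd (y, b).
have -> : (y, b) - (a, b) = (y - a, 0) by congr pair; rewrite /= subrr.
by rewrite prod_normE/= normr0 max_l//; apply.
Qed.

Lemma approx_snd (V1 V2 W : normedModType R) (f : V1 * V2 -> W) a b L :
  approx f (a, b) L -> approx (fun x => f (a, x)) b (fun v => L (0, v)).
Proof.
move=> [Ll fL]; split=> [l u v|e /fL[d d0 fd]].
  by rewrite pairr_linear Ll.
exists d => // y yd; have := fd (a, y).
have -> : (a, y) - (a, b) = (0, y - b) by congr pair; rewrite /= subrr.
by rewrite prod_normE/= normr0 max_r//; apply.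
Qed.

End FirstOrder.

(** * Charts and one-parameter subgroups *)

Section TopologicalGroup.
Variable G : topGroupType.
Implicit Types (g h : G) (N K : set G).

Lemma cvg_mulg (T : Type) (F : set_system T) (f1 f2 : T -> G) g h :
  Filter F -> f1 @ F --> g -> f2 @ F --> h ->
  (f1 x * f2 x)%g @[x --> F] --> (g * h)%g.
Proof.
move=> FF f1g f2h.
exact: (cvg_comp2 f1g f2h (@continuous_mulg G (g, h))).
Qed.

Lemma cvg_invg (T : Type) (F : set_system T) (f : T -> G) g :
  Filter F -> f @ F --> g -> (f x)^-1%g @[x --> F] --> (g^-1)%g.
Proof. by move=> FF fg; apply: cvg_comp fg _; exact: continuous_invg. Qed.

Lemma nbhs_mulg g h N : nbhs (g * h)%g N ->
  \forall x \near g & y \near h, N (x * y)%g.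
Proof.
by move=> Ngh; exact: (cvg_mulg _ cvg_fst cvg_snd Ngh).
Qed.

(** Every conjugation fixes [1], and compactness of [K] makes its continuity there uniform in the
    conjugating element. *)
Lemma compact_conj_nbhs K N : compact K -> nbhs 1%g N ->
  exists2 N', nbhs 1%g N' & forall k x, K k -> N' x -> N (k * x * k^-1)%g.
Proof.
move=> /compact_near_coveringP Kc N1.
have := Kc G (nbhs 1%g) (fun x k => N (k * x * k^-1)%g).
have near_k k : K k -> \forall k' \near k & x \near (1%g : G), N (k' * x * k'^-1)%g.
  move=> _.
  have cv : (p.1 * p.2 * p.1^-1)%g @[p --> (nbhs k, nbhs (1%g : G))] -->
      (k * 1 * k^-1)%g.
    apply: cvg_mulg; last by apply: cvg_invg; exact: cvg_fst.
    by apply: cvg_mulg; [exact: cvg_fst|exact: cvg_snd].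
  by apply: cv; rewrite mulg1 mulgV.
move=> /(_ _ near_k) H; exists [set x | forall k, K k -> N (k * x * k^-1)%g].
  exact: H.
by move=> k x Kk; apply.
Qed.

End TopologicalGroup.

Section Chart.
Context {R : realType} {n : nat} {G : topGroupType}.
Variable c : chart R n G.
Notation E := 'rV[R]_n.
Implicit Types (x y : E) (g h : G).

Definition lcoord g : E := chart_map c g - chart_map c 1%g.

Lemma lcoordE g : lcoord g = chart_map c g - chart_map c 1%g. Proof. by []. Qed.

Definition lpoint x : G := chart_inv c (x + chart_map c 1%g).

Definition small (r : R) : set G := [set g | chart_dom c g /\ `|lcoord g| < r].

Hypothesis c1 : chart_dom c 1%g.

Lemma lcoord1 : lcoord 1%g = 0. Proof. exact: subrr. Qed.

Lemma lcoordK g : chart_dom c g -> lpoint (lcoord g) = g.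
Proof. by move=> cg; rewrite /lpoint subrK chart_mapK. Qed.

Lemma lpoint0 : lpoint 0 = 1%g. Proof. by rewrite -lcoord1 lcoordK. Qed.

Lemma near_lcoord1 : lcoord g @[g --> (1%g : G)] --> (0 : E).
Proof.
rewrite -lcoord1; exact: (cvgB (chart_map_continuous c1) (cvg_cst _)).
Qed.

Lemma nbhs_small r : 0 < r -> nbhs 1%g (small r).
Proof.
move=> r0; apply: filterI.
  by apply: open_nbhs_nbhs; split=> //; exact: open_chart_dom.
exact: (near_lcoord1 (@nbhs0_lt R E r r0)).
Qed.

Lemma near_lpoint0 : lpoint x @[x --> (0 : E)] --> (1%g : G).
Proof.
have c0 : chart_cod c (0 + chart_map c 1%g) by rewrite add0r; exact: chart_map_cod.
rewrite -lpoint0.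
exact: (cvg_comp _ _ (cvgD cvg_id (cvg_cst _)) (chart_inv_continuous c0)).
Qed.

Lemma small_nbhs N : nbhs (1%g : G) N -> exists2 r, 0 < r & small r `<=` N.
Proof.
move=> /near_lpoint0 /nbhs_normP[r /= r0 rN]; exists r => // g [cg gr].
by rewrite -[g]lcoordK//; apply: rN; rewrite /= sub0r normrN.
Qed.

Lemma lpointK_near : exists2 r, 0 < r & forall x, `|x| < r ->
  chart_dom c (lpoint x) /\ lcoord (lpoint x) = x.
Proof.
have : \forall x \near (0 : E), chart_cod c (x + chart_map c 1%g).
  have cv : (x + chart_map c 1%g) @[x --> (0 : E)] --> 0 + chart_map c 1%g.
    exact: (cvgD cvg_id (cvg_cst _)).
  have cod1 : nbhs (0 + chart_map c 1%g) (chart_cod c).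
    rewrite add0r; apply: open_nbhs_nbhs; split; first exact: open_chart_cod.
    exact: chart_map_cod.
  exact: (cv _ cod1).
move=> /nbhs_normP[r /= r0 rP]; exists r => // x xr.
have cx : chart_cod c (x + chart_map c 1%g) by apply: rP; rewrite /= sub0r normrN.
by split; [exact: chart_inv_dom|rewrite /lcoord chart_invK// addrK].
Qed.

End Chart.

Section LocalMultiplication.
Context {R : realType} {n : nat} {G : topGroupType}.
Variables (atlas : set (chart R n G)) (c : chart R n G).
Notation E := 'rV[R]_n.
Notation lcoord := (lcoord c).
Notation lpoint := (lpoint c).
Notation small := (small c).
Hypothesis GL : lie_group atlas.
Hypothesis atc : atlas c.
Hypothesis c1 : chart_dom c 1%g.

(** A bound on the second difference of the product, from which the later local estimates are drawn.
    At [g' = h' = 1] it says that coordinates add up to [C |g| |h|]; other choices compare squaring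
    with doubling. *)
Definition mul_bound (C d : R) : Prop :=
  [/\ 0 <= C, 0 < d,
      forall g h, small d g -> small d h -> chart_dom c (g * h)%g,
      forall g g' h h', small d g -> small d g' -> small d h -> small d h' ->
        `|lcoord (g * h)%g - lcoord (g' * h)%g - lcoord (g * h')%g + lcoord (g' * h')%g|
          <= C * (`|lcoord g - lcoord g'| * `|lcoord h - lcoord h'|) &
      forall x, `|x| < d -> chart_dom c (lpoint x) /\ lcoord (lpoint x) = x].

Lemma near_chart_mul (d1 d2 d3 : chart R n G) g h :
  chart_dom d1 g -> chart_dom d2 h -> chart_dom d3 (g * h)%g ->
  nbhs (chart_map d1 g, chart_map d2 h)
    [set xy : E * E | [/\ chart_cod d1 xy.1, chart_cod d2 xy.2 &
      chart_dom d3 (chart_inv d1 xy.1 * chart_inv d2 xy.2)%g]].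
Proof.
move=> g1 h2 gh3.
have cod1 := chart_map_cod g1; have cod2 := chart_map_cod h2.
have n1 : nbhs (chart_map d1 g) (chart_cod d1).
  by apply: open_nbhs_nbhs; split=> //; exact: open_chart_cod.
have n2 : nbhs (chart_map d2 h) (chart_cod d2).
  by apply: open_nbhs_nbhs; split=> //; exact: open_chart_cod.
have n3 : nbhs (chart_inv d1 (chart_map d1 g) * chart_inv d2 (chart_map d2 h))%g
    (chart_dom d3).
  by rewrite !chart_mapK//; apply: open_nbhs_nbhs; split=> //; exact: open_chart_dom.
have cv : (chart_inv d1 xy.1 * chart_inv d2 xy.2)%g
    @[xy --> (nbhs (chart_map d1 g), nbhs (chart_map d2 h))] -->
    (chart_inv d1 (chart_map d1 g) * chart_inv d2 (chart_map d2 h))%g.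
  apply: cvg_mulg.
    refine (cvg_comp fst (chart_inv d1) cvg_fst (chart_inv_continuous cod1)).
  refine (cvg_comp snd (chart_inv d2) cvg_snd (chart_inv_continuous cod2)).
have m3 := cv _ n3.
have m1 := cvg_fst n1; have m2 := cvg_snd n2.
near=> xy; split; near: xy; [exact: m1|exact: m2|exact: m3].
Unshelve. all: by end_near. Qed.

Lemma mul_bound_exists : exists C d, mul_bound C d.
Proof.
have [_ _ _ smul _] := GL.
have g1 : chart_dom c (1 * 1)%g by rewrite mulg1.
have Un := near_chart_mul c1 c1 g1.
have [C C0 [d d0 Cd]] := mixed_difference Un (smul _ _ _ atc atc atc 2).
move: Un => /nbhs_normP[r1 /= r10 r1U].
have [r2 r20 r2P] := lpointK_near c1.
pose r := Num.min d (Num.min r1 r2).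
have rP g : small r g -> [/\ chart_dom c g,
    `|chart_map c g - chart_map c 1%g| < d & `|chart_map c g - chart_map c 1%g| < r1].
  by move=> [cg]; rewrite !lt_min => /and3P[].
exists C, r; split=> //.
- by rewrite !lt_min d0 r10.
- move=> g h /rP[cg _ gr] /rP[ch _ hr].
  have [] := r1U (chart_map c g, chart_map c h).
    by rewrite /= prod_normE/= gt_max distrC gr distrC hr.
  by rewrite /= !chart_mapK.
- move=> g g' h h' /rP[cg gd _] /rP[cg' gd' _] /rP[ch hd _] /rP[ch' hd' _].
  have := Cd _ _ _ _ gd gd' hd hd'; rewrite /= !chart_mapK// => Cd'.
  have sub (a b x : E) : a - x - (b - x) = a - b by rewrite opprB addrA subrK.
  rewrite !lcoordE !sub; apply: le_trans Cd'; rewrite le_eqVlt; apply/orP; left.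
  apply/eqP; congr `|_|; set x := chart_map c 1%g.
  by rewrite -[LHS]addrA -[RHS]addrA; congr (_ + _); rewrite opprB addrC subrKA addrC.
- by move=> x; rewrite !lt_min => /and3P[_ _ xr]; exact: r2P.
Qed.

End LocalMultiplication.

(** * Uniqueness of one-parameter subgroups *)

Section OneParameterSubgroups.
Context {R : realType} {n : nat} {G : topGroupType}.
Variable c : chart R n G.
Notation E := 'rV[R]_n.
Notation lcoord := (lcoord c).
Notation lpoint := (lpoint c).
Notation small := (small c).
Notation ops := (one_parameter_subgroup c).
Hypothesis c1 : chart_dom c 1%g.
Implicit Types (X Y : E) (gam : R -> G) (g h : G).

Section Bounds.
Variables C d : R.
Hypothesis CdP : mul_bound c C d.

Let d0 : 0 < d. Proof. by case: CdP. Qed.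

Lemma small1 r : 0 < r -> small r 1%g.
Proof. by move=> r0; split=> //; rewrite lcoord1 normr0. Qed.

Lemma mul_dom g h : small d g -> small d h -> chart_dom c (g * h)%g.
Proof. by case: CdP => _ _ H _ _; exact: H. Qed.

Lemma lcoord_mul g h : small d g -> small d h ->
  `|lcoord (g * h)%g - lcoord g - lcoord h| <= C * (`|lcoord g| * `|lcoord h|).
Proof.
case: CdP => _ _ _ H _ gd hd; have := H _ _ _ _ gd (small1 d0) hd (small1 d0).
by rewrite !mulg1 !mul1g lcoord1 !subr0 addr0 addrAC.
Qed.

(** Passes from [g * g] to [h * h] through [h * g], changing one factor at a time. *)
Lemma lcoord_sqr_lipschitz g h : small d g -> small d h ->
  `|lcoord (g * g)%g - lcoord (h * h)%g - 2 *: (lcoord g - lcoord h)| <=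
  C * (`|lcoord g| + `|lcoord h|) * `|lcoord g - lcoord h|.
Proof.
case: CdP => _ _ _ H _ gd hd.
have H1 := H _ _ _ _ gd hd gd (small1 d0).
have H2 := H _ _ _ _ hd (small1 d0) gd hd.
move: H1 H2; rewrite !mulg1 !mul1g lcoord1 !subr0 => H1 H2.
set a := lcoord g in H1 H2 *; set b := lcoord h in H1 H2 *.
set gg := lcoord _ in H1 H2 *; set hg := lcoord (h * g)%g in H1 H2 *.
set hh := lcoord (h * h)%g in H1 H2 *.
have -> : gg - hh - 2 *: (a - b) = (gg - hg - a + b) + (hg - a - hh + b).
  by apply/rowP => i; rewrite !mxE; ring.
rewrite (le_trans (ler_normD _ _))// mulrDr mulrDl lerD//.
  by rewrite -mulrA (mulrC `|a|).
by rewrite -mulrA.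
Qed.

End Bounds.

Lemma ops1 X gam : ops X gam -> gam 0 = 1%g.
Proof.
move=> [_ gD _]; have := gD 0 0; rewrite addr0 => h.
by apply: (mulgI (gam 0)); rewrite mulg1 -h.
Qed.

Lemma ops_derive X gam e : ops X gam -> 0 < e ->
  exists2 d : R, 0 < d & forall h : R, `|h| < d -> `|lcoord (gam h) - h *: X| <= e * `|h|.
Proof.
move=> opsX e0; have [_ _ gX] := opsX.
have [_ /(_ _ e0)[d d0 dP]] := is_derive_approx gX.
exists d => // h hd; have := dP h; rewrite subr0 => /(_ hd).
by rewrite /= (ops1 opsX).
Qed.

Lemma ops_intro X gam : continuous gam ->
  (forall s t, gam (s + t) = (gam s * gam t)%g) ->
  (forall e, 0 < e -> exists2 d : R, 0 < d & forall h : R, `|h| < d ->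
    `|lcoord (gam h) - h *: X| <= e * `|h|) -> ops X gam.
Proof.
move=> gcont gD gX; split=> //.
have g1 : gam 0 = 1%g.
  by have := gD 0 0; rewrite addr0 => h; apply: (mulgI (gam 0)); rewrite mulg1 -h.
have ap : approx (chart_map c \o gam : R^o -> E) (0 : R^o) (fun h : R^o => (h : R) *: X).
  split=> [l u v|e /gX[d d0 dP]]; first by rewrite scalerDl scalerA.
  by exists d => // h; rewrite subr0 => hd; rewrite /= g1; exact: dP.
by have := approx_is_derive (1 : R^o) ap; rewrite scale1r.
Qed.

Lemma ops_rescale X gam t : ops X gam -> ops (t *: X) (fun s => gam (s * t)).
Proof.
move=> opsX; have [gcont gD _] := opsX; apply: ops_intro.
- move=> s; apply: continuous_comp; last exact: gcont.
  exact: mulrr_continuous.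
- by move=> s s'; rewrite mulrDl gD.
- move=> e e0; have t0 : 0 < `|t| + 1 by rewrite ltr_wpDl.
  have [d d0 dP] := ops_derive opsX (divr_gt0 e0 t0).
  exists (d / (`|t| + 1)); first exact: divr_gt0.
  move=> h; rewrite ltr_pdivlMr// => hd.
  have ht : `|h| * `|t| <= `|h| * (`|t| + 1) by rewrite ler_wpM2l// lerDl.
  rewrite scalerA (le_trans (dP _ _))//; first by rewrite normrM (le_lt_trans ht).
  rewrite normrM mulrAC ler_pdivrMr// -mulrA ler_wpM2l ?(ltW e0)//.
Qed.

(** Existence stays a hypothesis until [has_exp_all] derives it from the Cartan decomposition. *)
Definition has_exp X := exists gam, ops X gam.

Section DyadicDescent.
Variables C d : R.
Hypothesis CdP : mul_bound c C d.

Let C0 : 0 <= C. Proof. by case: CdP. Qed.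
Let d0 : 0 < d. Proof. by case: CdP. Qed.

Notation half j := ((2 : R) ^- j).

Lemma half_gt0 j : 0 < half j. Proof. by rewrite invr_gt0 exprn_gt0. Qed.

Lemma half_small (r : R) : 0 < r -> exists J, forall j, (J <= j)%N -> half j < r.
Proof.
move=> r0; exists (Num.bound r^-1) => j /upper_nthrootP h.
by rewrite -[ltRHS]invrK ltf_pV2 ?posrE ?exprn_gt0 ?invr_gt0.
Qed.

Lemma ops_half X gam j : ops X gam -> gam (half j) = (gam (half j.+1) * gam (half j.+1))%g.
Proof.
move=> [_ gD _]; rewrite -gD; congr gam.
rewrite exprSr invfM -mulrDr -[LHS]mulr1; congr (_ * _); by field.
Qed.

(* In coordinates doubling is [x |-> 2 x] up to a quadratic error; starting
   from the tangent vector at a small scale and doubling back, the errors form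
   a geometric series. *)
Lemma ops_dyadic_bound X gam e : ops X gam -> 0 < e ->
  4 * C * (`|X| + e) <= 1 -> 2 * (`|X| + e) < d ->
  forall j, [/\ small d (gam (half j)),
    `|2 ^+ j *: lcoord (gam (half j)) - X| <= e + 4 * C * (`|X| + e) ^+ 2 * half j &
    `|lcoord (gam (half j))| <= 2 * (`|X| + e) * half j].
Proof.
move=> opsX e0; set m := `|X| + e => Cm md.
have m0 : 0 < m by rewrite ltr_wpDl.
have [r r0 rP] := ops_derive opsX e0.
have gsmall : \forall h \near (0 : R), small d (gam h).
  have [gcont _ _] := opsX.
  by apply: gcont; rewrite (ops1 opsX); exact: nbhs_small.
move: gsmall => /nbhs_normP[r' /= r'0 r'P].
have [|J JP] := @half_small (Num.min r r'); first by rewrite lt_min r0.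
(* At very small scales the derivative at [0] gives the claim with error [e] alone. *)
have base j : (J <= j)%N -> small d (gam (half j)) /\
    `|2 ^+ j *: lcoord (gam (half j)) - X| <= e + 4 * C * m ^+ 2 * half j.
  move=> /JP; rewrite lt_min => /andP[jr jr']; split.
    by apply: r'P; rewrite /= sub0r normrN gtr0_norm ?half_gt0.
  have := rP (half j); rewrite gtr0_norm ?half_gt0// => /(_ jr) h.
  have -> : 2 ^+ j *: lcoord (gam (half j)) - X =
      2 ^+ j *: (lcoord (gam (half j)) - half j *: X).
    by rewrite (scalerBr (2 ^+ j) (lcoord (gam (half j)))) scalerA
      mulfV ?scale1r ?expf_neq0 ?pnatr_eq0.
  rewrite normrZ ger0_norm ?exprn_ge0//.
  rewrite (@le_trans _ _ e)//; last by rewrite lerDl !mulr_ge0 ?exprn_ge0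
    ?invr_ge0 ?exprn_ge0// ltW.
  by rewrite -ler_pdivlMl ?exprn_gt0// mulrC.
have half_le1 j : half j <= 1 by rewrite invf_le1 ?exprn_gt0// exprn_ege1// ler1n.
(* Since [4 * C * m <= 1], the quadratic error is at most [m], which keeps the rescaled coordinates
   below [2 * m]. *)
have bound j (z : E) : `|z - X| <= e + 4 * C * m ^+ 2 * half j -> `|z| <= 2 * m.
  move=> zX; have := ler_normD (z - X) X; rewrite subrK => zle.
  apply: le_trans zle _.
  have Cm2 : 4 * C * m ^+ 2 * half j <= m.
    rewrite (@le_trans _ _ (4 * C * m ^+ 2))//; last first.
      by rewrite expr2 mulrA ler_piMl// ltW.
    by rewrite ler_piMr// mulr_ge0 ?exprn_ge0 ?(ltW m0)// mulr_ge0.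
  have : `|z - X| + `|X| <= (e + m) + `|X| by rewrite lerD2r (le_trans zX)// lerD2l.
  by rewrite /m; move: `|X| `|z - X| => a b; lra.
have step j : small d (gam (half j.+1)) /\
    `|2 ^+ j.+1 *: lcoord (gam (half j.+1)) - X| <= e + 4 * C * m ^+ 2 * half j.+1 ->
  small d (gam (half j)) /\
    `|2 ^+ j *: lcoord (gam (half j)) - X| <= e + 4 * C * m ^+ 2 * half j.
  move=> [gd gX]; have ym := bound _ _ gX.
  have halfE : half j = 2 * half j.+1.
    by rewrite exprS invfM mulVKf ?pnatr_eq0.
  have cg : chart_dom c (gam (half j)) by rewrite (ops_half _ opsX); exact: (mul_dom CdP).
  have := lcoord_mul CdP gd gd; rewrite -(ops_half _ opsX).
  set z := lcoord (gam (half j)); move: gX ym; set x := lcoord (gam (half j.+1)).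
  set s := half j.+1 in halfE *; have s0 : 0 < s by exact: half_gt0.
  have E1 : 2 ^+ j.+1 = s^-1 by rewrite invrK.
  have E2 : 2 ^+ j = (2 * s)^-1 by rewrite -halfE invrK.
  rewrite E1 E2 => yX ym zx.
  have xm : `|x| <= 2 * m * s.
    have sV0 : 0 < s^-1 by rewrite invr_gt0.
    by move: ym; rewrite normrZ (gtr0_norm sV0) (mulrC s^-1) ler_pdivrMr.
  (* Doubling at scale [s] costs at most [C (2 m s)^2 / (2 s) = 2 C m^2 s], within the increase
     [4 C m^2 s] of the allowed error. *)
  have zX : `|(2 * s)^-1 *: z - X| <= e + 4 * C * m ^+ 2 * (2 * s).
    have -> : (2 * s)^-1 *: z - X = (2 * s)^-1 *: (z - x - x) + (s^-1 *: x - X).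
      apply/rowP => i; rewrite !mxE; field; exact: lt0r_neq0.
    apply: le_trans (ler_normD _ _) _.
    have s20 : 0 < 2 * s by rewrite mulr_gt0.
    have h1 : `|(2 * s)^-1 *: (z - x - x)| <= 2 * C * m ^+ 2 * s.
      rewrite normrZ gtr0_norm ?invr_gt0// ler_pdivrMl//.
      apply: le_trans zx _.
      have -> : 2 * s * (2 * C * m ^+ 2 * s) = C * ((2 * m * s) * (2 * m * s)) by ring.
      by rewrite ler_wpM2l// ler_pM.
    have h2 : 0 <= C * m ^+ 2 * s by rewrite !mulr_ge0 ?exprn_ge0// ltW.
    apply: le_trans (lerD h1 yX) _; move: h2.
    have -> : 2 * C * m ^+ 2 * s = 2 * (C * m ^+ 2 * s) by ring.
    have -> : 4 * C * m ^+ 2 * s = 4 * (C * m ^+ 2 * s) by ring.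
    have -> : 4 * C * m ^+ 2 * (2 * s) = 8 * (C * m ^+ 2 * s) by ring.
    move: (C * m ^+ 2 * s) => q; lra.
  have hj0 := half_gt0 j; have hjV0 : 0 < (half j)^-1 by rewrite invr_gt0.
  rewrite invrK; move: zX; rewrite -!halfE => zX; split=> //; split=> //.
  have := bound j _ zX.
  rewrite normrZ (gtr0_norm hjV0) ler_pdivrMl// => zm.
  apply: le_lt_trans zm _; apply: le_lt_trans md.
  by rewrite ler_piMl// mulr_ge0// ltW.
(* [k] counts the doublings down to scale [j]; [k := J] serves for all [j]. *)
have desc k j : (J <= j + k)%N -> small d (gam (half j)) /\
    `|2 ^+ j *: lcoord (gam (half j)) - X| <= e + 4 * C * m ^+ 2 * half j.
  elim: k j => [|k IHk] j Jj; first by apply: base; rewrite -(addn0 j).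
  by apply: step; apply: IHk; rewrite addSnnS.
move=> j; have [gd gX] := desc J j (leq_addl _ _); split=> //.
have := bound _ _ gX; rewrite normrZ (gtr0_norm (exprn_gt0 _ _))//.
by rewrite mulrC ler_pdivlMr ?exprn_gt0.
Qed.

(** The gap rescaled by [2 ^+ j] tends to [0], both curves having tangent [X]. Each doubling of time
    multiplies the rescaled gap by at most [1 + half j.+1 / 2], and the product of these factors
    converges. *)
Lemma ops_unique_small X gam gam' e : ops X gam -> ops X gam' -> 0 < e ->
  4 * C * (`|X| + e) <= 1 -> 2 * (`|X| + e) < d -> gam 1 = gam' 1.
Proof.
move=> opsX opsX' e0 Cm md; set m := `|X| + e in Cm md.
have B := ops_dyadic_bound opsX e0 Cm md.
have B' := ops_dyadic_bound opsX' e0 Cm md.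
pose D j := `|lcoord (gam (half j)) - lcoord (gam' (half j))|.
have step j : D j <= (2 + half j.+1) * D j.+1.
  have [gd _ gm] := B j.+1; have [gd' _ gm'] := B' j.+1.
  have := lcoord_sqr_lipschitz CdP gd gd'.
  rewrite -(ops_half j opsX) -(ops_half j opsX') => h.
  rewrite /D -[X in `|X| <= _](subrK (2 *: (lcoord (gam (half j.+1)) - lcoord (gam' (half j.+1))))).
  rewrite (le_trans (ler_normD _ _))// mulrDl addrC lerD//.
    by rewrite normrZ ger0_norm.
  apply: le_trans h _; rewrite ler_wpM2r//.
  apply: le_trans (ler_wpM2l C0 (lerD gm gm')) _.
  have -> : C * (2 * m * half j.+1 + 2 * m * half j.+1) = 4 * C * m * half j.+1 by ring.
  by rewrite ler_piMl// ltW// half_gt0.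
(* [2 - half j] dominates the partial products: with [h = half j.+1],
   [(2 - 2 h) (2 + h) <= 2 (2 - h)]. It equals [1] at [j = 0]. *)
have D0 j : D 0%N <= (2 - half j) * (2 ^+ j * D j).
  elim: j => [|j IHj]; first by rewrite expr0 invr1 mul1r; lra.
  apply: le_trans IHj _.
  have Dj := step j; have h1 := half_gt0 j.+1.
  have hE : half j = 2 * half j.+1 by rewrite exprS invfM mulVKf ?pnatr_eq0.
  have hle : half j.+1 <= 1 by rewrite invf_le1 ?exprn_gt0// exprn_ege1// ler1n.
  have p0 : (0 : R) <= 2 ^+ j by rewrite exprn_ge0.
  have c0 : 0 <= 2 - half j.
    by rewrite subr_ge0 hE ler_piMr.
  apply: le_trans (ler_wpM2l c0 (ler_wpM2l p0 Dj)) _.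
  have x0 : 0 <= D j.+1 by exact: normr_ge0.
  rewrite hE; set h := half j.+1 in h1 *; rewrite exprS.
  move: (D j.+1) x0 (2 ^+ j) p0 => x x0 p p0.
  have -> : (2 - 2 * h) * (p * ((2 + h) * x)) = (2 - h) * (2 * p * x) - 2 * (h ^+ 2 * (p * x)).
    by ring.
  by rewrite lerBlDr lerDl mulr_ge0// mulr_ge0 ?exprn_ge0 ?mulr_ge0// ltW.
have [gd _ _] := B 0%N; have [gd' _ _] := B' 0%N.
suff D00 : D 0%N <= 0.
  move: D00; rewrite /D normr_le0 subr_eq0 expr0 invr1 => /eqP cE.
  move: gd gd' => [+ _] [+ _]; rewrite expr0 invr1 => cg cg'.
  by rewrite -[LHS](lcoordK cg) cE lcoordK.
apply/ler_addgt0Pl => eps eps0; rewrite addr0.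
have e4 : 0 < eps / 4 by rewrite divr_gt0.
have [r r0 rP] := ops_derive opsX e4; have [r' r'0 rP'] := ops_derive opsX' e4.
have [|J JP] := @half_small (Num.min r r'); first by rewrite lt_min r0.
have := JP J (leqnn J); rewrite lt_min => /andP[Jr Jr'].
have h0 := half_gt0 J.
have := rP (half J); rewrite (gtr0_norm h0) => /(_ Jr) h1.
have := rP' (half J); rewrite (gtr0_norm h0) => /(_ Jr') h2.
have DJ : D J <= eps / 2 * half J.
  rewrite /D -(subrKA (half J *: X)) (le_trans (ler_normD _ _))//.
  rewrite -[X in _ + X <= _]normrN opprB.
  by apply: le_trans (lerD h1 h2) _; rewrite le_eqVlt; apply/orP; left;
    apply/eqP; move: (half J) => q; field.
have p0 : (0 : R) < 2 ^+ J by rewrite exprn_gt0.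
have pD : 2 ^+ J * D J <= eps / 2.
  by rewrite mulrC -ler_pdivlMr.
apply: le_trans (D0 J) _.
have pD0 : 0 <= 2 ^+ J * D J by apply: mulr_ge0; [exact: ltW|exact: normr_ge0].
move: (2 ^+ J * D J) (half J) h0 pD pD0 => a h h0 a1 a0.
have := mulr_ge0 (ltW h0) a0; lra.
Qed.

End DyadicDescent.
End OneParameterSubgroups.

Section Exponential.
Context {R : realType} {n : nat} {G : topGroupType}.
Variable c : chart R n G.
Notation E := 'rV[R]_n.
Notation lcoord := (lcoord c).
Notation lpoint := (lpoint c).
Notation small := (small c).
Notation ops := (one_parameter_subgroup c).
Notation has_exp := (has_exp c).
Notation lie_exp := (lie_exp c).
Hypothesis c1 : chart_dom c 1%g.
Variables C d : R.
Hypothesis CdP : mul_bound c C d.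
Implicit Types (X Y : E) (gam : R -> G) (g h : G).
Notation half j := ((2 : R) ^- j).

Let C0 : 0 <= C. Proof. by case: CdP. Qed.
Let d0 : 0 < d. Proof. by case: CdP. Qed.

Let r0 : R := Num.min (8 * (C + 1))^-1 (d / 8).
Let r00 : 0 < r0.
Proof. by rewrite lt_min invr_gt0 divr_gt0// mulr_gt0// ltr_wpDl. Qed.

Let r0P (X : E) e : `|X| < r0 -> e <= r0 -> 4 * C * (`|X| + e) <= 1 /\ 2 * (`|X| + e) < d.
Proof.
move=> Xr er.
have h1 : r0 <= (8 * (C + 1))^-1 by rewrite ge_min lexx.
have h2 : r0 <= d / 8 by rewrite ge_min lexx orbT.
split; last by move: d0; lra.
have C8 : 0 < 8 * (C + 1) by rewrite mulr_gt0// ltr_wpDl.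
have : r0 * (8 * (C + 1)) <= 1 by rewrite -ler_pdivlMr// mul1r.
have s : `|X| + e <= 2 * r0 by lra.
have := ler_wpM2l C0 s; move: r00; move: (`|X| + e) => q; nra.
Qed.

Lemma ops_unique X gam gam' : ops X gam -> ops X gam' -> gam = gam'.
Proof.
move=> opsX opsX'; apply/funext => t.
have oX := ops_rescale t opsX; have oX' := ops_rescale t opsX'.
have tX0 : 0 < `|t *: X| + 1 by rewrite ltr_wpDl.
have [N NP] := half_small (divr_gt0 r00 tX0).
have : gam (half N * t) = gam' (half N * t).
  have hX := ops_rescale (half N) oX; have hX' := ops_rescale (half N) oX'.
  have := NP N (leqnn N); rewrite ltr_pdivlMr//.
  move=> small_t.
  have nr : `|half N *: (t *: X)| < r0.
    have hN : 0 < half N by rewrite invr_gt0 exprn_gt0.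
    rewrite normrZ (gtr0_norm hN); apply: le_lt_trans small_t.
    by rewrite ler_wpM2l ?(ltW hN)// lerDl.
  have [h1 h2] := r0P nr (lexx _).
  by have := ops_unique_small c1 CdP hX hX' r00 h1 h2; rewrite /= mul1r.
elim: N {NP} => [|N IHN]; first by rewrite expr0 invr1 mul1r.
by move=> e; apply: IHN; rewrite (ops_half N oX) (ops_half N oX')/= e.
Qed.

Lemma lie_exp_ops X gam : ops X gam -> lie_exp X = gam 1.
Proof.
move=> oX; rewrite /Defs.lie_exp; case: xgetP => [g _ [gam' oX' <-]|/(_ (gam 1))].
  by rewrite (ops_unique oX oX').
by case; exists gam.
Qed.

Lemma ops_lie_exp X : has_exp X -> ops X (fun t => lie_exp (t *: X)).
Proof.
move=> [gam oX]; have -> : (fun t => lie_exp (t *: X)) = gam; last by [].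
apply/funext => t; rewrite (lie_exp_ops (ops_rescale t oX)); exact: congr1 (mul1r t).
Qed.

Lemma lie_exp_default X : ~ has_exp X -> lie_exp X = 1%g.
Proof.
move=> nX; rewrite /Defs.lie_exp; case: xgetP => // g _ [gam oX _].
by case: nX; exists gam.
Qed.

Lemma has_expZ t X : has_exp X -> has_exp (t *: X).
Proof. by move=> [gam oX]; eexists; exact: ops_rescale oX. Qed.

Lemma ops0 : ops 0 (fun=> 1%g).
Proof.
apply: ops_intro; first exact: cst_continuous.
  by move=> s t; rewrite mulg1.
move=> e e0; exists 1 => // h _.
by rewrite lcoord1 scaler0 subrr normr0 mulr_ge0// ltW.
Qed.

Lemma has_exp0 : has_exp 0. Proof. by eexists; exact: ops0. Qed.

Lemma lie_exp0 : lie_exp 0 = 1%g. Proof. exact: lie_exp_ops ops0. Qed.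

Lemma lie_expD s t X : has_exp X ->
  lie_exp ((s + t) *: X) = (lie_exp (s *: X) * lie_exp (t *: X))%g.
Proof. by move=> /ops_lie_exp[_ + _] => ->. Qed.

Lemma lie_expN X : has_exp X -> lie_exp (- X) = (lie_exp X)^-1%g.
Proof.
move=> hX; apply: (mulgI (lie_exp X)); rewrite mulgV.
have := lie_expD 1 (-1) hX; rewrite subrr scale0r lie_exp0 scale1r scaleN1r.
by move=> <-.
Qed.

(** The dyadic bound at scale [1] with tolerance [|X| ^+ 2], so that both error terms are quadratic;
    [16 * C] is [4 * C] times the square of [2]. The tolerance must be positive, hence the separate
    case [X = 0]. *)
Lemma lie_exp_bound : exists K r, [/\ 0 <= K, 0 < r & forall X, has_exp X -> `|X| < r ->
  small d (lie_exp X) /\ `|lcoord (lie_exp X) - X| <= K * `|X| ^+ 2].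
Proof.
exists (1 + 16 * C), (Num.min r0 1); split; first by rewrite addr_ge0// mulr_ge0.
  by rewrite lt_min r00 ltr01.
move=> X [gam oX]; rewrite lt_min => /andP[Xr X1].
rewrite (lie_exp_ops oX).
have [X0|X0] := eqVneq X 0.
  rewrite X0 in oX *; rewrite -(lie_exp_ops oX) lie_exp0 lcoord1 subrr !normr0.
  by split; [exact: small1|rewrite expr0n mulr0].
have Xp : 0 < `|X| by rewrite normr_gt0.
have e0 : 0 < `|X| ^+ 2 by rewrite exprn_gt0.
have eX : `|X| ^+ 2 <= `|X| by rewrite expr2 ler_piMl// ltW.
have [h1 h2] := r0P Xr (le_trans eX (ltW Xr)).
have [] := ops_dyadic_bound c1 CdP oX e0 h1 h2 0%N.
rewrite expr0 invr1 mulr1 scale1r => gd gX _; split=> //.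
apply: le_trans gX _.
have : (`|X| + `|X| ^+ 2) ^+ 2 <= (2 * `|X|) ^+ 2.
  by rewrite ler_sqr ?nnegrE ?mulr_ge0 ?addr_ge0 ?exprn_ge0//; lra.
move=> /(ler_wpM2l (mulr_ge0 (ler0n R 4) C0)) h.
have -> : (1 + 16 * C) * `|X| ^+ 2 = `|X| ^+ 2 + 4 * C * (2 * `|X|) ^+ 2 by ring.
by rewrite lerD2l.
Qed.

End Exponential.

(** * Adjoint action and bracket *)

Section AdjointAction.
Context {R : realType} {n : nat} {G : topGroupType}.
Variables (atlas : set (chart R n G)) (c : chart R n G).
Notation E := 'rV[R]_n.
Notation lcoord := (lcoord c).
Notation lpoint := (lpoint c).
Notation small := (small c).
Notation ops := (one_parameter_subgroup c).
Notation has_exp := (has_exp c).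
Notation lie_exp := (lie_exp c).
Notation Ad := (Ad c).
Notation x0 := (chart_map c 1%g).
Notation iv := (chart_inv c).
Hypothesis GL : lie_group atlas.
Hypothesis atc : atlas c.
Hypothesis c1 : chart_dom c 1%g.
Implicit Types (X Y : E) (gam : R -> G) (g h : G).

Definition conj_chart g (y : E) : E := chart_map c (g * iv y * g^-1)%g.

Lemma conj_chart1 g : conj_chart g x0 = x0.
Proof. by rewrite /conj_chart chart_mapK// mulg1 mulgV. Qed.

Lemma near_chart_smul (d1 d2 : chart R n G) g h :
  chart_dom d1 h -> chart_dom d2 (g * h)%g ->
  exists2 r : R, 0 < r & forall y, `|y - chart_map d1 h| < r ->
    chart_cod d1 y /\ chart_dom d2 (g * chart_inv d1 y)%g.
Proof.
move=> h1 gh2; have [_ _ [sat _] _ _] := GL.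
have [d3 _ g3] := sat g.
have /nbhs_normP[r /= r0 rP] := near_chart_mul g3 h1 gh2.
exists r => // y yr; have [] := rP (chart_map d3 g, y).
  by rewrite /= prod_normE/= subrr normr0 max_r// distrC.
by rewrite /= chart_mapK.
Qed.

Lemma conj_chart_dom g : exists2 r : R, 0 < r & forall y, `|y - x0| < r ->
  chart_cod c y /\ chart_dom c (g * iv y * g^-1)%g.
Proof.
have cod1 := chart_map_cod c1.
have cv : (g * iv y * g^-1)%g @[y --> x0] --> (g * iv x0 * g^-1)%g.
  exact: (cvg_mulg _ (cvg_mulg _ (cvg_cst g) (chart_inv_continuous cod1)) (cvg_cst _)).
have n1 : nbhs x0 (chart_cod c).
  by apply: open_nbhs_nbhs; split=> //; exact: open_chart_cod.
have n2 : nbhs (g * iv x0 * g^-1)%g (chart_dom c).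
  rewrite chart_mapK// mulg1 mulgV.
  by apply: open_nbhs_nbhs; split=> //; exact: open_chart_dom.
have : \forall y \near x0, chart_cod c y /\ chart_dom c (g * iv y * g^-1)%g.
  exact: (filterI n1 (cv _ n2)).
move=> /nbhs_normP[r /= r0 rP].
by exists r => // y yr; apply: rP; rewrite /= distrC.
Qed.

Lemma conj_chart_approx g : approx (conj_chart g) x0 (Ad g).
Proof.
suff [L aL] : exists L, approx (conj_chart g) x0 L.
  suff -> : Ad g = L by [].
  by apply/funext => Y; exact: approx_derive aL.
have [_ _ [sat _] smul _] := GL.
(* [g] may be far from the domain of [c]: the product [g y] is read in a chart at [g], and its right
   multiplication by [g^-1] uses a chart at [g^-1]. *)
have [d1 at1 g1] := sat g; have [d2 at2 g2] := sat (g^-1)%g.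
have gg1 : chart_dom d1 (g * 1)%g by rewrite mulg1.
have ggV : chart_dom c (g * g^-1)%g by rewrite mulgV.
have [f1d _] := smul _ _ _ at1 atc at1 1%N.
have [f2d _] := smul _ _ _ at1 at2 atc 1%N.
have a1 := approx_snd (differentiable_approx (f1d _ (nbhs_singleton (near_chart_mul g1 c1 gg1)))).
have a2 := approx_fst (differentiable_approx (f2d _ (nbhs_singleton (near_chart_mul g1 g2 ggV)))).
have u1 : chart_map d1 (chart_inv d1 (chart_map d1 g) * iv x0)%g = chart_map d1 g.
  by rewrite !chart_mapK// mulg1.
rewrite /= -[X in approx _ X]u1 in a2.
have [r r0 rP] := near_chart_smul c1 gg1.
eexists; apply: approx_near r0 _ (approx_comp (linear_bounded (proj1 a1)) a1 a2).
by move=> y /rP[cy gy]; rewrite /= !chart_mapK.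
Qed.

Lemma Ad_linear g : linear (Ad g).
Proof. exact: (conj_chart_approx g).1. Qed.

Lemma Ad_mul g h Y : Ad (g * h)%g Y = Ad g (Ad h Y).
Proof.
have ah := conj_chart_approx h; have ag := conj_chart_approx g.
rewrite -{1}(conj_chart1 h) in ag.
have agh := approx_comp (linear_bounded (Ad_linear h)) ah ag.
have [r r0 rP] := conj_chart_dom h.
have := approx_near r0 _ agh => /(_ (conj_chart (g * h)%g)).
move=> /(_ _)/approx_derive; apply => y /rP[cy hy].
by rewrite /= /conj_chart chart_mapK// invgM !mulgA.
Qed.

Lemma Ad1 Y : Ad 1%g Y = Y.
Proof.
have [r r0 rP] := conj_chart_dom 1%g.
apply: (@approx_derive _ _ _ _ _ id); apply: approx_near r0 _ (approx_id _).
by move=> y /rP[cy _]; rewrite /= mul1g invg1 mulg1 chart_invK.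
Qed.

Lemma ops_dom X gam : ops X gam ->
  exists2 r : R, 0 < r & forall t : R, `|t| < r -> chart_dom c (gam t).
Proof.
move=> oX; have [gcont _ _] := oX.
have : \forall t \near (0 : R), chart_dom c (gam t).
  apply: gcont; rewrite (ops1 oX).
  by apply: open_nbhs_nbhs; split=> //; exact: open_chart_dom.
by move=> /nbhs_normP[r /= r0 rP]; exists r => // t tr; apply: rP; rewrite /= sub0r normrN.
Qed.

Lemma ops_approx X gam : ops X gam ->
  approx (chart_map c \o gam : R^o -> E) (0 : R^o) (fun h : R^o => (h : R) *: X).
Proof. by move=> [_ _ gX]; exact: is_derive_approx. Qed.

Lemma scale_bounded X :
  exists2 C : R, 0 <= C & forall h : R^o, `|(h : R) *: X| <= C * `|h|.
Proof. by exists `|X| => // h; rewrite normrZ mulrC. Qed.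

Lemma conj_ops g X gam : ops X gam -> ops (Ad g X) (fun t => g * gam t * g^-1)%g.
Proof.
move=> oX; have [gcont gD _] := oX; apply: ops_intro.
- move=> t; exact: (cvg_mulg _ (cvg_mulg _ (cvg_cst g) (gcont t)) (cvg_cst _)).
- by move=> s t; rewrite gD !mulgA mulgVK.
have a1 := ops_approx oX; have a2 := conj_chart_approx g.
have x0E : x0 = (chart_map c \o gam) 0 by rewrite /= (ops1 oX).
rewrite {1}x0E in a2.
have [_ a3] := approx_comp (scale_bounded X) a1 a2.
have [r r0 rP] := ops_dom oX.
move=> e /a3[d d0 dP]; exists (Num.min d r); first by rewrite lt_min d0.
move=> h; rewrite lt_min => /andP[hd /rP hr]; have := dP h.
rewrite subr0 => /(_ hd); rewrite /= /conj_chart (ops1 oX) !chart_mapK//.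
have /pack_linear[a <-] := Ad_linear g.
by rewrite linearZ/= mulg1 mulgV.
Qed.

Lemma lie_exp_Ad (C d : R) (CdP : mul_bound c C d) g X :
  has_exp X -> lie_exp (Ad g X) = (g * lie_exp X * g^-1)%g.
Proof.
move=> hX; rewrite (lie_exp_ops c1 CdP (conj_ops g (ops_lie_exp c1 CdP hX))).
by rewrite scale1r.
Qed.

End AdjointAction.

(** * Differentiability of the adjoint action at the unit *)

Section Bracket.
Context {R : realType} {n : nat} {G : topGroupType}.
Variables (atlas : set (chart R n G)) (c : chart R n G).
Notation E := 'rV[R]_n.
Notation Ad := (Ad c).
Notation bracket := (bracket c).
Notation x0 := (chart_map c 1%g).
Notation iv := (chart_inv c).
Hypothesis GL : lie_group atlas.
Hypothesis atc : atlas c.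
Hypothesis c1 : chart_dom c 1%g.
Implicit Types (X Y : E) (gam : R -> G) (g h : G).

Let Phi (xy : E * E) : E := chart_map c (iv xy.1 * iv xy.2)%g.
(** In coordinates, [l Y] and [r Y] are the left- and right-invariant vector fields with value [Y]
    at the unit. *)
Let l Y (x : E) : E := 'D_(0, Y) Phi (x, x0).
Let r Y (x : E) : E := 'D_(Y, 0) Phi (x0, x).

Let Phi_near : exists2 e : R, 0 < e & forall x y, `|x - x0| < e -> `|y - x0| < e ->
  [/\ chart_cod c x, chart_cod c y & chart_dom c (iv x * iv y)%g].
Proof.
have g1 : chart_dom c (1 * 1)%g by rewrite mulg1.
have /nbhs_normP[e /= e0 eP] := near_chart_mul c1 c1 g1.
exists e => // x y xe ye; apply: (eP (x, y)).
by rewrite /= prod_normE/= gt_max distrC xe distrC ye.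
Qed.

Let Phi_smooth : smooth_on [set xy : E * E | [/\ chart_cod c xy.1, chart_cod c xy.2 &
  chart_dom c (iv xy.1 * iv xy.2)%g]] Phi.
Proof. by have [_ _ _ smul _] := GL; exact: smul. Qed.

Let Phi_base : [/\ chart_cod c x0, chart_cod c x0 & chart_dom c (iv x0 * iv x0)%g].
Proof.
have [e e0 eP] := Phi_near; have xe : `|x0 - x0| < e by rewrite subrr normr0.
exact: (eP _ _ xe xe).
Qed.

Let l_approx Y : exists L, approx (l Y) x0 L.
Proof.
have [_ /(_ (0, Y)) [H _]] := Phi_smooth 2%N.
by eexists; exact: approx_fst (differentiable_approx (H (x0, x0) Phi_base)).
Qed.

Let r_approx Y : exists L, approx (r Y) x0 L.
Proof.
have [_ /(_ (Y, 0)) [H _]] := Phi_smooth 2%N.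
by eexists; exact: approx_snd (differentiable_approx (H (x0, x0) Phi_base)).
Qed.

Let Phi_l x : [/\ chart_cod c x, chart_cod c x0 & chart_dom c (iv x * iv x0)%g] ->
  approx (fun y => Phi (x, y)) x0 (fun Y => l Y x).
Proof.
move=> H; have [D _] := Phi_smooth 1%N.
exact: approx_snd (differentiable_approx (D (x, x0) H)).
Qed.

Let Phi_r x : [/\ chart_cod c x0, chart_cod c x & chart_dom c (iv x0 * iv x)%g] ->
  approx (fun y => Phi (y, x)) x0 (fun Y => r Y x).
Proof.
move=> H; have [D _] := Phi_smooth 1%N.
exact: approx_fst (differentiable_approx (D (x0, x) H)).
Qed.

Let l1 Y : l Y x0 = Y.
Proof.
have [e e0 eP] := Phi_near.
have a : approx (fun y => Phi (x0, y)) x0 id.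
  apply: (approx_near e0 _ (approx_id _)) => y ye.
  have x0e : `|x0 - x0| < e by rewrite subrr normr0.
  have [_ cy _] := eP x0 y x0e ye.
  by rewrite /Phi/= chart_mapK// mul1g chart_invK.
have b : approx (fun y => Phi (x0, y)) x0 (fun Y => l Y x0).
  by apply: Phi_l; exact: Phi_base.
by rewrite -(approx_derive Y b) (approx_derive Y a).
Qed.

Let r1 Y : r Y x0 = Y.
Proof.
have [e e0 eP] := Phi_near.
have a : approx (fun y => Phi (y, x0)) x0 id.
  apply: (approx_near e0 _ (approx_id _)) => y ye.
  have x0e : `|x0 - x0| < e by rewrite subrr normr0.
  have [cy _ _] := eP y x0 ye x0e.
  by rewrite /Phi/= (chart_mapK c1) mulg1 chart_invK.
have b : approx (fun y => Phi (y, x0)) x0 (fun Y => r Y x0).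
  by apply: Phi_r; exact: Phi_base.
by rewrite -(approx_derive Y b) (approx_derive Y a).
Qed.

(* [x y = (x y x^-1) x], differentiated in [y]. *)
Let l_r_Ad : exists2 e : R, 0 < e & forall x Y, `|x - x0| < e ->
  l Y x = r (Ad (iv x) Y) x.
Proof.
have [e e0 eP] := Phi_near; exists e; first exact: e0.
move=> x Y xe.
have x0e : `|x0 - x0| < e by rewrite subrr normr0.
have al := Phi_l (eP x x0 xe x0e).
have ar := Phi_r (eP x0 x x0e xe).
have aA := conj_chart_approx GL atc c1 (iv x).
rewrite -{1}(conj_chart1 c1 (iv x)) in ar.
have aC := approx_comp (linear_bounded aA.1) aA ar.
have [s s0 sP] := conj_chart_dom c1 (iv x).
have aN : approx (fun y => Phi (x, y)) x0 (r^~ x \o Ad (iv x)).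
  apply: (approx_near s0 _ aC) => y /sP[cy gy].
  by rewrite /= /Phi /conj_chart /= chart_mapK// mulgVK.
by rewrite -(approx_derive Y al) (approx_derive Y aN).
Qed.

Let r_lin : exists2 e : R, 0 < e & forall x, `|x - x0| < e -> linear (r^~ x).
Proof.
have [e e0 eP] := Phi_near; exists e; first exact: e0.
move=> x xe.
have x0e : `|x0 - x0| < e by rewrite subrr normr0.
exact: (Phi_r (eP x0 x x0e xe)).1.
Qed.

Let r_close : exists2 K : R, 0 <= K & exists2 e : R, 0 < e & forall x v,
  `|x - x0| < e -> `|r v x - v| <= K * `|x - x0| * `|v|.
Proof.
have [e e0 rl] := r_lin.
have /choice[Kd KdP] : forall k : 'I_n, exists Kd : R * R, [/\ 0 < Kd.1, 0 < Kd.2 &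
    forall x, `|x - x0| < Kd.2 ->
      `|r (delta_mx 0 k) x - r (delta_mx 0 k) x0| <= Kd.1 * `|x - x0|].
  move=> k; have [L aL] := r_approx (delta_mx 0 k).
  have [K K0 [d d0 H]] := approx_bounded (linear_bounded aL.1) aL.
  by exists (K, d).
have [d d0 dP] : exists2 d : R, 0 < d & forall k, d <= (Kd k).2.
  by apply: finite_min_pos => k; have [] := KdP k.
exists (\sum_k (Kd k).1); first by apply: sumr_ge0 => k _; have [/ltW] := KdP k.
exists (Num.min d e); first by rewrite lt_min d0.
move=> x v; rewrite lt_min => /andP[xd /rl/pack_linear[f fE]].
have fE' u : r u x = f u by exact: (esym (congr1 (fun F : E -> E => F u) fE)).
have -> : r v x - v = \sum_k v 0 k *: (r (delta_mx 0 k) x - delta_mx 0 k).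
  rewrite fE' {1 2}(row_sum_delta v) linear_sum -sumrB; apply: eq_bigr => k _.
  by rewrite linearZ fE' scalerBr.
rewrite (le_trans (ler_norm_sum _ _ _))// 2!mulr_suml ler_sum// => k _.
rewrite normrZ mulrC ler_pM ?ler_coord//.
have [_ _ /(_ x)] := KdP k; rewrite r1; apply; exact: lt_le_trans (dP k).
Qed.

(** [Ad (iv x) Y] is known through [l Y x = r (Ad (iv x) Y) x], where [r] is within [O(|x - x0|)] of
    the identity. Hence [Ad (iv x) Y - Y] agrees to first order with [l Y x - r Y x], which is
    differentiable. *)
Lemma Ad_approx Y : approx (fun x => Ad (iv x) Y) x0 (fun X => bracket X Y).
Proof.
suff [L aL] : exists L, approx (fun x => Ad (iv x) Y) x0 L.
  suff -> : (fun X => bracket X Y) = L by [].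
  by apply/funext => X; exact: approx_derive aL.
have [Ll al] := l_approx Y; have [Lr ar] := r_approx Y.
have aq := approx_lincomb (-1) ar al.
exists (fun v => -1 *: Lr v + Ll v).
have [Cq Cq0 [dq dq0 qb]] := approx_bounded (linear_bounded aq.1) aq.
move: aq => [qlin aq]; split=> // e e0.
have [K K0 [d d0 Kd]] := r_close; have [d1 d10 rl] := r_lin.
have [d2 d20 lrA] := l_r_Ad.
have e2 : 0 < e / 2 by rewrite divr_gt0.
have [d3 d30 q3] := aq _ e2.
have K1 : 0 < 2 * (K + 1) by rewrite mulr_gt0// ltr_wpDl.
have KC : 0 < 4 * (K + 1) * Cq by rewrite !mulr_gt0// ltr_wpDl.
exists (Num.min (Num.min (Num.min dq d) (Num.min d1 d2))
  (Num.min (Num.min d3 (2 * (K + 1))^-1) (e / (4 * (K + 1) * Cq)))).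
  by rewrite !lt_min dq0 d0 d10 d20 d30 invr_gt0 K1 divr_gt0.
move=> x; rewrite !lt_min.
move=> /andP[/andP[/andP[xq xd] /andP[x1 x2]] /andP[/andP[x3 xK] xe]].
have {}qb := qb _ xq; have {}q3 := q3 _ x3; have {}Kd := Kd x ^~ xd.
have {}lrA := lrA _ Y x2; have /pack_linear[f fE] := rl _ x1.
have fE' u : r u x = f u by exact: (esym (congr1 (fun F : E -> E => F u) fE)).
rewrite (chart_mapK c1) Ad1//; move: qb q3.
have z : -1 *: Y + Y = 0 by rewrite scaleN1r addNr.
rewrite r1 l1 z subr0; set q := -1 *: r Y x + l Y x => qb q3.
set a := Ad (iv x) Y in lrA *; set t := `|x - x0| in qb q3 Kd xK xe *.
have t0 : 0 <= t by exact: normr_ge0.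
have aE : a - Y = q - (r (a - Y) x - (a - Y)).
  rewrite /q scaleN1r lrA !fE' (linearB f a Y) (addrC (- f Y)).
  by rewrite [in RHS]opprB [RHS]addrC subrK.
(* Near [x0] the correction is at most half of [a - Y] and is absorbed on the left. *)
have aY : `|a - Y| <= 2 * (Cq * t).
  have h := Kd (a - Y).
  have h2 : `|a - Y| <= `|q| + K * t * `|a - Y|.
    rewrite {1}aE (le_trans (ler_normB _ _))// lerD2l//.
  have Kt : K * t <= 1 / 2.
    have : (K + 1) * t <= 1 / 2.
      by move: (ltW xK); rewrite -[(_ * _)^-1]mul1r ler_pdivlMr//; lra.
    by lra.
  have := ler_wpM2r (normr_ge0 (a - Y)) Kt; move: h2 qb.
  move: `|q| `|a - Y| (K * t * _) => u v w; lra.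
have -> : a - Y - (-1 *: Lr (x - x0) + Ll (x - x0)) =
    (q - (-1 *: Lr (x - x0) + Ll (x - x0))) - (r (a - Y) x - (a - Y)).
  by rewrite {1}aE addrAC.
rewrite (le_trans (ler_normB _ _))// [e]splitr mulrDl lerD//.
apply: le_trans (Kd _) _; apply: le_trans (ler_wpM2l (mulr_ge0 K0 t0) aY) _.
have -> : K * t * (2 * (Cq * t)) = (2 * K * Cq * t) * t by ring.
rewrite ler_wpM2r//; move: (ltW xe); rewrite ler_pdivlMr// => h.
have h' : 0 <= Cq * t by rewrite mulr_ge0// ltW.
have := mulr_ge0 K0 h'; lra.
Qed.

End Bracket.

Section BilinearDerivative.
Context {R : realType}.

Lemma bilinear_bounded n m (W : normedModType R) (b : 'rV[R]_n -> 'rV[R]_m -> W) :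
  (forall v, linear (b^~ v)) -> (forall u, linear (b u)) ->
  exists2 K : R, 0 <= K & forall u v, `|b u v| <= K * (`|u| * `|v|).
Proof.
move=> bl br.
have /choice[K KP] : forall i : 'I_n, exists K : R, 0 <= K /\
    forall v, `|b (delta_mx 0 i) v| <= K * `|v|.
  by move=> i; have [K K0 KP] := linear_bounded (br (delta_mx 0 i)); exists K.
exists (\sum_i K i); first by apply: sumr_ge0 => i _; have [] := KP i.
move=> u v; have /pack_linear[f fE] := bl v.
have -> : b u v = \sum_i u 0 i *: b (delta_mx 0 i) v.
  have fE' w : b w v = f w by rewrite fE.
  rewrite fE' {1}(row_sum_delta u) linear_sum; apply: eq_bigr => i _.
  by rewrite linearZ fE'.
rewrite (le_trans (ler_norm_sum _ _ _))// mulr_suml ler_sum// => i _.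
rewrite normrZ mulrCA; have [K0 /(_ v) Kv] := KP i.
by rewrite ler_pM// ?ler_coord.
Qed.

Lemma approx_bilinear n m k (V : normedModType R) (b : 'rV[R]_n -> 'rV[R]_m -> 'rV[R]_k)
    (f : V -> 'rV[R]_n) (g : V -> 'rV[R]_m) x Lf Lg :
  (forall v, linear (b^~ v)) -> (forall u, linear (b u)) ->
  (exists2 C : R, 0 <= C & forall v, `|Lf v| <= C * `|v|) ->
  (exists2 C : R, 0 <= C & forall v, `|Lg v| <= C * `|v|) ->
  approx f x Lf -> approx g x Lg ->
  approx (fun y => b (f y) (g y)) x (fun v => b (Lf v) (g x) + b (f x) (Lg v)).
Proof.
move=> bl br bLf bLg af ag.
have [K K0 bK] := bilinear_bounded bl br.
have [Cf Cf0 [df df0 fC]] := approx_bounded bLf af.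
have [Cg Cg0 [dg dg0 gC]] := approx_bounded bLg ag.
move: af ag => [Lfl fL] [Lgl gL].
have brD u v w l : b u (l *: v + w) = l *: b u v + b u w by exact: br.
have blD u v w l : b (l *: u + v) w = l *: b u w + b v w by exact: bl.
have brB u v w : b u (v - w) = b u v - b u w.
  by rewrite addrC -scaleN1r brD scaleN1r addrC.
have blB u v w : b (u - v) w = b u w - b v w.
  by rewrite addrC -scaleN1r blD scaleN1r addrC.
split=> [l u v|e e0].
  by rewrite Lfl Lgl blD brD scalerDr addrACA.
pose Q := K * `|g x| + K * `|f x| + K * (Cf * Cg) + 1.
have Q0 : 0 < Q by rewrite ltr_wpDl// !addr_ge0 ?mulr_ge0// ltW.
have eQ : 0 < e / Q by rewrite divr_gt0.
have [d1 d10 f1] := fL _ eQ; have [d2 d20 g2] := gL _ eQ.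
exists (Num.min (Num.min df dg) (Num.min (Num.min d1 d2) (e / Q))).
  by rewrite !lt_min df0 dg0 d10 d20 eQ.
move=> y; rewrite !lt_min => /andP[/andP[/fC fy /gC gy] /andP[/andP[/f1 {}f1 /g2 {}g2] yQ]].
set t := `|y - x| in fy gy f1 g2 yQ *.
have t0 : 0 <= t by exact: normr_ge0.
have -> : b (f y) (g y) - b (f x) (g x) - (b (Lf (y - x)) (g x) + b (f x) (Lg (y - x))) =
    b (f y - f x - Lf (y - x)) (g x) + b (f x) (g y - g x - Lg (y - x)) +
    b (f y - f x) (g y - g x).
  by rewrite !blB !brB; apply/rowP => i; rewrite !mxE; ring.
have h1 := le_trans (bK (f y - f x - Lf (y - x)) (g x))
  (ler_wpM2l K0 (ler_wpM2r (normr_ge0 (g x)) f1)).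
have h2 := le_trans (bK (f x) (g y - g x - Lg (y - x)))
  (ler_wpM2l K0 (ler_wpM2l (normr_ge0 (f x)) g2)).
have h3 := le_trans (bK (f y - f x) (g y - g x))
  (ler_wpM2l K0 (ler_pM (normr_ge0 _) (normr_ge0 _) fy gy)).
rewrite (le_trans (ler_normD _ _))// (le_trans (lerD (ler_normD _ _) (lexx _)))//.
apply: le_trans (lerD (lerD h1 h2) h3) _.
have h4 : K * (Cf * t * (Cg * t)) <= K * (Cf * Cg) * (e / Q) * t.
  have -> : K * (Cf * t * (Cg * t)) = K * (Cf * Cg) * t * t by ring.
  by rewrite ler_wpM2r// ler_wpM2l ?(ltW yQ)// mulr_ge0// mulr_ge0// ltW.
apply: le_trans (lerD (lexx _) h4) _.
have -> : K * (e / Q * t * `|g x|) + K * (`|f x| * (e / Q * t)) +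
    K * (Cf * Cg) * (e / Q) * t = (Q - 1) * (e / Q) * t.
  by rewrite /Q; ring.
have -> : (Q - 1) * (e / Q) * t = e * t - (e / Q) * t.
  by field; rewrite gt_eqF.
by rewrite lerBlDr lerDl mulr_ge0// ltW.
Qed.

End BilinearDerivative.

Section BracketTheory.
Context {R : realType} {n : nat} {G : topGroupType}.
Variables (atlas : set (chart R n G)) (c : chart R n G).
Notation E := 'rV[R]_n.
Notation ops := (one_parameter_subgroup c).
Notation has_exp := (has_exp c).
Notation lie_exp := (lie_exp c).
Notation Ad := (Ad c).
Notation bracket := (bracket c).
Notation x0 := (chart_map c 1%g).
Notation iv := (chart_inv c).
Hypothesis GL : lie_group atlas.
Hypothesis atc : atlas c.
Hypothesis c1 : chart_dom c 1%g.
Implicit Types (X Y Z : E) (gam : R -> G) (g h : G).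

Lemma bracket_linearl Y : linear (bracket^~ Y).
Proof. exact: (Ad_approx GL atc c1 Y).1. Qed.

Lemma bracket_linearr X : linear (bracket X).
Proof.
move=> k Y Z; apply: (@approx_derive _ _ _ _ _ (fun X => k *: bracket X Y + bracket X Z)).
have -> : (fun x => Ad (iv x) (k *: Y + Z)) = (fun x => k *: Ad (iv x) Y + Ad (iv x) Z).
  by apply/funext => x; rewrite (Ad_linear GL atc c1).
by apply: approx_lincomb; exact: (Ad_approx GL atc c1).
Qed.

Lemma Ad_ops_approx X gam Y : ops X gam ->
  approx (fun t : R^o => Ad (gam t) Y) (0 : R^o) (fun h : R^o => (h : R) *: bracket X Y).
Proof.
move=> oX; have a1 := ops_approx oX; have a2 := Ad_approx GL atc c1 Y.
have x0E : x0 = (chart_map c \o gam) 0 by rewrite /= (ops1 oX).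
rewrite {1}x0E in a2.
have a3 := approx_comp (scale_bounded X) a1 a2.
have [r r0 rP] := ops_dom c1 oX.
have -> : (fun h : R^o => (h : R) *: bracket X Y) =
    (fun X => bracket X Y) \o (fun h : R^o => (h : R) *: X).
  apply/funext => h /=; have /pack_linear[f fE] := bracket_linearl Y.
  have fE' w : bracket w Y = f w by rewrite fE.
  by rewrite !fE' linearZ.
apply: approx_near r0 _ a3 => t; rewrite subr0 => /rP tr.
by rewrite /= chart_mapK.
Qed.

(** [Ad (gam y) = Ad (gam t) Ad (gam (y - t))] carries the derivative at [0] over to [t]. *)
Lemma Ad_ops_derive X gam Y (t : R) : ops X gam ->
  is_derive (t : R^o) (1 : R^o) (fun s : R^o => Ad (gam s) Y) (Ad (gam t) (bracket X Y)).
Proof.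
move=> oX; have [_ gD _] := oX.
have a1 := Ad_ops_approx Y oX.
have lA := Ad_linear GL atc c1 (gam t).
have [C C0 AC] := linear_bounded lA.
suff a : approx (fun s : R^o => Ad (gam s) Y) (t : R^o)
    (fun h : R^o => (h : R) *: Ad (gam t) (bracket X Y)).
  by have := approx_is_derive (1 : R^o) a; rewrite scale1r.
split=> [l u v|e e0]; first by rewrite scalerDl scalerA.
have C1 : 0 < C + 1 by rewrite ltr_wpDl.
have [_ /(_ _ (divr_gt0 e0 C1))[d d0 dP]] := a1.
exists d => // y yd; have := dP (y - t); rewrite subr0 => /(_ yd) h.
have yE : gam y = (gam t * gam (y - t))%g by rewrite -gD addrC subrK.
have -> : Ad (gam y) Y - Ad (gam t) Y - (y - t) *: Ad (gam t) (bracket X Y) =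
    Ad (gam t) (Ad (gam (y - t)) Y - Ad (gam 0) Y - (y - t) *: bracket X Y).
  rewrite yE (Ad_mul GL atc c1) (ops1 oX) (Ad1 c1).
  by case/pack_linear: lA => f <-; rewrite [RHS](linearB f) [in RHS](linearB f)
    [in RHS](linearZZ f).
apply: le_trans (AC _) _; apply: le_trans (ler_wpM2l C0 h) _.
rewrite mulrA ler_wpM2r// mulrCA ler_piMr ?(ltW e0)// ler_pdivrMr// mul1r lerDl//.
Qed.

(* An eigenvector of [bracket X] solves the scalar equation [u' = l u]. *)
Lemma Ad_ops_eigen X gam Y l t : ops X gam -> bracket X Y = l *: Y ->
  Ad (gam t) Y = expR (l * t) *: Y.
Proof.
move=> oX XY; have P' := fun t => Ad_ops_derive Y t oX.
(* The integrating factor [expR (- l * s)] makes every coordinate constant. *)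
have fder i (s : R) : is_derive (s : R^o) (1 : R^o)
    (fun s : R^o => expR (- l * s) * Ad (gam s) Y 0 i : R^o) 0.
  have := coord_derive 0 i (P' s); rewrite XY => h1.
  have lA := Ad_linear GL atc c1 (gam s).
  have AE : Ad (gam s) (l *: Y) = l *: Ad (gam s) Y.
    by case/pack_linear: lA => f <-; rewrite linearZ.
  rewrite AE mxE in h1.
  have h2 : is_derive (s : R^o) (1 : R^o) (fun s : R^o => expR (- l * s) : R^o)
      (- l * expR (- l * s)).
    have h3 : is_derive s 1 (fun s => - l * s) (- l).
      by apply: is_derive_eq; rewrite [LHS]mulr1.
    have := is_derive1_comp (is_derive_expR (- l * s)) h3.
    by rewrite mulrC.
  have <- : expR (- l * s) *: (l * Ad (gam s) Y 0 i : R^o) +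
      Ad (gam s) Y 0 i *: (- l * expR (- l * s) : R^o) = 0.
    by rewrite /GRing.scale/=; ring.
  exact: (is_deriveM h2 h1).
have cst i : expR (- l * t) * Ad (gam t) Y 0 i = Y 0 i.
  have := is_derive_0_is_cst t 0 (fder i).
  by rewrite mulr0 expR0 mul1r (ops1 oX) (Ad1 c1).
apply/rowP => i; rewrite mxE -(cst i) mulrA -expRD mulNr subrr expR0 mul1r//.
Qed.

Section WithBound.
Variables C d : R.
Hypothesis CdP : mul_bound c C d.

Let exp_ops X : has_exp X -> ops X (fun t => lie_exp (t *: X)).
Proof. exact: (ops_lie_exp c1 CdP). Qed.

Lemma Ad_exp_eigen X Y l : has_exp X -> bracket X Y = l *: Y ->
  Ad (lie_exp X) Y = expR l *: Y.
Proof.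
by move=> /exp_ops oX /(Ad_ops_eigen 1 oX); rewrite scale1r mulr1.
Qed.

Lemma Ad_exp_fix X Y : has_exp X -> has_exp Y -> bracket X Y = 0 ->
  (lie_exp X * lie_exp Y = lie_exp Y * lie_exp X)%g.
Proof.
move=> hX hY XY; have := @Ad_exp_eigen X Y 0 hX.
rewrite scale0r expR0 scale1r => /(_ XY) XYY.
have := lie_exp_Ad GL atc c1 CdP (lie_exp X) hY; rewrite XYY => {2}->.
by rewrite mulgVK.
Qed.

(** A one-parameter subgroup commutes with itself, so [Ad] along it fixes its tangent vector. *)
Lemma bracket_self X : has_exp X -> bracket X X = 0.
Proof.
move=> /exp_ops oX.
have := approx_derive (1 : R^o) (Ad_ops_approx X oX); rewrite scale1r => <-.
have -> : (fun t : R^o => Ad (lie_exp ((t : R) *: X)) X) = cst X; last exact: derive_cst.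
apply/funext => t.
have o2 := conj_ops GL atc c1 (lie_exp (t *: X)) oX.
have [_ gD _] := oX.
have gE : (fun s => lie_exp (t *: X) * lie_exp (s *: X) * (lie_exp (t *: X))^-1)%g =
    (fun s => lie_exp (s *: X)).
  by apply/funext => s; rewrite -gD addrC gD mulgK.
rewrite gE in o2; have [_ _ d1] := o2; have [_ _ d2] := oX.
by rewrite /= -(@derive_val _ _ _ _ _ _ _ d1) -[RHS](@derive_val _ _ _ _ _ _ _ d2).
Qed.

(** Derivative at [t = 0] of [Ad (g exp(t Y) g^-1) (Ad g Z) = Ad g (Ad (exp(t Y)) Z)]. *)
Lemma Ad_bracket g Y Z : has_exp Y -> Ad g (bracket Y Z) = bracket (Ad g Y) (Ad g Z).
Proof.
move=> /exp_ops oY.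
have := approx_derive (1 : R^o) (Ad_ops_approx (Ad g Z) (conj_ops GL atc c1 g oY)).
rewrite scale1r => <-.
have -> : (fun t : R^o => Ad (g * lie_exp ((t : R) *: Y) * g^-1) (Ad g Z))%g =
    Ad g \o (fun t : R^o => Ad (lie_exp ((t : R) *: Y)) Z).
  by apply/funext => t; rewrite /= -!(Ad_mul GL atc c1) mulgVK.
have lA := Ad_linear GL atc c1 g.
have aA : approx (Ad g) ((fun t : R^o => Ad (lie_exp ((t : R) *: Y)) Z) 0) (Ad g).
  split=> // e e0; exists 1 => // y _.
  by case/pack_linear: lA => f <-; rewrite linearB subrr normr0 mulr_ge0// ltW.
have a := approx_comp (scale_bounded (bracket Y Z)) (Ad_ops_approx Z oY) aA.
by rewrite (approx_derive (1 : R^o) a) /= scale1r.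
Qed.

(** Derivative of [Ad_bracket] along the one-parameter subgroup of [X], with the product rule on the
    right. *)
Lemma jacobi_exp X Y Z : has_exp X -> has_exp Y ->
  bracket X (bracket Y Z) = bracket (bracket X Y) Z + bracket Y (bracket X Z).
Proof.
move=> /exp_ops oX hY.
have a1 := Ad_ops_approx (bracket Y Z) oX.
have aY := Ad_ops_approx Y oX; have aZ := Ad_ops_approx Z oX.
have a2 := approx_bilinear bracket_linearl bracket_linearr
  (scale_bounded _) (scale_bounded _) aY aZ.
have g0 : lie_exp ((0 : R) *: X) = 1%g by exact: ops1 oX.
have fE : (fun t : R^o => Ad (lie_exp ((t : R) *: X)) (bracket Y Z)) =
    (fun t : R^o => bracket (Ad (lie_exp ((t : R) *: X)) Y) (Ad (lie_exp ((t : R) *: X)) Z)).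
  by apply/funext => t; rewrite Ad_bracket.
have e1 := approx_derive (1 : R^o) a1; have e2 := approx_derive (1 : R^o) a2.
have A0 W : Ad (lie_exp ((0 : R) *: X)) W = W by rewrite g0; exact: Ad1.
rewrite -fE e1 (A0 Y) (A0 Z) in e2.
move: e2; move: (bracket X Y) (bracket X Z) (bracket X (bracket Y Z)) => u v w.
by rewrite (scale1r w) (scale1r u) (scale1r v).
Qed.

End WithBound.
End BracketTheory.

(** * Cartan decompositions *)

Section BilinearProducts.
Context {R : realType} {n : nat}.
Notation E := 'rV[R]_n.
Implicit Types (X Y Z : E) (S : set E).

(** [S] need not be a subspace: a finite family in [S] with span of maximal dimension does. *)
Lemma spanning_seq (S : set E) : exists2 xs : seq E, (forall x, x \in xs -> S x) &
  forall x, S x -> x \in <<xs>>%VS.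
Proof.
pose P m := `[< exists2 xs : seq E, (forall x, x \in xs -> S x) & \dim <<xs>> = m >].
have exP : exists m, P m by exists (\dim <<[::] : seq E>>); apply/asboolP; exists [::].
have bdP m : P m -> (m <= dim E)%N.
  by move=> /asboolP[xs _ <-]; rewrite -dimvf dimvS// subvf.
have [m /asboolP[xs xsS dxs] max] := ex_maxnP exP bdP.
exists xs => // x Sx.
have le : (<<xs>> <= <<x :: xs>>)%VS by rewrite span_cons addvSr.
have : P (\dim <<x :: xs>>).
  apply/asboolP; exists (x :: xs) => // y; rewrite inE => /orP[/eqP->//|]; exact: xsS.
move=> /max; rewrite -dxs => dle.
have /eqP -> : (<<xs>> == <<x :: xs>>)%VS by rewrite eqEdim le.
by rewrite memv_span ?mem_head.
Qed.

Variables (br : E -> E -> E).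
Hypothesis brl : forall Y, linear (br^~ Y).
Hypothesis brr : forall X, linear (br X).

Let brDl U V W : br (U + V) W = br U W + br V W.
Proof. by have := brl W 1 U V; rewrite !scale1r. Qed.

Let brDr U V W : br U (V + W) = br U V + br U W.
Proof. by have := brr U 1 V W; rewrite !scale1r. Qed.

Let br0l W : br 0 W = 0.
Proof. by apply: (addrI (br 0 W)); rewrite -brDl !addr0. Qed.

Let br0r W : br W 0 = 0.
Proof. by apply: (addrI (br W 0)); rewrite -brDr !addr0. Qed.

Let brZl s X Y : br (s *: X) Y = s *: br X Y.
Proof. by have := brl Y s X 0; rewrite br0l !addr0. Qed.

Let brZr s X Y : br X (s *: Y) = s *: br X Y.
Proof. by have := brr X s Y 0; rewrite br0r !addr0. Qed.

(* Polynomial identities need only be checked off a proper subspace; here off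
   [k], where one-parameter subgroups are known to exist. *)
Lemma alternating_off_subspace (k : {vspace E}) P : P \notin k ->
  (forall Y, Y \notin k -> br Y Y = 0) -> forall X, br X X = 0.
Proof.
move=> Pk nk X; have [Xk|/nk//] := boolP (X \in k).
(* Off [k] lies every [s *: P + X] with [s != 0]; adding the cases [s = 1] and [s = -1] cancels the
   cross terms. *)
have e (s : R) : s != 0 -> br X X + s *: (br X P + br P X) = 0.
  move=> s0; have : br (s *: P + X) (s *: P + X) = 0.
    apply: nk; apply: contraNN Pk => sPX.
    have sPk : s *: P \in k by rewrite -[s *: P](addrK X) memvB.
    by rewrite -[P]scale1r -(mulVf s0) -scalerA memvZ.
  rewrite brDl !brDr !brZl !brZr (nk _ Pk) !scaler0 add0r => h.
  by rewrite -[RHS]h scalerDr [LHS]addrC (addrC (s *: br X P)) -addrA.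
have := e 1 (oner_neq0 _); have := e (-1); rewrite oppr_eq0 oner_neq0 => /(_ isT).
rewrite scaleN1r scale1r => e1 e2; have := congr2 +%R e1 e2.
rewrite addrACA addNr !addr0 -mulr2n -scaler_nat => /eqP.
by rewrite scaler_eq0 pnatr_eq0 => /eqP.
Qed.

(** The identity is additive in [X] and in [Y]. For [U] in [k], subtract the identity at [P] from
    that at [P + U], both being off [k]. *)
Lemma jacobi_off_subspace (k : {vspace E}) P : P \notin k ->
  (forall X Y Z, X \notin k -> Y \notin k ->
    br X (br Y Z) = br (br X Y) Z + br Y (br X Z)) ->
  forall X Y Z, br X (br Y Z) = br (br X Y) Z + br Y (br X Z).
Proof.
move=> Pk nk X Y Z.
have addP U : U \in k -> P + U \notin k.
  by move=> Uk; apply: contraNN Pk => PUk; rewrite -[P](addrK U) memvB.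
have nk1 U V : V \notin k -> br U (br V Z) = br (br U V) Z + br V (br U Z).
  move=> Vk; have [Uk|Uk] := boolP (U \in k); last exact: nk.
  have := nk _ _ Z (addP _ Uk) Vk; rewrite !brDl brDr (nk _ _ Z Pk Vk) addrACA.
  by move/addrI.
have [Yk|Yk] := boolP (Y \in k); last exact: nk1.
have := nk1 X _ (addP _ Yk); rewrite brDl !brDr !brDl (nk1 _ _ Pk) addrACA.
by move/addrI.
Qed.

Lemma span_commute S (xs ys : seq E) :
  (forall x, x \in xs -> S x) -> (forall x, x \in ys -> S x) ->
  (forall X Y, S X -> S Y -> br X Y = 0) ->
  forall X Y, X \in <<xs>>%VS -> Y \in <<ys>>%VS -> br X Y = 0.
Proof.
move=> xsS ysS Sab.
have h1 X Y : S X -> Y \in <<ys>>%VS -> br X Y = 0.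
  move=> SX; have /pack_linear[f fE] := brr X; have fE' w : br X w = f w by rewrite fE.
  have : (<<ys>> <= lker (linfun f))%VS.
    by apply/span_subvP => y /ysS Sy; rewrite memv_ker lfunE/= -fE' Sab.
  by move=> /subvP h /h; rewrite memv_ker lfunE/= fE' => /eqP.
move=> X Y; have /pack_linear[f fE] := brl Y; have fE' w : br w Y = f w by rewrite fE.
move=> + Ys; have : (<<xs>> <= lker (linfun f))%VS.
  by apply/span_subvP => x /xsS Sx; rewrite memv_ker lfunE/= -fE' h1.
by move=> /subvP h /h; rewrite memv_ker lfunE/= fE' => /eqP.
Qed.

Lemma abelian_add_line (a : {vspace E}) X : (forall Y, br Y Y = 0) ->
  (forall Y Z, Y \in a -> Z \in a -> br Y Z = 0) ->
  (forall Y, Y \in a -> br Y X = 0) ->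
  forall Y Z, Y \in (a + <[X]>)%VS -> Z \in (a + <[X]>)%VS -> br Y Z = 0.
Proof.
move=> br_self aa aX _ _ /memv_addP[H Ha [_ /vlineP[t ->] ->]]
  /memv_addP[H' H'a [_ /vlineP[t' ->] ->]].
have Xa Y : Y \in a -> br X Y = 0.
  move=> Ya; have := br_self (X + Y).
  by rewrite brDl !brDr !br_self aX// !add0r addr0.
by rewrite brDl !brDr !brZl !brZr aa// aX// Xa// br_self !scaler0 !addr0.
Qed.

End BilinearProducts.

(** * The Cartan involution and its inner product *)

Section CartanAlgebra.
Context {R : realType} {n : nat}.
Notation E := 'rV[R]_n.
Implicit Types (X Y Z u v : E).

Lemma mul_lin1_mx (f : E -> E) u : linear f -> u *m lin1_mx f = f u.
Proof. by case/pack_linear => g <-; exact: mul_rV_lin1. Qed.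

Lemma mulmx_ext (A B : 'M[R]_n) : (forall u : E, u *m A = u *m B) -> A = B.
Proof. by move=> AB; apply/row_matrixP => i; rewrite !rowE. Qed.

Lemma mxformP (b : E -> E -> R) u v :
  (forall w l x y, b (l *: x + y) w = l * b x w + b y w) ->
  (forall w l x y, b w (l *: x + y) = l * b w x + b w y) ->
  mxform (\matrix_(i, j) b (delta_mx 0 i) (delta_mx 0 j)) u v = b u v.
Proof.
move=> bl br.
have b0l w : b 0 w = 0 by have := bl w (-1) 0 0; rewrite scaler0 addr0 mulN1r addNr.
have b0r w : b w 0 = 0 by have := br w (-1) 0 0; rewrite scaler0 addr0 mulN1r addNr.
have suml w (x : E) : b x w = \sum_i x 0 i * b (delta_mx 0 i) w.
  rewrite {1}(row_sum_delta x).
  elim: (index_enum _) => [|i s IHs]; first by rewrite !big_nil b0l.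
  by rewrite !big_cons bl IHs.
have sumr w (x : E) : b w x = \sum_i x 0 i * b w (delta_mx 0 i).
  rewrite {1}(row_sum_delta x).
  elim: (index_enum _) => [|i s IHs]; first by rewrite !big_nil b0r.
  by rewrite !big_cons br IHs.
rewrite /mxform mxE (sumr u v); apply: eq_bigr => j _.
rewrite !mxE mulrC (suml _ u); congr (_ * _); apply: eq_bigr => i _.
by rewrite !mxE.
Qed.

Lemma mxform_inj (A B : 'M[R]_n) :
  (forall u v, mxform A u v = mxform B u v) -> A = B.
Proof.
move=> AB; apply/matrixP => i j; have := AB (delta_mx 0 i) (delta_mx 0 j).
by rewrite /mxform -!rowE trmx_delta -!colE !mxE.
Qed.

Lemma mxform_tr (A : 'M[R]_n) u v : mxform A^T u v = mxform A v u.
Proof.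
rewrite /mxform; have -> : u *m A^T *m v^T = (v *m A *m u^T)^T.
  by rewrite !trmx_mul trmxK mulmxA.
by rewrite mxE.
Qed.

Lemma mxform_mul (A B : 'M[R]_n) u v : mxform (A *m B) u v = mxform B (u *m A) v.
Proof. by rewrite /mxform mulmxA. Qed.

(** Eigenvectors of [A] with distinct eigenvalues are [B]-orthogonal, so on an eigenbasis [F] has
    the same factor on both sides wherever [B] does not vanish. *)
Lemma symmetric_of_function (A B F : 'M[R]_n) (e : R -> R) :
  B^T = B -> (A *m B)^T = A *m B -> diagonalizable A ->
  (forall v l, v *m A = l *: v -> v *m F = e l *: v) ->
  (F *m B)^T = F *m B.
Proof.
move=> BT ABT Ad AF; have [P Pu [d Pd]] := diagonalizable_basis Ad.
suff h : P *m (F *m B)^T *m P^T = P *m (F *m B) *m P^T.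
  have PTu : P^T \in unitmx by rewrite unitmx_tr.
  by apply: (can_inj (mulKmx Pu)); apply: (can_inj (mulmxK PTu)).
have rowmx (M : 'M[R]_n) i j : (P *m M *m P^T) i j = mxform M (row i P) (row j P).
  rewrite /mxform -row_mul [RHS]mxE [LHS]mxE; apply: eq_bigr => k _.
  by congr (_ * _); rewrite [RHS]mxE// [RHS]mxE [LHS]mxE.
apply/matrixP => i j; rewrite !rowmx mxform_tr !mxform_mul (AF _ _ (Pd i)) (AF _ _ (Pd j)).
rewrite !mxformZl (mxform_sym (row j P) _ BT).
have := mxform_sym (row i P) (row j P) ABT.
rewrite !mxform_mul !Pd !mxformZl (mxform_sym (row j P) _ BT).
have [-> //|b0] := eqVneq (mxform B (row i P) (row j P)) 0; first by rewrite !mulr0.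
by move=> /(mulIf b0) ->.
Qed.

Variables (br : E -> E -> E).
Hypothesis brl : forall Y, linear (br^~ Y).
Hypothesis brr : forall X, linear (br X).
Hypothesis br_self : forall X, br X X = 0.
Hypothesis jacobi : forall X Y Z, br X (br Y Z) = br (br X Y) Z + br Y (br X Z).

(** Matrices act on row vectors from the right, so products occur in the reverse order of
    composition. *)
Definition adm X : 'M[R]_n := lin1_mx (br X).
Definition kl X Y : R := \tr (adm X *m adm Y).

Lemma admE u X : u *m adm X = br X u. Proof. exact: mul_lin1_mx. Qed.

Lemma br_anti X Y : br X Y = - br Y X.
Proof.
have := br_self (1 *: X + Y); rewrite brl !brr !br_self scaler0 add0r addr0 !scale1r.
by move=> /eqP; rewrite addr_eq0 => /eqP.
Qed.

Lemma adm_linear l X Y : adm (l *: X + Y) = l *: adm X + adm Y.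
Proof.
apply: mulmx_ext => u; rewrite mulmxDr -scalemxAr !admE; exact: brl.
Qed.

Lemma adm_br X Y : adm (br X Y) = adm Y *m adm X - adm X *m adm Y.
Proof.
apply: mulmx_ext => u; rewrite mulmxBr !mulmxA !admE jacobi.
by rewrite addrK.
Qed.

Lemma kl_sym X Y : kl X Y = kl Y X. Proof. exact: mxtrace_mulC. Qed.

Lemma kl_linearl Z l X Y : kl (l *: X + Y) Z = l * kl X Z + kl Y Z.
Proof. by rewrite /kl adm_linear mulmxDl -scalemxAl raddfD /= linearZ. Qed.

Lemma kl_linearr Z l X Y : kl Z (l *: X + Y) = l * kl Z X + kl Z Y.
Proof. by rewrite kl_sym kl_linearl !(kl_sym _ Z). Qed.

Lemma klDl X Y Z : kl (X + Y) Z = kl X Z + kl Y Z.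
Proof. by have := kl_linearl Z 1 X Y; rewrite scale1r mul1r. Qed.

Lemma kl0l Z : kl 0 Z = 0.
Proof. by apply: (addrI (kl 0 Z)); rewrite -klDl !addr0. Qed.

Lemma klNl X Z : kl (- X) Z = - kl X Z.
Proof. by apply/eqP; rewrite -addr_eq0 -klDl addNr kl0l. Qed.

Lemma klDr Z X Y : kl Z (X + Y) = kl Z X + kl Z Y.
Proof. by rewrite kl_sym klDl !(kl_sym Z). Qed.

Lemma klNr Z X : kl Z (- X) = - kl Z X.
Proof. by rewrite kl_sym klNl (kl_sym Z). Qed.

Lemma kl_invariant X Y Z : kl (br X Y) Z = - kl Y (br X Z).
Proof.
apply/eqP; rewrite -addr_eq0 /kl !adm_br mulmxBl mulmxBr !raddfB /=.
rewrite -[adm X *m adm Y *m adm Z]mulmxA [\tr (adm X *m _)]mxtrace_mulC !mulmxA.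
by rewrite addrA subrK subrr.
Qed.

Variables k p : {vspace E}.
Hypothesis kpT : (k + p = fullv)%VS.
Hypothesis kp0 : (k :&: p = 0)%VS.
Hypothesis br_kk : forall X Y, X \in k -> Y \in k -> br X Y \in k.
Hypothesis br_kp : forall X Y, X \in k -> Y \in p -> br X Y \in p.
Hypothesis br_pp : forall X Y, X \in p -> Y \in p -> br X Y \in k.
Hypothesis kl_neg : forall X, X \in k -> X != 0 -> kl X X < 0.
Hypothesis kl_pos : forall X, X \in p -> X != 0 -> 0 < kl X X.

Lemma br_pk X Y : X \in p -> Y \in k -> br X Y \in p.
Proof. by move=> Xp Yk; rewrite br_anti memvN br_kp. Qed.

Definition kpart X : E := daddv_pi k p X.
Definition ppart X : E := daddv_pi p k X.

Lemma kpart_mem X : kpart X \in k. Proof. exact: memv_pi. Qed.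
Lemma ppart_mem X : ppart X \in p. Proof. exact: memv_pi. Qed.

Lemma kp_parts X : kpart X + ppart X = X.
Proof. by apply: daddv_pi_add; rewrite ?kpT ?memvf. Qed.

Lemma kp_disjoint X : X \in k -> X \in p -> X = 0.
Proof. by move=> Xk Xp; apply/eqP; rewrite -memv0 -kp0 memv_cap Xk. Qed.

Lemma kp_unique X Y X' Y' : X \in k -> X' \in k -> Y \in p -> Y' \in p ->
  X + Y = X' + Y' -> X = X' /\ Y = Y'.
Proof.
move=> Xk X'k Yp Y'p e.
have d : X - X' = Y' - Y.
  by apply/eqP; rewrite subr_eq addrAC eq_sym subr_eq e addrC.
have z : X - X' = 0 by apply: kp_disjoint; [exact: memvB|rewrite d; exact: memvB].
split; first by apply/eqP; rewrite -subr_eq0 z.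
by apply/eqP; rewrite eq_sym -subr_eq0 -d z.
Qed.

Lemma kpartD X Y : X \in k -> Y \in p -> kpart (X + Y) = X /\ ppart (X + Y) = Y.
Proof.
by move=> Xk Yp; apply: kp_unique => //; rewrite ?kpart_mem ?ppart_mem ?kp_parts.
Qed.

(** The Cartan involution. *)
Definition theta X := kpart X - ppart X.

Lemma theta_linear : linear theta.
Proof.
move=> l X Y; rewrite /theta /kpart /ppart (linearP (daddv_pi k p)).
by rewrite (linearP (daddv_pi p k)) scalerBr opprD addrACA.
Qed.

Lemma thetaD X Y : X \in k -> Y \in p -> theta (X + Y) = X - Y.
Proof. by move=> Xk Yp; rewrite /theta; have [-> ->] := kpartD Xk Yp. Qed.

Lemma thetaK X : theta (theta X) = X.
Proof.
by rewrite {2}/theta thetaD ?memvN ?kpart_mem ?ppart_mem// opprK kp_parts.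
Qed.

Lemma theta_br_k X u : X \in k -> theta (br X u) = br X (theta u).
Proof.
move=> Xk; rewrite -{1}(kp_parts u) /theta -/(theta _).
have /pack_linear[f fE] := brr X; have fE' w : br X w = f w by rewrite fE.
rewrite !fE' linearD linearB -!fE'.
by rewrite -/(theta _) thetaD ?br_kk ?br_kp ?kpart_mem ?ppart_mem.
Qed.

Lemma theta_br_p X u : X \in p -> theta (br X u) = - br X (theta u).
Proof.
move=> Xp; rewrite -{1}(kp_parts u) /theta -/(theta _).
have /pack_linear[f fE] := brr X; have fE' w : br X w = f w by rewrite fE.
rewrite !fE' linearD linearB -!fE' opprB addrC.
by rewrite -/(theta _) thetaD ?br_pk ?br_pp ?kpart_mem ?ppart_mem.
Qed.

(** Conjugation by [theta] fixes [adm X] and negates [adm Y], so the trace of their product equals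
    its opposite. *)
Lemma kl_kp X Y : X \in k -> Y \in p -> kl X Y = 0.
Proof.
move=> Xk Yp; pose J := lin1_mx theta.
have JE u : u *m J = theta u by exact: mul_lin1_mx theta_linear.
have JJ : J *m J = 1%:M by apply: mulmx_ext => u; rewrite mulmxA !JE thetaK mulmx1.
have AJ : adm X *m J = J *m adm X.
  by apply: mulmx_ext => u; rewrite !mulmxA !(JE, admE) theta_br_k.
have BJ : adm Y *m J = - (J *m adm Y).
  by apply: mulmx_ext => u; rewrite mulmxN !mulmxA !(JE, admE) theta_br_p.
have e1 : \tr (adm X *m adm Y) = \tr (J *m (adm X *m adm Y *m J)).
  by rewrite [RHS]mxtrace_mulC -(mulmxA (adm X *m adm Y) J J) JJ mulmx1.
have e2 : J *m (adm X *m adm Y *m J) = - (adm X *m adm Y).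
  rewrite -(mulmxA (adm X)) BJ !mulmxN (mulmxA (adm X) J) AJ -(mulmxA J (adm X)).
  by rewrite (mulmxA J J) JJ mul1mx.
have : kl X Y = - kl X Y by rewrite {1}/kl e1 e2 raddfN.
move=> /eqP; rewrite -addr_eq0 -mulr2n mulrn_eq0 => /eqP //.
Qed.

(** Gram matrix of the inner product [- kl u (theta v)], for which [ad] is symmetric on [p] and skew
    on [k]. *)
Definition ipmx : 'M[R]_n :=
  \matrix_(i, j) - kl (delta_mx 0 i) (theta (delta_mx 0 j)).

Lemma ipmxE u v : mxform ipmx u v = - kl u (theta v).
Proof.
apply: (@mxformP (fun u v => - kl u (theta v))) => [w l x y|w l x y].
  by rewrite kl_linearl opprD mulrN.
by rewrite theta_linear kl_linearr opprD mulrN.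
Qed.

Lemma ipmx_parts u v :
  mxform ipmx u v = kl (ppart u) (ppart v) - kl (kpart u) (kpart v).
Proof.
rewrite ipmxE -{1}(kp_parts u) /theta klDl !klDr !klNr.
rewrite (kl_kp (kpart_mem u) (ppart_mem v)) (kl_sym (ppart u) (kpart v)).
by rewrite (kl_kp (kpart_mem v) (ppart_mem u)) oppr0 add0r addr0 opprB addrC.
Qed.

Lemma ipmx_sym : ipmx^T = ipmx.
Proof.
apply: mxform_inj => u v; rewrite mxform_tr !ipmx_parts.
by rewrite (kl_sym (ppart v)) (kl_sym (kpart v)).
Qed.

Lemma ipmx_pos v : v != 0 -> 0 < mxform ipmx v v.
Proof.
move=> v0; rewrite ipmx_parts.
have [p0|p0] := eqVneq (ppart v) 0; have [k0|k0] := eqVneq (kpart v) 0.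
- by move: v0; rewrite -(kp_parts v) p0 k0 addr0 eqxx.
- by rewrite p0 kl0l add0r oppr_gt0 kl_neg ?kpart_mem.
- by rewrite k0 kl0l subr0 kl_pos ?ppart_mem.
- by rewrite subr_gt0 (lt_trans (kl_neg (kpart_mem v) k0))// kl_pos ?ppart_mem.
Qed.

Lemma ip_adm_p X u v : X \in p -> mxform ipmx (br X u) v = mxform ipmx u (br X v).
Proof.
by move=> Xp; rewrite !ipmxE kl_invariant theta_br_p// klNr.
Qed.

Lemma ip_adm_k X u v : X \in k -> mxform ipmx (br X u) v = - mxform ipmx u (br X v).
Proof. by move=> Xk; rewrite !ipmxE kl_invariant theta_br_k. Qed.

Lemma adm_ipmx_sym X : X \in p -> (adm X *m ipmx)^T = adm X *m ipmx.
Proof.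
move=> Xp; apply: mxform_inj => u v; rewrite mxform_tr !mxform_mul !admE.
by rewrite ip_adm_p// (mxform_sym _ _ ipmx_sym).
Qed.

Lemma adm_diagonalizable X : X \in p -> diagonalizable (adm X).
Proof.
by move=> Xp; apply: (symmetric_diagonalizable ipmx_pos ipmx_sym); exact: adm_ipmx_sym.
Qed.

Lemma center_eq0 X : adm X = 0 -> X = 0.
Proof.
move=> X0; apply/eqP; apply: contraT => /ipmx_pos.
by rewrite ipmxE /kl X0 mul0mx raddf0 oppr0 ltxx.
Qed.

(** Removing the component in [p], which acts symmetrically, leaves a component in [k] whose [ad] is
    both symmetric and skew, hence zero. *)
Lemma symmetric_mem_p X :
  (forall u v, mxform ipmx (br X u) v = mxform ipmx u (br X v)) -> X \in p.
Proof.
move=> Xsym; have Xk0 : kpart X = 0; last first.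
  by rewrite -(kp_parts X) Xk0 add0r ppart_mem.
apply: center_eq0; apply: mxform_inj => u v.
suff : forall u v, mxform ipmx (br (kpart X) u) v = 0.
  move=> /(_ u (br (kpart X) u)) e.
  have [z|/ipmx_pos] := eqVneq (br (kpart X) u) 0; last by rewrite e ltxx.
  by rewrite /mxform admE z mulmx0.
move=> {}u {}v.
have XE w : br X w = br (kpart X) w + br (ppart X) w.
  by have := brl w 1 (kpart X) (ppart X); rewrite scale1r kp_parts scale1r.
have := Xsym u v; rewrite !XE mxformDl mxformDr (ip_adm_p _ _ (ppart_mem X)).
move=> /addIr; rewrite (ip_adm_k _ _ (kpart_mem X)) => /eqP.
rewrite -subr_eq0 -opprD oppr_eq0 -mulr2n mulrn_eq0 => /eqP ->.
by rewrite oppr0.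
Qed.

End CartanAlgebra.

Section GlobalStructure.
Context {R : realType} {n : nat} {G : topGroupType}.
Variables (atlas : set (chart R n G)) (c : chart R n G).
Notation E := 'rV[R]_n.
Notation lcoord := (lcoord c).
Notation small := (small c).
Notation ops := (one_parameter_subgroup c).
Notation has_exp := (has_exp c).
Notation lie_exp := (lie_exp c).
Notation Ad := (Ad c).
Notation br := (bracket c).
Hypothesis GL : lie_group atlas.
Hypothesis atc : atlas c.
Hypothesis c1 : chart_dom c 1%g.
Variables C d : R.
Hypothesis CdP : mul_bound c C d.
Implicit Types (X Y Z : E) (g h : G).

Let brl : forall Y, linear (br^~ Y) := bracket_linearl GL atc c1.
Let brr : forall X, linear (br X) := bracket_linearr GL atc c1.

Lemma brZZ s t X Y : br (s *: X) (t *: Y) = (s * t) *: br X Y.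
Proof.
have /pack_linear[f fE] := brl (t *: Y); have fE' w : br w (t *: Y) = f w by rewrite fE.
have /pack_linear[h hE] := brr X; have hE' w : br X w = h w by rewrite hE.
have -> : br (s *: X) (t *: Y) = s *: br X (t *: Y) by rewrite !fE' linearZ.
have -> : br X (t *: Y) = t *: br X Y by rewrite !hE' linearZ.
exact: scalerA.
Qed.

Lemma lie_exp_comm X Y : has_exp X -> has_exp Y -> br X Y = 0 ->
  forall s t, (lie_exp (s *: X) * lie_exp (t *: Y) = lie_exp (t *: Y) * lie_exp (s *: X))%g.
Proof.
move=> hX hY XY s t; apply: (Ad_exp_fix GL atc c1 CdP); try exact: has_expZ.
by rewrite brZZ XY scaler0.
Qed.

Lemma ops_add X Y : has_exp X -> has_exp Y -> br X Y = 0 ->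
  ops (X + Y) (fun t => lie_exp (t *: X) * lie_exp (t *: Y))%g.
Proof.
move=> hX hY XY; have comm := lie_exp_comm hX hY XY.
have oX := ops_lie_exp c1 CdP hX; have oY := ops_lie_exp c1 CdP hY.
have [cX DX _] := oX; have [cY DY _] := oY.
apply: ops_intro.
- by move=> t; exact: (cvg_mulg _ (cX t) (cY t)).
- by move=> s t; rewrite DX DY -!mulgA; congr (_ * _)%g; rewrite !mulgA comm.
move=> e e0.
have [C0 d0 _ _ _] := CdP.
have nsm Z : has_exp Z -> exists2 r : R, 0 < r & forall h : R, `|h| < r ->
    small d (lie_exp (h *: Z)).
  move=> hZ; have oZ := ops_lie_exp c1 CdP hZ; have [cZ _ _] := oZ.
  have : \forall h \near (0 : R), small d (lie_exp (h *: Z)).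
    apply: cZ; have -> := ops1 oZ; exact: nbhs_small.
  by move=> /nbhs_normP[r /= r0 rP]; exists r => // h hr; apply: rP; rewrite /= sub0r normrN.
have [r1 r10 s1] := nsm _ hX; have [r2 r20 s2] := nsm _ hY.
have e3 : 0 < e / 3 by rewrite divr_gt0.
pose q := Num.min 1 (e / 3); have q0 : 0 < q by rewrite lt_min ltr01.
have [d1 d10 D1] := ops_derive oX q0; have [d2 d20 D2] := ops_derive oY q0.
pose M := C * ((1 + `|X|) * (1 + `|Y|)) + 1.
have M0 : 0 < M by rewrite ltr_wpDl// mulr_ge0// mulr_ge0// addr_ge0.
exists (Num.min (Num.min r1 r2) (Num.min (Num.min d1 d2) (e / 3 / M))).
  by rewrite !lt_min r10 r20 d10 d20 divr_gt0.
move=> h; rewrite !lt_min.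
move=> /andP[/andP[/s1 g1 /s2 g2] /andP[/andP[/D1 {}D1 /D2 {}D2] hM]].
have := lcoord_mul c1 CdP g1 g2; move: D1 D2.
move: (lcoord (lie_exp (h *: X))) (lcoord (lie_exp (h *: Y))) => x y.
move: (lcoord _) => z Dx Dy Dz.
have xh Z (w : E) : `|w - h *: Z| <= q * `|h| -> `|w| <= (1 + `|Z|) * `|h|.
  move=> wh; rewrite -[w](subrK (h *: Z)) (le_trans (ler_normD _ _))// mulrDl lerD//.
    by rewrite (le_trans wh)// ler_wpM2r// ge_min lexx.
  by rewrite normrZ mulrC.
have Dxy : C * (`|x| * `|y|) <= e / 3 * `|h|.
  apply: le_trans (ler_wpM2l C0 (ler_pM (normr_ge0 _) (normr_ge0 _) (xh _ _ Dx) (xh _ _ Dy))) _.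
  have -> : C * ((1 + `|X|) * `|h| * ((1 + `|Y|) * `|h|)) = (M - 1) * `|h| * `|h|.
    by rewrite /M; ring.
  rewrite ler_wpM2r//; move: (ltW hM); rewrite ler_pdivlMr// => hM'.
  by rewrite mulrBl mul1r (le_trans _ hM')// mulrC lerBlDr lerDl.
have qh : q * `|h| <= e / 3 * `|h| by rewrite ler_wpM2r// ge_min lexx orbT.
have -> : z - h *: (X + Y) = (z - x - y) + (x - h *: X) + (y - h *: Y).
  by apply/rowP => i; rewrite !mxE; ring.
rewrite (le_trans (ler_normD _ _))// (le_trans (lerD (ler_normD _ _) (lexx _)))//.
move: (le_trans Dz Dxy) (le_trans Dx qh) (le_trans Dy qh).
move: `|z - x - y| `|x - h *: X| `|y - h *: Y| => a b c' ha hb hc.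
have -> : e * `|h| = e / 3 * `|h| + e / 3 * `|h| + e / 3 * `|h| by field.
by rewrite !lerD.
Qed.

Lemma lie_exp_add X Y : has_exp X -> has_exp Y -> br X Y = 0 ->
  lie_exp (X + Y) = (lie_exp X * lie_exp Y)%g.
Proof.
move=> hX hY XY; rewrite (lie_exp_ops c1 CdP (ops_add hX hY XY)).
by rewrite !scale1r.
Qed.

End GlobalStructure.

(** * Existence of the exponential and structure of [A] *)

Section CartanStructure.
Context {R : realType} {n : nat} {G : topGroupType}.
Variables (atlas : set (chart R n G)) (c : chart R n G).
Notation E := 'rV[R]_n.
Notation has_exp := (has_exp c).
Notation lie_exp := (lie_exp c).
Notation exp_image := (exp_image c).
Notation Ad := (Ad c).
Notation br := (bracket c).
Notation kl := (kl br).
Hypothesis GL : lie_group atlas.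
Hypothesis atc : atlas c.
Hypothesis c1 : chart_dom c 1%g.
Variables C d : R.
Hypothesis CdP : mul_bound c C d.
Implicit Types (X Y Z H : E) (g h : G).

Let brl : forall Y, linear (br^~ Y) := bracket_linearl GL atc c1.
Let brr : forall X, linear (br X) := bracket_linearr GL atc c1.

Variables (K A : set G) (k p a : {vspace E}) (Phi : set 'Hom(subvs_of a, R^o)).
Hypothesis ncpt : ~ compact [set: G].
Hypothesis CD : cartan_decomposition c K A k p Phi.

Let Kgrp : subgroup K. Proof. by have [[[]]] := CD. Qed.
Let Kcpt : compact K. Proof. by have [[[]]] := CD. Qed.
Let kLie : is_lie_algebra_of c K k. Proof. by have [[]] := CD. Qed.
Let kpT : (k + p = fullv)%VS. Proof. by have [_ [[[]]]] := CD. Qed.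
Let kp0 : (k :&: p = 0)%VS. Proof. by have [_ [[[]]]] := CD. Qed.
Let br_kk : forall X Y, X \in k -> Y \in k -> br X Y \in k.
Proof. by have [_ [[_ [? ? ?] _ _] _] _ _ _] := CD. Qed.
Let br_kp : forall X Y, X \in k -> Y \in p -> br X Y \in p.
Proof. by have [_ [[_ [? ? ?] _ _] _] _ _ _] := CD. Qed.
Let br_pp : forall X Y, X \in p -> Y \in p -> br X Y \in k.
Proof. by have [_ [[_ [? ? ?] _ _] _] _ _ _] := CD. Qed.
Let kl_neg : forall X, X \in k -> X != 0 -> kl X X < 0.
Proof. by have [_ [[_ _ ? ?] _] _ _ _] := CD. Qed.
Let kl_pos : forall X, X \in p -> X != 0 -> 0 < kl X X.
Proof. by have [_ [[_ _ ? ?] _] _ _ _] := CD. Qed.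
(* Keeps unification from unfolding derivatives. *)
Local Opaque Defs.Ad bracket adm.

Let GKp : [set: G] = K *s exp_image p. Proof. by have [_ [_ ?] _ _ _] := CD. Qed.
Let Acartan : split_cartan_subgroup c p A. Proof. by have [_ _ [? _] _ _] := CD. Qed.
Let aLie : is_lie_algebra_of c A a. Proof. by have [_ _ [_ ?] _ _] := CD. Qed.
Let GKAK : [set: G] = K *s closed_chamber c A Phi *s K. Proof. by have [] := CD. Qed.

Let K1 : K 1%g. Proof. by have [] := Kgrp. Qed.
Let KM g h : K g -> K h -> K (g * h)%g.
Proof.
have [_ KB] := Kgrp => Kg Kh; rewrite -[h]invgK; apply: (KB) => //.
by rewrite -[_^-1%g]mul1g; exact: KB.
Qed.

Let kp_disj X : X \in k -> X \in p -> X = 0.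
Proof. by move=> Xk Xp; apply/eqP; rewrite -memv0 -kp0 memv_cap Xk. Qed.

(* Where no one-parameter subgroup exists [lie_exp] takes the junk value [1], so
   such an [X] belongs to the Lie algebra of every subgroup. *)
Lemma no_exp_mem (H : set G) (h : {vspace E}) X :
  subgroup H -> is_lie_algebra_of c H h -> ~ has_exp X -> X \in h.
Proof.
move=> [H1 _] hLie nX; apply/hLie => t.
have [->|t0] := eqVneq t 0; first by rewrite scale0r (lie_exp0 c1 CdP).
rewrite lie_exp_default// => hX; apply: nX.
by rewrite -[X]scale1r -(mulVf t0) -scalerA; exact: has_expZ.
Qed.

Lemma has_exp_notin_k X : X \notin k -> has_exp X.
Proof. by apply: contraNP => /(no_exp_mem Kgrp kLie). Qed.

Lemma has_exp_p X : X \in p -> has_exp X.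
Proof.
move=> Xp; have [->|X0] := eqVneq X 0; first exact: has_exp0.
apply: has_exp_notin_k; apply: contraNN X0 => Xk.
by apply/eqP; exact: kp_disj.
Qed.

(** Noncompactness enters here: with [p = 0] the decomposition [G = K exp(p)] reduces to [K]. *)
Lemma p_neq0 : exists2 P, P \in p & P != 0.
Proof.
apply: contrapT => noP; apply: ncpt.
suff -> : [set: G] = K by [].
apply/seteqP; split=> // g _.
have : (K *s exp_image p) g by rewrite -GKp.
move=> [u Ku [_ [X /= Xp <-] <-]].
have -> : X = 0.
  by apply: contrapT => /eqP X0; apply: noP; exists X.
by rewrite (lie_exp0 c1 CdP) mulg1.
Qed.

Lemma p_notin_k : exists P, P \notin k.
Proof.
have [P Pp P0] := p_neq0; exists P.
by apply: contraNN P0 => Pk; apply/eqP; exact: kp_disj.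
Qed.

Lemma br_self_all X : br X X = 0.
Proof.
have [P Pk] := p_notin_k.
apply: (alternating_off_subspace brl brr Pk) => Y Yk.
by apply: (bracket_self GL atc c1 CdP); exact: has_exp_notin_k.
Qed.

Lemma jacobi_all X Y Z : br X (br Y Z) = br (br X Y) Z + br Y (br X Z).
Proof.
have [P Pk] := p_notin_k.
apply: (jacobi_off_subspace brl brr Pk) => {}X {}Y {}Z Xk Yk.
by apply: (jacobi_exp GL atc c1 CdP); exact: has_exp_notin_k.
Qed.

Let ip := ipmx br k p.

Let diag_p X : X \in p -> diagonalizable (adm br X).
Proof.
exact: (adm_diagonalizable brl brr br_self_all jacobi_all kpT kp0 br_kk br_kp br_pp kl_neg kl_pos).
Qed.

Let ip_sym : ip^T = ip.
Proof. exact: (ipmx_sym brl brr br_self_all kpT kp0 br_kk br_kp br_pp). Qed.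

Let adm_sym X : X \in p -> (adm br X *m ip)^T = adm br X *m ip.
Proof. exact: (adm_ipmx_sym brl brr br_self_all jacobi_all kpT kp0 br_kk br_kp br_pp). Qed.

Definition Admx g : 'M[R]_n := lin1_mx (Ad g).

Lemma AdmxE u g : u *m Admx g = Ad g u.
Proof. exact: mul_lin1_mx (Ad_linear GL atc c1 g). Qed.

Local Opaque Admx.

Lemma Admx_eigen X : X \in p -> forall (v : E) (l : R),
  v *m adm br X = l *: v -> v *m Admx (lie_exp X) = expR l *: v.
Proof.
move=> Xp v l; rewrite (admE brr) AdmxE.
by apply: (Ad_exp_eigen GL atc c1 CdP); exact: has_exp_p.
Qed.

Lemma Admx_sym X : X \in p ->
  (Admx (lie_exp X) *m ip)^T = Admx (lie_exp X) *m ip.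
Proof.
move=> Xp; apply: (symmetric_of_function ip_sym (adm_sym Xp) (diag_p Xp)).
exact: Admx_eigen.
Qed.

Lemma Admx_comm g h : (g * h = h * g)%g -> Admx g *m Admx h = Admx h *m Admx g.
Proof.
move=> gh; apply: mulmx_ext => u.
have E2 g' h' : u *m (Admx g' *m Admx h') = Ad h' (Ad g' u).
  by apply: etrans (mulmxA _ _ _) _; rewrite (AdmxE u); exact: AdmxE.
apply: etrans (E2 g h) _; apply: etrans _ (esym (E2 h g)).
by rewrite -(Ad_mul GL atc c1 h g) -(Ad_mul GL atc c1 g h) gh.
Qed.

(** The matrices of [Ad (exp X)] and [Ad (exp Y)] commute. Two uses of [comm_of_function] replace
    them by [ad X] and [ad Y] in turn, and [ad] is injective. *)
Lemma commute_exp_p X Y : X \in p -> Y \in p ->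
  (lie_exp X * lie_exp Y = lie_exp Y * lie_exp X)%g -> br X Y = 0.
Proof.
move=> Xp Yp XY.
have FF := Admx_comm XY.
have h1 : Admx (lie_exp Y) *m adm br X = adm br X *m Admx (lie_exp Y).
  exact: (comm_of_function (@expR_inj R) (diag_p Xp) (Admx_eigen Xp) (esym FF)).
have h2 : adm br X *m adm br Y = adm br Y *m adm br X.
  exact: (comm_of_function (@expR_inj R) (diag_p Yp) (Admx_eigen Yp) (esym h1)).
apply: (center_eq0 brl brr br_self_all kpT kp0 br_kk br_kp br_pp kl_neg kl_pos).
rewrite (adm_br brr jacobi_all X Y); apply/eqP; rewrite subr_eq0.
by apply/eqP; exact: esym h2.
Qed.

Let split_torus (B : set G) :=
  [/\ subgroup B, connected B, abelian_subset B & B `<=` exp_image p].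

Lemma exp_image_split (s : {vspace E}) : (s <= p)%VS ->
  (forall X Y, X \in s -> Y \in s -> br X Y = 0) -> split_torus (exp_image s).
Proof.
move=> sp sab; have hs X : X \in s -> has_exp X.
  by move=> Xs; apply: has_exp_p; exact: subvP sp _ Xs.
split.
- split; first by exists 0; [exact: mem0v|exact: (lie_exp0 c1 CdP)].
  move=> _ _ [X /= Xs <-] [Y /= Ys <-]; exists (X - Y) => /=; first exact: memvB.
  have Ns : - Y \in s by rewrite memvN.
  rewrite (lie_exp_add GL atc c1 CdP (hs _ Xs) (hs _ Ns) (sab _ _ Xs Ns)).
  by rewrite (lie_expN c1 CdP (hs _ Ys)).
(* Connectedness: the image is a union of arcs [t |-> exp (t X)] issued from [1]. *)
- have -> : exp_image s = \bigcup_(X in [set X | X \in s])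
      ((fun t : R => lie_exp (t *: X)) @` `[0, 1]).
    apply/seteqP; split=> [_ [X /= Xs <-]|_ [X /= Xs [t _ <-]]].
      exists X => //; exists 1; last by rewrite scale1r.
      by rewrite /= in_itv/= ler01 lexx.
    by exists (t *: X) => //=; exact: memvZ.
  apply: bigcup_connected.
    exists 1%g => X /= Xs; exists 0; first by rewrite /= in_itv/= lexx ler01.
    by rewrite scale0r (lie_exp0 c1 CdP).
  move=> X /= Xs; apply: connected_continuous_connected; first exact: segment_connected.
  by apply: continuous_subspaceT; have [] := ops_lie_exp c1 CdP (hs _ Xs).
- move=> _ _ [X /= Xs <-] [Y /= Ys <-].
  exact: (Ad_exp_fix GL atc c1 CdP (hs _ Xs) (hs _ Ys) (sab _ _ Xs Ys)).
- by move=> _ [X /= Xs <-]; exists X => //=; exact: subvP sp _ Xs.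
Qed.

(** Logarithms in [p] of elements of [A] commute by [commute_exp_p], so the exponential of their
    span is a split torus containing [A]; maximality of [A] gives equality. This precedes any
    comparison with [a], which may still contain vectors without exponential. *)
Lemma A_exp_image : exists s : {vspace E}, (s <= p)%VS /\ A = exp_image s.
Proof.
have [[Agrp Acon Aab Ap] Amax] := Acartan.
pose S := [set X | X \in p /\ A (lie_exp X)].
have [xs xsS Sxs] := spanning_seq S.
have sp : (<<xs>> <= p)%VS by apply/span_subvP => x /xsS[].
exists <<xs>>%VS; split=> //; apply/esym/Amax.
  apply: exp_image_split => //; apply: (span_commute brl brr xsS xsS) => X Y [Xp AX] [Yp AY].
  by apply: commute_exp_p => //; exact: Aab.
move=> g Ag; have [X /= Xp gX] := Ap _ Ag.
by exists X => //=; apply: Sxs; split=> //; rewrite gX.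
Qed.

Lemma Ad_exp_p_sym X u v : X \in p ->
  mxform ip (Ad (lie_exp X) u) v = mxform ip u (Ad (lie_exp X) v).
Proof.
move=> Xp; have := mxform_sym u v (Admx_sym Xp).
by rewrite !mxform_mul !AdmxE => ->; exact: mxform_sym ip_sym.
Qed.

(** [exp (t X)] lies in [A], inside [exp(p)], so its [Ad] is symmetric for [ip]; differentiating at
    [0] makes [ad X] symmetric. *)
Lemma mem_a_exp_p X : X \in a -> has_exp X -> X \in p.
Proof.
move=> Xa hX; have oX := ops_lie_exp c1 CdP hX.
have [[_ _ _ Ap] _] := Acartan.
apply: (symmetric_mem_p brl brr br_self_all jacobi_all kpT kp0 br_kk br_kp br_pp kl_neg kl_pos).
move=> u v; rewrite -/ip.
have der w : linear (w : E -> R^o) -> forall z,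
    'D_(1 : R^o) (fun t : R^o => w (Ad (lie_exp ((t : R) *: X)) z)) (0 : R^o) = w (br X z).
  move=> wl z; have a1 := Ad_ops_approx GL atc c1 z oX.
  have aw : approx w ((fun t : R^o => Ad (lie_exp ((t : R) *: X)) z) 0) w.
    split=> // e e0; exists 1 => // y _.
    by case/pack_linear: wl => f <-; rewrite linearB subrr normr0 mulr_ge0// ltW.
  rewrite (approx_derive (1 : R^o) (approx_comp (scale_bounded (br X z)) a1 aw)).
  exact: congr1 (scale1r _).
have l1 : linear (fun w => mxform ip w v : R^o).
  by move=> l x y; rewrite mxformDl mxformZl.
have l2 : linear (fun w => mxform ip u w : R^o).
  by move=> l x y; rewrite mxformDr mxformZr.
have fE : (fun t : R^o => mxform ip (Ad (lie_exp ((t : R) *: X)) u) v : R^o) =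
    (fun t : R^o => mxform ip u (Ad (lie_exp ((t : R) *: X)) v) : R^o).
  apply/funext => t; have /Ap[Y /= Yp <-] : A (lie_exp (t *: X)).
    exact: (aLie X).1 Xa t.
  exact: Ad_exp_p_sym.
exact: (etrans (esym (der _ l1 u))
  (etrans (congr1 (fun f => 'D_(1 : R^o) f (0 : R^o)) fE) (der _ l2 v))).
Qed.

(* Otherwise [X] is in both [k] and [a]; a nonzero [Y] of [p] with [exp Y] in [A]
   would be in [k] or put [X] in [p], so [A] is trivial and [G = K A K] compact. *)
Lemma has_exp_all X : has_exp X.
Proof.
apply: contrapT => nX.
have [s [sp As]] := A_exp_image.
have [[Agrp _ _ _] _] := Acartan.
have Xk := no_exp_mem Kgrp kLie nX; have Xa := no_exp_mem Agrp aLie nX.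
have Y0 Y : Y \in s -> Y = 0.
  move=> Ys; have Yp := subvP sp _ Ys.
  have Ya : Y \in a.
    by apply/aLie => t; rewrite As; exists (t *: Y) => //=; exact: memvZ.
  have [hXY|/(no_exp_mem Kgrp kLie) XYk] := pselect (has_exp (X + Y)).
    have XYp : X + Y \in p by apply: mem_a_exp_p => //; exact: memvD.
    have X0 : X = 0.
      by apply: kp_disj => //; rewrite -[X](addrK Y) memvB.
    by case: nX; rewrite X0; exact: has_exp0.
  apply: kp_disj => //; have -> : Y = X + Y - X by rewrite addrAC subrr add0r.
  exact: memvB.
apply: ncpt; suff -> : [set: G] = K by [].
apply/seteqP; split=> // g _.
have : (K *s closed_chamber c A Phi *s K) g by rewrite -GKAK.
move=> [_ [u Ku [b [Ab _] <-]] [v Kv <-]].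
move: Ab; rewrite As => -[Y /= /Y0 -> <-].
by rewrite (lie_exp0 c1 CdP) mulg1; exact: KM.
Qed.

Lemma a_sub_p : (a <= p)%VS.
Proof. by apply/subvP => X Xa; apply: mem_a_exp_p => //; exact: has_exp_all. Qed.

Lemma lie_exp_mem_A X : X \in a -> A (lie_exp X).
Proof. by move=> /aLie /(_ 1); rewrite scale1r. Qed.

Lemma br_aa X Y : X \in a -> Y \in a -> br X Y = 0.
Proof.
move=> Xa Ya; have [[_ _ Aab _] _] := Acartan.
apply: commute_exp_p; [exact: subvP a_sub_p _ Xa|exact: subvP a_sub_p _ Ya|].
by apply: Aab; exact: lie_exp_mem_A.
Qed.

Lemma A_lie_log g : A g -> lie_exp (vsval (lie_log c a g)) = g.
Proof.
move=> Ag; rewrite /lie_log; case: xgetP => [H _ <- //|/=].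
have [s [sp As]] := A_exp_image.
move: (Ag); rewrite {1}As => -[Y /= Ys Yg].
have Ya : Y \in a.
  by apply/aLie => t; rewrite As; exists (t *: Y) => //=; exact: memvZ.
by move=> /(_ (Subvs Ya)).
Qed.

(** [exp (a + <[X]>)] is a split torus containing [A]; by maximality it is [A], which therefore
    contains all [exp (t X)]. *)
Lemma centralizer_a X : X \in p -> (forall H, H \in a -> br H X = 0) -> X \in a.
Proof.
move=> Xp Xcent; have [_ Amax] := Acartan.
pose s := (a + <[X]>)%VS.
have sp : (s <= p)%VS by rewrite subv_add a_sub_p -memvE.
have sab := abelian_add_line brl brr br_self_all br_aa Xcent.
have As : A = exp_image s.
  apply/esym/Amax; first exact: exp_image_split.
  move=> g Ag; rewrite -(A_lie_log Ag); exists (vsval (lie_log c a g)) => //=.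
  by rewrite -[X in X \in _]addr0; apply: memv_add; [exact: subvsP|exact: mem0v].
apply/aLie => t; rewrite As; exists (t *: X) => //=; apply: memvZ.
by rewrite -[X]add0r; apply: memv_add; [exact: mem0v|exact: memv_line].
Qed.

End CartanStructure.

(** * The first-order decomposition with uniform bounds *)

Section TransverseDecomposition.
Context {R : realType} {n : nat} {G : topGroupType}.
Variables (atlas : set (chart R n G)) (c : chart R n G).
Notation E := 'rV[R]_n.
Notation lie_exp := (lie_exp c).
Notation Ad := (Ad c).
Notation br := (bracket c).
Hypothesis GL : lie_group atlas.
Hypothesis atc : atlas c.
Hypothesis c1 : chart_dom c 1%g.
Variables C d : R.
Hypothesis CdP : mul_bound c C d.
Implicit Types (X Y Z H : E) (g h : G).
Variables (K A : set G) (k p a : {vspace E}) (Phi : set 'Hom(subvs_of a, R^o)).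
Hypothesis ncpt : ~ compact [set: G].
Hypothesis CD : cartan_decomposition c K A k p Phi.

Let brl : forall Y, linear (br^~ Y) := bracket_linearl GL atc c1.
Let brr : forall X, linear (br X) := bracket_linearr GL atc c1.
Let br_self X : br X X = 0. Proof. exact: (br_self_all GL atc c1 CdP ncpt CD). Qed.
Let jacobi X Y Z : br X (br Y Z) = br (br X Y) Z + br Y (br X Z).
Proof. exact: (jacobi_all GL atc c1 CdP ncpt CD). Qed.
Let exp_all X : has_exp c X. Proof. exact: (has_exp_all GL atc c1 CdP ncpt CD). Qed.
Let ap : (a <= p)%VS. Proof. exact: (a_sub_p GL atc c1 CdP ncpt CD). Qed.
Let aa X Y : X \in a -> Y \in a -> br X Y = 0.
Proof. exact: (br_aa GL atc c1 CdP ncpt CD). Qed.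
Let kpT : (k + p = fullv)%VS. Proof. by have [_ [[[]]]] := CD. Qed.
Let kp0 : (k :&: p = 0)%VS. Proof. by have [_ [[[]]]] := CD. Qed.
Let br_kk : forall X Y, X \in k -> Y \in k -> br X Y \in k.
Proof. by have [_ [[_ [? ? ?] _ _] _] _ _ _] := CD. Qed.
Let br_kp : forall X Y, X \in k -> Y \in p -> br X Y \in p.
Proof. by have [_ [[_ [? ? ?] _ _] _] _ _ _] := CD. Qed.
Let br_pp : forall X Y, X \in p -> Y \in p -> br X Y \in k.
Proof. by have [_ [[_ [? ? ?] _ _] _] _ _ _] := CD. Qed.
Let kl_neg : forall X, X \in k -> X != 0 -> kl br X X < 0.
Proof. by have [_ [[_ _ ? ?] _] _ _ _] := CD. Qed.
Let kl_pos : forall X, X \in p -> X != 0 -> 0 < kl br X X.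
Proof. by have [_ [[_ _ ? ?] _] _ _ _] := CD. Qed.
Let br_pk X Y : X \in p -> Y \in k -> br X Y \in p.
Proof. exact: (br_pk brl brr br_self br_kp). Qed.

Local Opaque Defs.Ad bracket adm.

Lemma joint_eigenbasis : exists2 P : 'M[R]_n, P \in unitmx &
  forall i H, H \in a -> exists l, br H (row i P) = l *: row i P.
Proof.
pose As := [seq adm br H | H <- vbasis a].
have [||P Pu PA] := @codiagonalizable_basis R n As.
- move=> _ _ /mapP[X Xa ->] /mapP[Y Ya ->].
  have adm0 : adm br 0 = 0.
    by have := adm_linear brl brr (-1) 0 0; rewrite scaler0 addr0 scaleN1r addNr.
  have e := adm_br brr jacobi X Y.
  rewrite (aa (vbasis_mem Xa) (vbasis_mem Ya)) adm0 in e.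
  by apply/eqP; rewrite eq_sym -subr_eq0; apply/eqP; exact: esym e.
- move=> _ /mapP[X Xa ->].
  have Xp := subvP ap _ (vbasis_mem Xa).
  exact: (adm_diagonalizable brl brr br_self jacobi kpT kp0 br_kk br_kp br_pp kl_neg kl_pos Xp).
exists P => // i H Ha; pose e := row i P.
have /choice[l lP] : forall X, exists l : R, X \in (vbasis a : seq E) -> br X e = l *: e.
  move=> X; have [Xa|_] := boolP (X \in (vbasis a : seq E)); last by exists 0.
  have [dd ddP] := PA _ (map_f (adm br) Xa).
  by exists (dd i) => _; rewrite -(admE brr) ddP.
(* The weight is linear in [H], hence given by its values on the basis. *)
exists (\sum_(j < \dim a) coord (vbasis a) j H * l (vbasis a)`_j).
have /pack_linear[f fE] := brl e; have fE' w : br w e = f w by rewrite fE.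
rewrite -/e fE' {1}(coord_vbasis Ha) linear_sum scaler_suml; apply: eq_bigr => j _.
have m : (vbasis a)`_j \in (vbasis a : seq E) by apply: mem_nth; rewrite size_tuple.
by rewrite linearZ -fE' (lP _ m) [LHS]scalerA.
Qed.

Lemma root_of_eigenvector (e : E) : e != 0 ->
  (forall H, H \in a -> exists l, br H e = l *: e) ->
  exists al : 'Hom(subvs_of a, R^o), root_space c al e.
Proof.
move=> /rV0Pn[j ej] eP.
(* A nonzero coordinate of [e] reads the eigenvalue off [br H e], linearly in [H]. *)
have /pack_linear[f fE] : linear (fun H : subvs_of a => br (vsval H) e 0 j / e 0 j : R^o).
  move=> l x y; rewrite linearP /= brl !mxE mulrDl -mulrA//.
exists (linfun f) => H; rewrite lfunE/= fE.
have [l ->] := eP _ (subvsP H).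
by rewrite mxE mulfK.
Qed.

(** Since [v - w = - 2 sinh l], the fractions are [- 1 / sinh l] and [1 + coth l]. With
    [x = exp (- |l|) <= q], each has the form [2 y / (1 - x^2)] with [|y| <= 1]. *)
Lemma sinh_coth_bound (C0 l : R) : 0 < C0 -> C0 <= `|l| ->
  let w := expR l in let v := expR (- l) in let q := expR (- C0) in
  [/\ v - w != 0, `|2 / (v - w)| <= 2 / (1 - q ^+ 2) &
      `|- (2 * w) / (v - w)| <= 2 / (1 - q ^+ 2)].
Proof.
move=> C00 Cl w v q.
have q0 : 0 < q by exact: expR_gt0.
have q1 : q < 1 by rewrite -expR0 ltr_expR oppr_lt0.
have wv : w * v = 1 by rewrite -expRD subrr expR0.
have w0 : 0 < w by exact: expR_gt0.
have v0 : 0 < v by exact: expR_gt0.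
have den (x : R) : 0 < x -> x <= q -> 0 < 1 - q ^+ 2 /\ 1 - q ^+ 2 <= 1 - x ^+ 2.
  by move=> x0 xq; split; nra.
have inv_le (x : R) : 0 < x -> x <= q -> (1 - x ^+ 2)^-1 <= (1 - q ^+ 2)^-1.
  move=> x0 xq; have [h1 h2] := den _ x0 xq.
  by rewrite lef_pV2 ?posrE//; exact: lt_le_trans h2.
have numer (x y : R) : 0 < x -> x <= q -> `|y| <= 1 ->
    `|2 * y * (1 - x ^+ 2)^-1| <= 2 / (1 - q ^+ 2).
  move=> x0 xq y1; have [h1 h2] := den _ x0 xq.
  have h3 : 0 < (1 - x ^+ 2)^-1 by rewrite invr_gt0 (lt_le_trans h1).
  rewrite 2!normrM (gtr0_norm h3) ger0_norm// ler_pM ?inv_le ?(ltW h3) ?mulr_ge0//.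
  by rewrite ler_piMr.
have [l0|l0] := leP 0 l.
  have vq : v <= q by rewrite ler_expR lerN2 -(ger0_norm l0).
  have [h1 h2] := den _ v0 vq.
  have v20 : 1 - v ^+ 2 != 0 by rewrite gt_eqF// (lt_le_trans h1).
  have wE : w = v^-1 by rewrite -[w]mulr1 -(mulfV (lt0r_neq0 v0)) mulrA wv mul1r.
  have vwE : v - w = - ((1 - v ^+ 2) / v) by rewrite wE; field; rewrite gt_eqF.
  split.
  - by rewrite vwE oppr_eq0 mulf_neq0// invr_eq0 gt_eqF.
  - have -> : 2 / (v - w) = 2 * (- v) * (1 - v ^+ 2)^-1.
      by rewrite vwE; field; rewrite v20 gt_eqF.
    by apply: numer => //; rewrite normrN gtr0_norm//; lra.
  - have -> : - (2 * w) / (v - w) = 2 * 1 * (1 - v ^+ 2)^-1.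
      by rewrite vwE wE; field; rewrite v20 gt_eqF.
    by apply: numer => //; rewrite normr1.
have wq : w <= q by rewrite ler_expR lerNr -(ltr0_norm l0).
have [h1 h2] := den _ w0 wq.
have w20 : 1 - w ^+ 2 != 0 by rewrite gt_eqF// (lt_le_trans h1).
have vE : v = w^-1 by rewrite -[v]mul1r -(mulVf (lt0r_neq0 w0)) -mulrA wv mulr1.
have vwE : v - w = (1 - w ^+ 2) / w by rewrite vE; field; rewrite gt_eqF.
split.
- by rewrite vwE mulf_neq0// invr_eq0 gt_eqF.
- have -> : 2 / (v - w) = 2 * w * (1 - w ^+ 2)^-1.
    by rewrite vwE; field; rewrite w20 gt_eqF.
  by apply: numer => //; rewrite gtr0_norm//; lra.
- have -> : - (2 * w) / (v - w) = 2 * (- w ^+ 2) * (1 - w ^+ 2)^-1.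
    by rewrite vwE; field; rewrite w20 gt_eqF.
  by apply: numer => //; rewrite normrN ger0_norm ?exprn_ge0 ?(ltW w0)//; nra.
Qed.

(** The first case is that of weight zero, where nothing is divided by [sinh]. Stated for one
    eigenvector, the condition survives a small change of [H] with a smaller [s]. *)
Definition regular (s : R) (e H : E) : Prop :=
  (forall H', H' \in a -> br H' e = 0) \/ exists2 l, s <= `|l| & br H e = l *: e.

Lemma AdN_eigen H e l : br H e = l *: e -> Ad (lie_exp (- H)) e = expR (- l) *: e.
Proof.
move=> He; apply: (Ad_exp_eigen GL atc c1 CdP); first exact: exp_all.
have := brl e (-1) H 0; rewrite addr0 scaleN1r => ->.
have -> : br 0 e = 0 by apply: (addrI (br 0 e)); have := brl e 1 0 0;
  rewrite !scale1r !addr0.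
by rewrite addr0 He scaleN1r scaleNr.
Qed.

(* With [e = X + Y], [X] in [k] and [Y] in [p], [Ad (exp (- H)) X] is
   [cosh l X - sinh l Y], so [Y] is a combination of it and [X]. *)
Lemma transverse_eigenvector (s : R) (e : E) : 0 < s ->
  (forall H, H \in a -> exists l, br H e = l *: e) ->
  exists2 B : R, 0 <= B & forall H0, H0 \in a -> regular s e H0 ->
    exists T H Z, [/\ T \in k, H \in a, Z \in k &
      e = Ad (lie_exp (- H0)) T + H + Z] /\
      [/\ `|T| <= B, `|H| <= B & `|Z| <= B].
Proof.
move=> s0 eP.
pose X := kpart k p e; pose Y := ppart k p e.
have Xk : X \in k by exact: kpart_mem.
have Yp : Y \in p by exact: ppart_mem.
have eXY : X + Y = e by exact: kp_parts.
pose b := 2 / (1 - expR (- s) ^+ 2).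
have b0 : 0 <= b.
  rewrite divr_ge0// subr_ge0 exprn_ile1 ?expR_ge0//.
  by rewrite -expR0 ler_expR oppr_le0 ltW.
have brD H : br H e = br H X + br H Y.
  by have := brr H 1 X Y; rewrite !scale1r eXY.
(* [br H] exchanges [k] and [p], so the eigenvalue equation splits into its two components. *)
have parts H l : H \in a -> br H e = l *: e -> br H Y = l *: X /\ br H X = l *: Y.
  move=> Ha; rewrite brD -eXY scalerDr addrC => h.
  have Hp := subvP ap _ Ha.
  by apply: (kp_unique kp0) h; rewrite ?memvZ//; [exact: br_pp|exact: br_pk].
exists ((b + 1) * (`|X| + `|Y|)); first by rewrite mulr_ge0 ?addr_ge0.
have bX : `|X| <= (b + 1) * (`|X| + `|Y|).
  by have := normr_ge0 X; have := normr_ge0 Y; move: b0; nra.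
have bY : `|Y| <= (b + 1) * (`|X| + `|Y|).
  by have := normr_ge0 X; have := normr_ge0 Y; move: b0; nra.
have bbX : b * `|X| <= (b + 1) * (`|X| + `|Y|).
  by have := normr_ge0 X; have := normr_ge0 Y; move: b0; nra.
have b00 : 0 <= (b + 1) * (`|X| + `|Y|) by rewrite mulr_ge0 ?addr_ge0.
move=> H0 H0a [e0|[l sl He]].
  (* At weight zero [Y] centralizes [a], hence belongs to it, and [e = Y + X] is already a
     decomposition with [T = 0]. *)
  have Ya : Y \in a.
    apply: (centralizer_a GL atc c1 CdP ncpt CD Yp) => H Ha.
    have e0' : br H e = 0 *: e by rewrite scale0r; exact: e0.
    have [hY _] := parts H 0 Ha e0'.
    exact: etrans hY (scale0r X).
  exists 0, Y, X; split; last by rewrite normr0.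
  split=> //; first exact: mem0v.
  have /pack_linear[f <-] := Ad_linear GL atc c1 (lie_exp (- H0)).
  by rewrite linear0 add0r addrC.
have [den t1 z1] := sinh_coth_bound s0 sl.
set w := expR l in den t1 z1; set v := expR (- l) in den t1 z1.
have [HY HX] := parts _ _ H0a He.
(* Solve [2 Ad (exp (- H0)) X = (v + w) X + (v - w) Y] for [Y]; the coefficient of [X] in
   [e = X + Y] becomes [1 - (v + w) / (v - w) = - 2 w / (v - w)]. *)
exists ((2 / (v - w)) *: X), 0, ((- (2 * w) / (v - w)) *: X); split; last first.
  split; first by rewrite normrZ (le_trans _ bbX)// ler_wpM2r.
    by rewrite normr0.
  by rewrite normrZ (le_trans _ bbX)// ler_wpM2r.
split; [exact: memvZ|exact: mem0v|exact: memvZ|].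
have A1 := AdN_eigen He.
(* [X - Y] is the image of [e] under the Cartan involution and has the opposite weight. *)
have A2 : Ad (lie_exp (- H0)) (X - Y) = w *: (X - Y).
  rewrite /w -[l]opprK; apply: AdN_eigen.
  have -> : br H0 (X - Y) = br H0 X - br H0 Y.
    by have := brr H0 (-1) Y X; rewrite !scaleN1r (addrC (- Y)) (addrC (- br H0 Y)).
  by rewrite HY HX scaleNr scalerBr opprB.
have AX : Ad (lie_exp (- H0)) X = 2^-1 *: (v *: e + w *: (X - Y)).
  have /pack_linear[f fE] := Ad_linear GL atc c1 (lie_exp (- H0)).
  have fE' u : Ad (lie_exp (- H0)) u = f u by rewrite fE.
  have XE : X = 2^-1 *: (e + (X - Y)).
    by rewrite -eXY; apply/rowP => i; rewrite !mxE; field.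
  rewrite {1}XE fE' linearZ linearD -!fE' A2.
  by rewrite A1.
have lA := Ad_linear GL atc c1 (lie_exp (- H0)).
have -> : Ad (lie_exp (- H0)) ((2 / (v - w)) *: X) =
    (2 / (v - w)) *: Ad (lie_exp (- H0)) X.
  by case/pack_linear: lA => f <-; rewrite linearZ.
rewrite AX addr0 -eXY; apply/rowP => i; rewrite !mxE; field.
by rewrite den.
Qed.

Lemma transverse_decomposition (s : R) (P : 'M[R]_n) : 0 < s -> P \in unitmx ->
  (forall i H, H \in a -> exists l, br H (row i P) = l *: row i P) ->
  exists2 B : R, 0 <= B & forall H0, H0 \in a -> (forall i, regular s (row i P) H0) ->
    forall x, exists T H Z, [/\ T \in k, H \in a, Z \in k &
      x = Ad (lie_exp (- H0)) T + H + Z] /\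
      [/\ `|T| <= B * `|x|, `|H| <= B * `|x| & `|Z| <= B * `|x|].
Proof.
move=> s0 Pu eP.
have /choice[B BP] : forall i, exists B : R, 0 <= B /\
    forall H0, H0 \in a -> regular s (row i P) H0 ->
    exists T H Z, [/\ T \in k, H \in a, Z \in k &
      row i P = Ad (lie_exp (- H0)) T + H + Z] /\
      [/\ `|T| <= B, `|H| <= B & `|Z| <= B].
  by move=> i; have [B B0 BP] := transverse_eigenvector s0 (eP i); exists B.
have lP : linear (fun x : E => x *m invmx P).
  by move=> l x y; rewrite mulmxDl scalemxAl.
have [M M0 MP] := linear_bounded lP.
have B0 i : 0 <= B i by have [] := BP i.
exists (M * \sum_i B i); first by rewrite mulr_ge0// sumr_ge0.
move=> H0 H0a reg x.
have /choice[F FP] : forall i, exists F : E * E * E,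
    [/\ F.1.1 \in k, F.1.2 \in a, F.2 \in k &
      row i P = Ad (lie_exp (- H0)) F.1.1 + F.1.2 + F.2] /\
      [/\ `|F.1.1| <= B i, `|F.1.2| <= B i & `|F.2| <= B i].
  move=> i; have [_ /(_ H0 H0a (reg i))[T [H [Z TP]]]] := BP i.
  by exists (T, H, Z).
pose y := x *m invmx P.
have bnd (f : 'I_n -> E) : (forall i, `|f i| <= B i) ->
    `|\sum_i y 0 i *: f i| <= M * (\sum_i B i) * `|x|.
  move=> fB; rewrite (le_trans (ler_norm_sum _ _ _))// mulr_sumr mulr_suml.
  apply: ler_sum => i _; rewrite normrZ mulrAC ler_pM//.
  exact: le_trans (ler_coord _ _ _) (MP x).
exists (\sum_i y 0 i *: (F i).1.1), (\sum_i y 0 i *: (F i).1.2), (\sum_i y 0 i *: (F i).2).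
split; last by split; apply: bnd => i; have [_ []] := FP i.
split.
- by apply: memv_suml => i _; apply: memvZ; have [[]] := FP i.
- by apply: memv_suml => i _; apply: memvZ; have [[]] := FP i.
- by apply: memv_suml => i _; apply: memvZ; have [[]] := FP i.
have /pack_linear[f fE] := Ad_linear GL atc c1 (lie_exp (- H0)).
have fE' u : Ad (lie_exp (- H0)) u = f u by rewrite fE.
rewrite fE' linear_sum -!big_split /= -[LHS](mulmxKV Pu) mulmx_sum_row.
apply: eq_bigr => i _; have [[_ _ _ rE] _] := FP i.
by rewrite linearZ -fE' rE !scalerDr.
Qed.

End TransverseDecomposition.

(** * Successive approximation *)

Section FourFactors.
Context {R : realType} {n : nat} {G : topGroupType}.
Variable c : chart R n G.
Notation lcoord := (lcoord c).
Notation lpoint := (lpoint c).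
Notation small := (small c).
Notation lie_exp := (lie_exp c).
Notation has_exp := (has_exp c).
Hypothesis c1 : chart_dom c 1%g.
Variables C d : R.
Hypothesis CdP : mul_bound c C d.

Let C0 : 0 <= C. Proof. by case: CdP. Qed.

(** The coefficient of [s] is exactly [1]: in the iteration [g] is the accumulated factor and [h] a
    geometrically small increment, and the bounds must add up rather than multiply. *)
Lemma small_mul g h (s t : R) : small d g -> small d h ->
  `|lcoord g| <= s -> `|lcoord h| <= t -> C * s <= 1 -> s + 2 * t < d ->
  small d (g * h)%g /\ `|lcoord (g * h)%g| <= s + 2 * t.
Proof.
move=> gd hd gs ht Cs std.
suff le : `|lcoord (g * h)%g| <= s + 2 * t.
  by split=> //; split; [exact: (mul_dom CdP)|exact: le_lt_trans std].
have := lcoord_mul c1 CdP gd hd.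
move: (lcoord (g * h)%g) => z zgh.
have t0 : 0 <= t by exact: le_trans ht.
have h1 : C * (`|lcoord g| * `|lcoord h|) <= t.
  rewrite mulrA -[leRHS]mul1r; apply: ler_pM => //; first by rewrite mulr_ge0.
  exact: le_trans (ler_wpM2l C0 gs) Cs.
have -> : z = (z - lcoord g - lcoord h) + (lcoord g + lcoord h).
  by rewrite -[z - _ - _]addrA -opprD subrK.
rewrite (le_trans (ler_normD _ _))//.
have := le_trans zgh h1; have := le_trans (ler_normD _ _) (lerD gs ht).
move: `|_ + _| `|_ - _ - _| => u v; lra.
Qed.

Lemma small_mulr g h (s t : R) : small d g -> small d h ->
  `|lcoord g| <= s -> `|lcoord h| <= t -> C * t <= 1 -> 2 * s + t < d ->
  small d (g * h)%g /\ `|lcoord (g * h)%g| <= 2 * s + t.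
Proof.
move=> gd hd gs ht Ct std.
suff le : `|lcoord (g * h)%g| <= 2 * s + t.
  by split=> //; split; [exact: (mul_dom CdP)|exact: le_lt_trans std].
have := lcoord_mul c1 CdP gd hd.
move: (lcoord (g * h)%g) => z zgh.
have h1 : C * (`|lcoord g| * `|lcoord h|) <= s.
  rewrite mulrCA -[leRHS]mulr1; apply: ler_pM => //; first by rewrite mulr_ge0.
  exact: le_trans (ler_wpM2l C0 ht) Ct.
have -> : z = (z - lcoord g - lcoord h) + (lcoord g + lcoord h).
  by rewrite -[z - _ - _]addrA -opprD subrK.
rewrite (le_trans (ler_normD _ _))//.
have := le_trans zgh h1; have := le_trans (ler_normD _ _) (lerD gs ht).
move: `|_ + _| `|_ - _ - _| => u v; lra.
Qed.

(** The partial products have size at most [m], [3 m], [5 m]; each multiplication by a factor of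
    size [m] errs by [C] times the product of sizes, and [1 + 3 + 5 = 9]. *)
Lemma lcoord_mul4 g1 g2 g3 g4 (m : R) :
  small d g1 -> small d g2 -> small d g3 -> small d g4 ->
  `|lcoord g1| <= m -> `|lcoord g2| <= m -> `|lcoord g3| <= m -> `|lcoord g4| <= m ->
  C * (5 * m) <= 1 -> 7 * m < d ->
  small d (g1 * g2 * g3 * g4)%g /\
  `|lcoord (g1 * g2 * g3 * g4)%g -
     (lcoord g1 + lcoord g2 + lcoord g3 + lcoord g4)| <= 9 * C * m ^+ 2.
Proof.
move=> s1 s2 s3 s4 m1 m2 m3 m4 Cm md.
have m0 : 0 <= m by exact: le_trans m1.
have Cm0 : 0 <= C * m by rewrite mulr_ge0.
have Cm' (q : R) : q <= 5 -> C * (q * m) <= 1.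
  by move=> q5; rewrite (le_trans _ Cm)// ler_wpM2l// ler_wpM2r.
have [|| s12 m12] := small_mul s1 s2 m1 m2.
- by rewrite -[m]mul1r; apply: Cm'; lra.
- by move: md m0; lra.
have [|| s123 m123] := small_mul s12 s3 m12 m3.
- by rewrite (_ : m + 2 * m = 3 * m); [apply: Cm'; lra|ring].
- by move: md m0; lra.
have [|| s1234 m1234] := small_mul s123 s4 m123 m4.
- by rewrite (_ : m + 2 * m + 2 * m = 5 * m); [apply: Cm'; lra|ring].
- by move: md m0; lra.
split=> //.
have bnd g h (q : R) : small d g -> small d h -> `|lcoord g| <= q -> `|lcoord h| <= m ->
    `|lcoord (g * h)%g - lcoord g - lcoord h| <= C * (q * m).
  move=> gd hd gq hm; apply: le_trans (lcoord_mul c1 CdP gd hd) _.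
  by rewrite ler_wpM2l// ler_pM.
have b1 := bnd _ _ _ s1 s2 m1 m2; have b2 := bnd _ _ _ s12 s3 m12 m3.
have b3 := bnd _ _ _ s123 s4 m123 m4.
move: b1 b2 b3; move: (lcoord (g1 * g2)%g) (lcoord (g1 * g2 * g3)%g) (lcoord (g1 * g2 * g3 * g4)%g).
move: (lcoord g1) (lcoord g2) (lcoord g3) (lcoord g4) => a1 a2 a3 a4 x y z b1 b2 b3.
have -> : z - (a1 + a2 + a3 + a4) = (z - y - a4) + (y - x - a3) + (x - a1 - a2).
  by apply/rowP => i; rewrite !mxE; ring.
rewrite (le_trans (ler_normD _ _))// (le_trans (lerD (ler_normD _ _) (lexx _)))//.
apply: le_trans (lerD (lerD b3 b2) b1) _.
by rewrite le_eqVlt; apply/orP; left; apply/eqP; ring.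
Qed.

Lemma exp_product_estimate : exists Q r : R, [/\ 0 <= Q, 0 < r &
  forall X Y x Z (m : R), has_exp X -> has_exp Y -> has_exp Z ->
    `|X| <= m -> `|Y| <= m -> `|x| <= m -> `|Z| <= m -> m < r ->
    let w := (lie_exp X * lie_exp Y * lpoint x * lie_exp Z)%g in
    small d w /\ `|lcoord w - (X + Y + x + Z)| <= Q * m ^+ 2].
Proof.
have [K [r0 [K0 r00 KP]]] := lie_exp_bound c1 CdP.
have [_ d0 _ _ lpP] := CdP.
pose r := Num.min (Num.min r0 (K + 1)^-1) (Num.min (10 * (C + 1))^-1 (d / 14)).
have K1 : 0 < K + 1 by rewrite ltr_wpDl.
have C1 : 0 < 10 * (C + 1) by rewrite mulr_gt0// ltr_wpDl.
(* The four factors have coordinates of size at most [2 m], whence [9 C (2 m)^2]; each of the three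
   exponentials differs from its argument by at most [K m^2]. *)
exists (36 * C + 3 * K), r; split; first by rewrite addr_ge0// mulr_ge0.
  by rewrite !lt_min r00 !invr_gt0 K1 C1 divr_gt0.
move=> X Y x Z m hX hY hZ Xm Ym xm Zm; rewrite !lt_min.
move=> /andP[/andP[mr0 mK] /andP[mC md]] w.
have m0 : 0 <= m by exact: le_trans Xm.
have Km : K * m <= 1.
  by move: (ltW mK); rewrite -[_^-1]mul1r ler_pdivlMr// => h; nra.
have ex U : has_exp U -> `|U| <= m -> [/\ small d (lie_exp U),
    `|lcoord (lie_exp U) - U| <= K * m ^+ 2 & `|lcoord (lie_exp U)| <= 2 * m].
  move=> hU Um; have [sU UK] := KP _ hU (le_lt_trans Um mr0).
  have UK' : `|lcoord (lie_exp U) - U| <= K * m ^+ 2.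
    by rewrite (le_trans UK)// ler_wpM2l// lerXn2r ?nnegrE.
  split=> //; rewrite -[lcoord _](subrK U) (le_trans (ler_normD _ _))//.
  have : K * m ^+ 2 <= m by rewrite expr2 mulrA ler_piMl.
  by move: UK' Um; move: `|U| `|_ - U| => u v; lra.
have [sX Xe X2] := ex _ hX Xm; have [sY Ye Y2] := ex _ hY Ym; have [sZ Ze Z2] := ex _ hZ Zm.
have xd : `|x| < d by rewrite (le_lt_trans xm)// (lt_le_trans md)//
  ler_pdivrMr// ler_peMr ?ltW//; lra.
have [dx xE] := lpP _ xd.
have sx : small d (lpoint x) by split=> //; rewrite xE.
have x2 : `|lcoord (lpoint x)| <= 2 * m by rewrite xE; lra.
have [||sw wE] := lcoord_mul4 sX sY sx sZ X2 Y2 x2 Z2.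
- by move: (ltW mC); rewrite -[_^-1]mul1r ler_pdivlMr// => h; nra.
- lra.
split=> //; move: wE; rewrite -/w xE; move: (lcoord w) => z wE.
move: Xe Ye Ze wE.
move: (lcoord (lie_exp X)) (lcoord (lie_exp Y)) (lcoord (lie_exp Z)) => a1 a2 a4 b1 b2 b4 zE.
have -> : z - (X + Y + x + Z) =
    (z - (a1 + a2 + x + a4)) + ((a1 - X) + (a2 - Y) + (a4 - Z)).
  by apply/rowP => i; rewrite !mxE; ring.
rewrite (le_trans (ler_normD _ _))//.
have b : `|(a1 - X) + (a2 - Y) + (a4 - Z)| <= 3 * K * m ^+ 2.
  rewrite (le_trans (ler_normD _ _))// (le_trans (lerD (ler_normD _ _) (lexx _)))//.
  apply: le_trans (lerD (lerD b1 b2) b4) _.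
  by rewrite le_eqVlt; apply/orP; left; apply/eqP; ring.
apply: le_trans (lerD zE b) _.
by rewrite le_eqVlt; apply/orP; left; apply/eqP; ring.
Qed.

End FourFactors.

Section LocalCompactness.
Context {R : realType} {n : nat} {G : topGroupType}.
Variable c : chart R n G.
Notation E := 'rV[R]_n.
Notation lpoint := (lpoint c).
Hypothesis c1 : chart_dom c 1%g.

Lemma compact_lpoint : exists2 r : R, 0 < r & forall s : R, s < r ->
  compact (lpoint @` [set x | `|x| <= s]).
Proof.
have cod1 : nbhs (chart_map c 1%g) (chart_cod c).
  apply: open_nbhs_nbhs; split; first exact: open_chart_cod.
  exact: chart_map_cod.
move: cod1 => /nbhs_normP[r /= r0 rP]; exists r => // s sr.
apply: continuous_compact; last first.
  apply: bounded_closed_compact.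
    exists s; split; first exact: num_real.
    by move=> x sx y /= ys; exact: le_trans (ltW sx).
  apply: (@closed_comp _ _ (fun v : E => `|v|) [set x | x <= s]) => [v _|].
    exact: norm_continuous.
  exact: closed_le.
apply: continuous_in_subspaceT => x; rewrite inE /= => xs.
have cx : chart_cod c (x + chart_map c 1%g).
  by apply: rP; rewrite /= opprD addrCA subrr addr0 normrN (le_lt_trans xs).
have cv : (y + chart_map c 1%g) @[y --> x] --> x + chart_map c 1%g.
  exact: (cvgD cvg_id (cvg_cst _)).
exact: (cvg_comp _ _ cv (chart_inv_continuous cx)).
Qed.

End LocalCompactness.

Section SuccessiveApproximation.
Context {R : realType} {n : nat} {G : topGroupType}.
Variables (atlas : set (chart R n G)) (c : chart R n G).
Notation E := 'rV[R]_n.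
Notation lcoord := (lcoord c).
Notation lpoint := (lpoint c).
Notation small := (small c).
Notation lie_exp := (lie_exp c).
Notation Ad := (Ad c).
Notation br := (bracket c).
Hypothesis GL : lie_group atlas.
Hypothesis atc : atlas c.
Hypothesis c1 : chart_dom c 1%g.
Variables C d : R.
Hypothesis CdP : mul_bound c C d.
Implicit Types (X Y Z H : E) (g h : G).
Variables (K A : set G) (k p a : {vspace E}) (Phi : set 'Hom(subvs_of a, R^o)).
Hypothesis ncpt : ~ compact [set: G].
Hypothesis CD : cartan_decomposition c K A k p Phi.

Let Kgrp : subgroup K. Proof. by have [[[]]] := CD. Qed.
Let Kcpt : compact K. Proof. by have [[[]]] := CD. Qed.
Let kLie : is_lie_algebra_of c K k. Proof. by have [[]] := CD. Qed.
Let K1 : K 1%g. Proof. by have [] := Kgrp. Qed.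
Let KM g h : K g -> K h -> K (g * h)%g.
Proof.
have [_ KB] := Kgrp => Kg Kh; rewrite -[h]invgK; apply: (KB) => //.
by rewrite -[_^-1%g]mul1g; exact: KB.
Qed.
Let Kexp X : X \in k -> K (lie_exp X).
Proof. by move=> Xk; have := (kLie X).1 Xk 1; rewrite scale1r. Qed.
Let exp_all X : has_exp c X. Proof. exact: (has_exp_all GL atc c1 CdP ncpt CD). Qed.
Let aa X Y : X \in a -> Y \in a -> br X Y = 0.
Proof. exact: (br_aa GL atc c1 CdP ncpt CD). Qed.
Let brl : forall Y, linear (br^~ Y) := bracket_linearl GL atc c1.
Let brr : forall X, linear (br X) := bracket_linearr GL atc c1.

Local Opaque Defs.Ad bracket adm.

Let expD H H' : H \in a -> H' \in a -> lie_exp (H + H') = (lie_exp H * lie_exp H')%g.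
Proof.
move=> Ha H'a.
exact: (lie_exp_add GL atc c1 CdP (exp_all H) (exp_all H') (aa Ha H'a)).
Qed.

Let expN X : lie_exp (- X) = (lie_exp X)^-1%g.
Proof. exact: (lie_expN c1 CdP (exp_all X)). Qed.

Lemma lie_exp_near1 N : nbhs (1%g : G) N ->
  exists2 r : R, 0 < r & forall X, `|X| < r -> N (lie_exp X).
Proof.
move=> /(small_nbhs c1)[s s0 sN].
have [L [r [L0 r0 LP]]] := lie_exp_bound c1 CdP.
have L1 : 0 < L + 1 by rewrite ltr_wpDl.
exists (Num.min r (Num.min (L + 1)^-1 (s / 2))).
  by rewrite !lt_min r0 invr_gt0 L1 divr_gt0.
move=> X; rewrite !lt_min => /andP[Xr /andP[XL Xs]].
have [[dX _] eX] := LP _ (exp_all X) Xr.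
apply: sN; split=> //.
rewrite -[lcoord _](subrK X) (le_lt_trans (ler_normD _ _))//.
have : L * `|X| <= 1.
  move: (ltW XL); rewrite -[_^-1]mul1r ler_pdivlMr// => h.
  by have := normr_ge0 X; nra.
move=> /(ler_wpM2r (normr_ge0 X)); rewrite -mulrA -expr2 mul1r => h.
have := le_trans eX h; move: Xs; move: `|X| `|_ - X| => u v; lra.
Qed.

(** Continuity of the exponential, known at [0], spreads over [a] by [exp H' = exp H exp (H' - H)],
    as [a] is abelian. *)
Lemma compact_exp_a (s : R) :
  compact (lie_exp @` [set H | H \in a /\ `|H| <= s]).
Proof.
apply: continuous_compact; last first.
  apply: bounded_closed_compact.
    exists s; split; first exact: num_real.
    by move=> x sx y /= [_ ys]; exact: le_trans (ltW sx).
  apply: closedI; last first.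
    apply: (@closed_comp _ _ (fun v : E => `|v|) [set x | x <= s]) => [v _|].
      exact: norm_continuous.
    exact: closed_le.
  change (closed [set H : E | H \in a]).
  have -> : [set H : E | H \in a] = (fun H => projv a H - H) @^-1` [set 0].
    apply/seteqP; split=> H /=; first by move=> Ha; rewrite projv_id// subrr.
    by move=> /eqP; rewrite subr_eq0 => /eqP <-; exact: memv_proj.
  apply: closed_comp => [H _|].
    apply: linear_fun_continuous => l x y.
    by rewrite linearP scalerBr opprD addrACA.
  exact/accessible_closed_set1/hausdorff_accessible/norm_hausdorff.
apply/subspace_continuousP => H [Ha Hs] W WH.
have : nbhs (lie_exp H * 1)%g W by rewrite mulg1.
move=> /nbhs_mulg [[U1 U2] /= [U1H U21] U12].
have [r r0 rP] := lie_exp_near1 U21.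
change (\forall H' \near H, H' \in a /\ `|H'| <= s -> W (lie_exp H')).
apply/nbhs_normP; exists r => //= H' H'r [H'a _].
have -> : H' = H + (H' - H) by rewrite addrC subrK.
rewrite /= expD ?memvB//; apply: (U12 (_, _)); split=> /=.
  exact: nbhs_singleton U1H.
by apply: rP; rewrite distrC.
Qed.

Let Kcl (s : R) : set G := K `&` (lpoint @` [set x | `|x| <= s]).

Lemma compact_small_K : exists2 r : R, 0 < r & forall s : R, s < r -> compact (Kcl s).
Proof.
have [hG _ _ _ _] := GL.
have [r r0 rP] := compact_lpoint c1; exists r => // s sr.
by apply: compact_closedI; [exact: Kcpt|exact: compact_closed hG (rP _ sr)].
Qed.

Lemma compact_mulS (S T : set G) : compact S -> compact T -> compact (S *s T).
Proof.
move=> Sc Tc; have -> : S *s T = (fun xy : G * G => (xy.1 * xy.2)%g) @` (S `*` T).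
  apply/seteqP; split=> [_ [x Sx [y Ty <-]]|_ [[x y] [/= Sx Ty] <-]].
    by exists (x, y).
  by exists x => //; exists y.
apply: continuous_compact; last exact: compact_setX.
exact/continuous_subspaceT/continuous_mulg.
Qed.

Section Iteration.
Variable P : 'M[R]_n.
Hypothesis Pu : P \in unitmx.
Hypothesis eP : forall i H, H \in a -> exists l, br H (row i P) = l *: row i P.

(** With [L] bounding the bracket, the weight at [H] is at most [L |H|], and [r] lets this consume
    half of [s]. *)
Lemma regular_perturbation (s : R) : 0 < s -> exists2 r : R, 0 < r &
  forall H0 H, H0 \in a -> H \in a -> `|H| <= r ->
    (forall i, regular c a s (row i P) H0) ->
    forall i, regular c a (s / 2) (row i P) (H0 + H).
Proof.
move=> s0; have [L L0 LP] := bilinear_bounded brl brr.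
have L1 : 0 < L + 1 by rewrite ltr_wpDl.
exists (s / 2 / (L + 1)); first by rewrite !divr_gt0.
move=> H0 H H0a Ha Hr reg i; have [e0|[l sl He]] := reg i; [by left|right].
have [l' H'e] := eP i Ha.
exists (l + l'); last first.
  have := brl (row i P) 1 H0 H; rewrite !scale1r => ->.
  by rewrite He H'e scalerDl.
have e0 := row_unitmx_neq0 i Pu.
have l's : `|l'| <= s / 2.
  have : `|l'| * `|row i P| <= s / 2 * `|row i P|.
    rewrite -normrZ -H'e (le_trans (LP _ _))// mulrA ler_wpM2r//.
    move: Hr; rewrite ler_pdivlMr// => Hr.
    by rewrite (le_trans _ Hr)// mulrDr mulr1 mulrC lerDl.
  by rewrite ler_pM2r// normr_gt0.
have := lerB_normD l l'; move: sl l's; move: `|l| `|l'| `|l + l'| => u v w; lra.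
Qed.

(* To first order [lpoint x] is [Ad (exp (- H0)) T + H + Z]; moving the factor
   [exp T] to the left of [exp H0] leaves a quadratic remainder. *)
Lemma approximation_step (s : R) : 0 < s -> exists B r : R, [/\ 0 <= B, 0 < r &
  forall H0 x, H0 \in a -> (forall i, regular c a s (row i P) H0) -> `|x| < r ->
    exists T H Z w, [/\ T \in k, H \in a, Z \in k &
      [/\ `|T| <= B * `|x|, `|H| <= B * `|x| & `|Z| <= B * `|x|]] /\
      [/\ small d w, `|lcoord w| <= `|x| / 2 &
        (lie_exp H0 * lpoint x = lie_exp T * lie_exp H0 * lie_exp H * w * lie_exp Z)%g]].
Proof.
move=> s0.
have [B B0 BP] := transverse_decomposition GL atc c1 CdP ncpt CD s0 Pu eP.
have [Q [r [Q0 r0 QP]]] := exp_product_estimate c1 CdP.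
pose D := 2 * B + 1.
have D0 : 0 < D by rewrite ltr_wpDl// mulr_ge0.
have QD0 : 0 < 2 * (Q * D ^+ 2 + 1) by rewrite mulr_gt0// ltr_wpDl// mulr_ge0// exprn_ge0// ltW.
exists B, (Num.min (r / D) (2 * (Q * D ^+ 2 + 1))^-1); split=> //.
  by rewrite lt_min divr_gt0// invr_gt0.
move=> H0 x H0a reg; rewrite lt_min => /andP[xr xQ].
have [T [H [Z [[Tk Ha Zk xE] [TB HB ZB]]]]] := BP H0 H0a reg x.
pose S := Ad (lie_exp (- H0)) T.
have x0 : 0 <= `|x| by [].
have Bx : 0 <= B * `|x| by rewrite mulr_ge0.
have le1 u : u <= B * `|x| -> u <= D * `|x| by rewrite /D; move: Bx; lra.
(* [S] is bounded through the equation and not through the norm of [Ad (exp (- H0))], so that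
   [D = 2 B + 1] is uniform in [H0]. *)
have SE : S = x - H - Z by rewrite {1}xE -/S addrAC addrK addrK.
have SB : `|S| <= D * `|x|.
  rewrite SE -addrA -opprD (le_trans (ler_normB _ _))//.
  have := le_trans (ler_normD H Z) (lerD HB ZB); rewrite /D.
  by move: `|H + Z| => u; lra.
have xB : `|x| <= D * `|x| by rewrite /D; move: Bx; lra.
have xr' : D * `|x| < r by rewrite mulrC -ltr_pdivlMr.
(* The first-order terms [- H - S + x - Z] of [w] cancel; and [exp H0 exp (- S) = exp (- T) exp H0]
   gives the exact equation. *)
pose w := (lie_exp (- H) * lie_exp (- S) * lpoint x * lie_exp (- Z))%g.
have [|||||sw wE] := QP (- H) (- S) x (- Z) (D * `|x|) (exp_all _) (exp_all _) (exp_all _).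
- by rewrite normrN; exact: le1.
- by rewrite normrN.
- by [].
- by rewrite normrN; exact: le1.
- by [].
exists T, H, Z, w; split=> //; split=> //.
  move: wE; rewrite -/w.
  have -> : - H + - S + x + - Z = 0.
    by rewrite SE; apply/rowP => i; rewrite !mxE; ring.
  rewrite subr0 => wE; apply: le_trans wE _.
  move: (ltW xQ); rewrite -[_^-1]mul1r ler_pdivlMr// => h.
  have h2 : `|x| * (Q * D ^+ 2) <= 1 / 2.
    by move: h; rewrite mulrCA mulrDr mulr1; lra.
  have := ler_wpM2r x0 h2.
  have -> : `|x| * (Q * D ^+ 2) * `|x| = Q * (D * `|x|) ^+ 2 by ring.
  lra.
have eS : lie_exp S = ((lie_exp H0)^-1 * lie_exp T * lie_exp H0)%g.
  rewrite /S (lie_exp_Ad GL atc c1 CdP _ (exp_all T)) expN.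
  by rewrite invgK.
rewrite /w !expN eS !invgM invgK !mulgA mulgVK.
by rewrite !mulgK mulgV mul1g.
Qed.

Notation half j := ((2 : R) ^- j).

Lemma approximate_decomposition (s e : R) : 0 < s -> 0 < e -> exists2 r : R, 0 < r &
  forall H0 x, H0 \in a -> (forall i, regular c a s (row i P) H0) -> `|x| < r ->
  forall j, exists u H w v, [/\ K u, H \in a, K v &
    (lie_exp H0 * lpoint x = u * lie_exp H0 * lie_exp H * w * v)%g] /\
    [/\ small d u /\ `|lcoord u| <= e, `|H| <= e, small d v /\ `|lcoord v| <= e &
        small d w /\ `|lcoord w| <= r * half j].
Proof.
move=> s0 e0; have [C0 d0 _ _ lpP] := CdP.
have [rp rp0 regP] := regular_perturbation s0.
(* All the iterates [H0 + H] remain [s / 2]-regular, so one constant [B] serves at every stage. *)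
have s20 : 0 < s / 2 by rewrite divr_gt0.
have [B [r' [B0 r'0 BP]]] := approximation_step s20.
have [L [rx [L0 rx0 LP]]] := lie_exp_bound c1 CdP.
have L1 : 0 < L + 1 by rewrite ltr_wpDl.
have C1 : 0 < 8 * (C + 1) by rewrite mulr_gt0// ltr_wpDl.
have B1 : 0 < B + 1 by rewrite ltr_wpDl.
(* For [m <= r1]: [rp / 2] and [e / 8] control the totals [2 m] and [8 m], [rx / 2] and [(L + 1)^-1]
   let the exponential at most double lengths, and the last two allow [small_mul]. *)
pose r1 := Num.min (Num.min (rp / 2) (e / 8))
  (Num.min (Num.min (rx / 2) (L + 1)^-1) (Num.min (d / 16) (8 * (C + 1))^-1)).
have r10 : 0 < r1 by rewrite !lt_min !invr_gt0 L1 C1 !divr_gt0.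
pose r := Num.min (Num.min (r' / 2) (d / 2)) (r1 / (B + 1)).
have r0 : 0 < r by rewrite !lt_min !divr_gt0.
have rr' : r < r'.
  by rewrite /r !gt_min; apply/orP; left; apply/orP; left; move: r'0; lra.
have rd : r < d.
  by rewrite /r !gt_min; apply/orP; left; apply/orP; right; move: d0; lra.
pose m := B * r.
have m0 : 0 <= m by rewrite mulr_ge0// ltW.
have : m <= r1.
  have : r <= r1 / (B + 1) by rewrite /r !ge_min lexx !orbT.
  by rewrite ler_pdivlMr// /m => h; rewrite (le_trans _ h)// mulrC ler_wpM2l ?(ltW r0)// lerDl.
rewrite /r1 !le_min => /andP[/andP[mp me] /andP[/andP[mx mL] /andP[md mC]]].
have Lm : L * m <= 1.
  by move: mL; rewrite -[_^-1]mul1r ler_pdivlMr// => h; nra.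
have Cm : C * (8 * m) <= 1.
  by move: mC; rewrite -[_^-1]mul1r ler_pdivlMr// => h; nra.
exists r => // H0 x H0a reg xr.
have half1 j : half j <= 1 by rewrite invf_le1 ?exprn_gt0// exprn_ege1// ler1n.
have half0 j : 0 < half j by rewrite invr_gt0 exprn_gt0.
(* Stage [j] adds to [H] at most [m * half j]. Each new outer factor has coordinates at most
   [2 * m * half j], which [small_mul] counts twice. The geometric series sum to [2 * m] and
   [8 * m]. *)
suff main j : exists u H w v, [/\ K u, H \in a, K v &
    (lie_exp H0 * lpoint x = u * lie_exp H0 * lie_exp H * w * v)%g] /\
    [/\ small d u /\ `|lcoord u| <= 8 * m * (1 - half j), `|H| <= 2 * m * (1 - half j),
        small d v /\ `|lcoord v| <= 8 * m * (1 - half j) &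
        small d w /\ `|lcoord w| <= r * half j].
  move=> j; have [u [H [w [v [eq [[su ub] Hb [sv vb] wb]]]]]] := main j.
  have le8 : 8 * m * (1 - half j) <= e.
    by have := half0 j; have := half1 j; move: me m0; nra.
  exists u, H, w, v; split=> //; split=> //.
  - by split=> //; exact: le_trans ub le8.
  - apply: le_trans Hb (le_trans _ le8).
    by rewrite ler_wpM2r ?subr_ge0// ler_wpM2r ?ler_nat.
  - by split=> //; exact: le_trans vb le8.
elim: j => [|j [u [H [w [v [[Ku Ha Kv eq] [[su ub] Hb [sv vb] [sw wb]]]]]]]].
  have [dx xE] := lpP _ (lt_trans xr rd).
  exists 1%g, 0, (lpoint x), 1%g; rewrite expr0 invr1 subrr !mulr0 mulr1 (lcoord1 c) !normr0 xE.
  split; first by split=> //; rewrite ?mem0v// (lie_exp0 c1 CdP) !mulg1 mul1g.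
  split=> //; try by split=> //; exact: small1.
  by split; [split=> //; rewrite xE (lt_trans xr)|exact: ltW].
have Hp : `|H| <= rp.
  by apply: le_trans Hb _; have := half0 j; have := half1 j; move: mp m0; nra.
have HHa : H0 + H \in a by exact: memvD.
have wr : `|lcoord w| < r'.
  by rewrite (le_lt_trans wb)// (le_lt_trans _ rr')// ler_piMr// ltW.
have [T [H' [Z [w' [[Tk H'a Zk [TB H'B ZB]] [sw' w'b weq]]]]]] :=
  BP _ _ HHa (regP _ _ H0a Ha Hp reg) wr.
have Bw : B * `|lcoord w| <= m * half j by rewrite /m -mulrA ler_wpM2l.
have mh : m * half j <= m by rewrite ler_piMr.
have ex U : `|U| <= B * `|lcoord w| ->
    small d (lie_exp U) /\ `|lcoord (lie_exp U)| <= 2 * (m * half j).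
  move=> Um; have Um' := le_trans Um Bw.
  have [|sU UL] := LP _ (exp_all U).
    by rewrite (le_lt_trans (le_trans Um' (le_trans mh mx)))//
    ltr_pdivrMr// ltr_pMr// ltr1n.
  split=> //; rewrite -[lcoord _](subrK U) (le_trans (ler_normD _ _))//.
  have LU : L * `|U| <= 1.
    by rewrite (le_trans _ Lm)// ler_wpM2l// (le_trans Um').
  have : L * `|U| ^+ 2 <= `|U| by rewrite expr2 mulrA ler_piMl.
  move=> LU2; have U1 := le_trans UL LU2.
  by rewrite mulr_natl mulr2n lerD// (le_trans U1).
have halfS : half j = 2 * half j.+1 by rewrite exprS invfM mulVKf ?pnatr_eq0.
have [sT Tm] := ex _ TB; have [sZ Zm] := ex _ ZB.
have C8 : C * (8 * m * (1 - half j)) <= 1.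
  apply: le_trans (ler_wpM2l C0 _) Cm; apply: ler_piMr; first by rewrite mulr_ge0.
  by rewrite gerBl; exact/ltW/half0.
have sumE : 8 * m * (1 - half j) + 2 * (2 * (m * half j)) = 8 * m * (1 - half j.+1).
  by rewrite halfS; ring.
have sumd : 8 * m * (1 - half j.+1) < d.
  have m8 : 8 * m < d by rewrite mulrC -ltr_pdivlMr// (le_lt_trans md)//
    ltr_pM2l// ltf_pV2 ?posrE// ltr_nat.
  apply: le_lt_trans m8; apply: ler_piMr; first by rewrite mulr_ge0.
  by rewrite gerBl; exact/ltW/half0.
have [|suT uTb] := small_mul c1 CdP su sT ub Tm C8; first by rewrite sumE.
have [|sZv Zvb] := small_mulr c1 CdP sZ sv Zm vb C8; first by rewrite addrC sumE.
exists (u * lie_exp T)%g, (H + H'), w', (lie_exp Z * v)%g; split; split.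
- by apply: KM => //; exact: Kexp.
- exact: memvD.
- by apply: KM => //; exact: Kexp.
- rewrite (lcoordK (proj1 sw)) (expD H0a Ha) in weq.
  rewrite eq (expD Ha H'a).
  transitivity (u * (lie_exp H0 * lie_exp H * w) * v)%g; first by rewrite !mulgA.
  by rewrite weq !mulgA.
- by split=> //; rewrite -sumE.
- rewrite (le_trans (ler_normD _ _))// (le_trans (lerD Hb (le_trans H'B Bw)))//.
  by rewrite halfS le_eqVlt; apply/orP; left; apply/eqP; ring.
- by split=> //; rewrite -sumE addrC.
- split=> //; apply: le_trans w'b _; rewrite ler_pdivrMr// -mulrA mulrC.
  by rewrite [half _ * _]mulrC -halfS mulrC.
Qed.

End Iteration.
End SuccessiveApproximation.

(** * From approximate to exact decompositions *)

Section WavefrontCore.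
Context {R : realType} {n : nat} {G : topGroupType}.
Variables (atlas : set (chart R n G)) (c : chart R n G).
Notation lcoord := (lcoord c).
Notation lpoint := (lpoint c).
Notation small := (small c).
Notation lie_exp := (lie_exp c).
Notation br := (bracket c).
Hypothesis GL : lie_group atlas.
Hypothesis atc : atlas c.
Hypothesis c1 : chart_dom c 1%g.
Variables C d : R.
Hypothesis CdP : mul_bound c C d.
Variables (K A : set G) (k p a : {vspace 'rV[R]_n}) (Phi : set 'Hom(subvs_of a, R^o)).
Hypothesis ncpt : ~ compact [set: G].
Hypothesis CD : cartan_decomposition c K A k p Phi.
Variable P : 'M[R]_n.
Hypothesis Pu : P \in unitmx.
Hypothesis eP : forall i H, H \in a -> exists l, br H (row i P) = l *: row i P.

Local Opaque Defs.Ad bracket adm.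

(* The products [u_j b exp(H_j) v_j] of the approximate decompositions stay in
   a compact set and converge to [b * lpoint x]. *)
Lemma wavefront_core (s : R) (N : set G) : 0 < s -> nbhs (1%g : G) N ->
  exists2 r : R, 0 < r &
  forall H0 x, H0 \in a -> (forall i, regular c a s (row i P) H0) -> `|x| < r ->
    exists u v w, [/\ K u /\ N u, A v /\ N v, K w /\ N w &
      (lie_exp H0 * lpoint x = u * lie_exp H0 * v * w)%g].
Proof.
move=> s0 NN; have [hG _ _ _ _] := GL; have [_ d0 _ _ lpP] := CdP.
have [[[[_ KB] Kc _] _] _ _ _ _] := CD.
have K1 : K 1%g by have [[[[]]]] := CD.
have KV g : K g -> K g^-1%g by move=> Kg; rewrite -[_^-1%g]mul1g; exact: KB.
have [rN rN0 rNP] := small_nbhs c1 NN.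
have [re re0 reP] := lie_exp_near1 GL atc c1 CdP ncpt CD NN.
have [rk rk0 rkP] := compact_small_K GL c1 CD.
pose e := Num.min (Num.min rN re) (Num.min rk d) / 2.
have m0 : 0 < Num.min (Num.min rN re) (Num.min rk d) by rewrite !lt_min rN0 re0 rk0 d0.
have e0 : 0 < e by rewrite divr_gt0.
have : e < Num.min (Num.min rN re) (Num.min rk d).
  by rewrite ltr_pdivrMr// ltr_pMr// ltr1n.
rewrite !lt_min => /andP[/andP[eN ee] /andP[ek ed]].
have [r r0 rP] := approximate_decomposition GL atc c1 CdP ncpt CD Pu eP s0 e0.
exists r => // H0 x H0a reg xr; set b := lie_exp H0; set z := (b * _)%g.
pose Ke : set G := K `&` (lpoint @` [set y | `|y| <= e]).
pose Ae : set G := lie_exp @` [set H | H \in a /\ `|H| <= e].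
have KeP g : K g -> small d g -> `|lcoord g| <= e -> Ke g.
  by move=> Kg [dg _] ge; split=> //; exists (lcoord g); rewrite ?lcoordK.
have KeN g : Ke g -> N g.
  move=> [_ [y /= ye <-]]; have [dy yE] := lpP _ (le_lt_trans ye ed).
  by apply: rNP; split=> //; rewrite yE (le_lt_trans ye).
pose Q := Ke *s [set b] *s Ae *s Ke.
have Qcl : closed Q.
  apply: compact_closed => //; apply: compact_mulS; last exact: rkP.
  apply: compact_mulS; last exact: (compact_exp_a GL atc c1 CdP ncpt CD).
  by apply: compact_mulS; [exact: rkP|exact: compact_set1].
suff : closure Q z.
  rewrite -(closure_id Q).1// => -[_ [_ [u Ku [_ -> <-]] [v [H [Ha He] <-]] <-]] [w Kw zE].
  exists u, (lie_exp H), w; split; rewrite ?zE//.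
  - by split; [exact: Ku.1|exact: KeN].
  - split; first exact: (lie_exp_mem_A CD Ha).
    by apply: reP; exact: le_lt_trans He ee.
  - by split; [exact: Kw.1|exact: KeN].
move=> B; rewrite -[in nbhs z](mulg1 z) => /nbhs_mulg[[U1 U2] /= [U1z U21] U12].
(* Deleting the remainder [w] multiplies [z] on the right by [v^-1 w^-1 v]; [v] changes with the
   stage, hence a neighborhood uniform over conjugation by [K]. *)
have [U' U'1 U'P] := compact_conj_nbhs Kc U21.
have : nbhs (1%g : G) [set g | U' g^-1%g].
  apply: (@cvg_invg _ _ (nbhs (1%g : G)) id 1%g _ cvg_id).
  by rewrite invg1.
move=> /(small_nbhs c1)[q q0 qP].
have [j jq] := half_small (divr_gt0 q0 r0).
have [u [H [w [v [[Ku Ha Kv zE] [[su ub] He [sv vb] [[dw _] wb]]]]]]] := rP _ _ H0a reg xr j.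
exists (u * b * lie_exp H * v)%g; split.
  exists (u * b * lie_exp H)%g; last by exists v => //; exact: KeP.
  exists (u * b)%g; last by exists (lie_exp H) => //; exists H.
  by exists u; [exact: KeP|exists b].
have -> : (u * b * lie_exp H * v = z * (v^-1 * w^-1 * v^-1^-1))%g.
  by rewrite /z zE invgK !mulgA !mulgK -/b.
apply: (U12 (_, _)); split=> /=; first exact: nbhs_singleton U1z.
apply: U'P; first exact: KV.
apply: qP; split=> //; apply: le_lt_trans wb _.
by rewrite mulrC -ltr_pdivlMr//; exact: jq.
Qed.

Lemma regular_opp (s : R) e H : regular c a s e H -> regular c a s e (- H).
Proof.
move=> [e0|[l sl He]]; [by left|right].
exists (- l); first by rewrite normrN.
have := bracket_linearl GL atc c1 e (-1) H 0.
rewrite !scaleN1r addr0 => ->.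
have -> : br 0 e = 0.
  by have := bracket_linearl GL atc c1 e (-1) 0 0; rewrite !scaleN1r oppr0 addr0 addNr.
by rewrite addr0 He scaleNr.
Qed.

(** A nonzero weight of the eigenbasis is a restricted root; it or its opposite is positive, and the
    distance from the walls bounds its absolute value. *)
Lemma regular_log (S : set G) : positive_distance_from_walls c Phi S ->
  exists2 s : R, 0 < s & forall b, S b ->
    forall i, regular c a s (row i P) (vsval (lie_log c a b)).
Proof.
have [_ _ _ [_ PhiP _ _] _] := CD.
move=> [s s0 sP]; exists s => // b Sb i.
have [al alP] := root_of_eigenvector GL atc c1 (row_unitmx_neq0 i Pu) (eP i).
have [al0|aln0] := eqVneq al 0.
  left => H' H'a; have := alP (vsproj a H').
  by rewrite vsprojK// al0 lfunE scale0r.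
right; exists (al (lie_log c a b)); last exact: alP.
have [/(sP _ _ Sb)/le_trans->//|/(sP _ _ Sb)] : Phi al \/ Phi (- al).
- by apply: PhiP; split=> //; exists (row i P); [exact: row_unitmx_neq0|].
- exact: ler_norm.
- by rewrite opp_lfunE => /le_trans -> //; rewrite -normrN ler_norm.
Qed.

Lemma wavefront_chamber (S N : set G) : S `<=` A ->
  positive_distance_from_walls c Phi S -> nbhs (1%g : G) N ->
  exists2 O : set G, nbhs (1%g : G) O & forall b o, S b -> O o ->
    (exists u v w, [/\ K u /\ N u, A v /\ N v, K w /\ N w &
      (b * o = u * b * v * w)%g]) /\
    (exists u v w, [/\ K u /\ N u, A v /\ N v, K w /\ N w &
      (o * b = u * b * v * w)%g]).
Proof.
move=> SA Sd NN; have [s s0 sP] := regular_log Sd.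
have [[[[_ KB] Kc _] _] _ [[[[A1 AB] _ AA _] _] _] _ _] := CD.
have K1 : K 1%g by have [[[[]]]] := CD.
have KV g : K g -> K g^-1%g by move=> Kg; rewrite -[_^-1%g]mul1g; exact: KB.
have AV g : A g -> A g^-1%g by move=> Ag; rewrite -[_^-1%g]mul1g; exact: AB.
have inv_nbhs B : nbhs (1%g : G) B -> nbhs (1%g : G) [set g | B g^-1%g].
  move=> B1; apply: (@cvg_invg _ _ (nbhs (1%g : G)) id 1%g _ cvg_id).
  by rewrite invg1.
(* Symmetric under inversion, since the second decomposition is obtained from that of
   [b^-1 * o^-1]. *)
have NN' : nbhs (1%g : G) (N `&` [set g | N g^-1%g]) by exact: (filterI NN (inv_nbhs _ NN)).
have [r r0 rP] := wavefront_core s0 NN'.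
have O1 : nbhs (1%g : G) [set g | chart_dom c g /\ `|lcoord g| < r].
  apply: filterI; first exact: open_nbhs_nbhs (conj (@open_chart_dom _ _ _ c) c1).
  exact: (near_lcoord1 c1 (@nbhs0_lt R 'rV[R]_n _ r0)).
exists [set g | (chart_dom c g /\ `|lcoord g| < r) /\ (chart_dom c g^-1%g /\ `|lcoord g^-1%g| < r)].
  exact: (filterI O1 (inv_nbhs _ O1)).
move=> b o Sb [[od ro] [doV roV]].
have H0a : vsval (lie_log c a b) \in a by exact: subvsP.
have HE := A_lie_log GL atc c1 CdP ncpt CD (SA _ Sb).
split.
  have := rP _ _ H0a (sP _ Sb) ro; rewrite HE (lcoordK od).
  by move=> [u [v [w [[Ku [Nu _]] [Av [Nv _]] [Kw [Nw _]] E]]]]; exists u, v, w.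
have H0a' : - vsval (lie_log c a b) \in a by rewrite memvN.
have := rP _ _ H0a' (fun i => regular_opp (sP _ Sb i)) roV.
rewrite (lie_expN c1 CdP (has_exp_all GL atc c1 CdP ncpt CD _)) HE (lcoordK doV).
move=> [u [v [w [[Ku [_ Nu]] [Av [_ Nv]] [Kw [_ Nw]] E]]]].
(* Inversion gives [o b = w^-1 v^-1 b u^-1], and [v^-1] commutes with [b] because [A] is abelian. *)
exists w^-1%g, v^-1%g, u^-1%g; split; [by split; [exact: KV|]|by split; [exact: AV|]|
  by split; [exact: KV|]|].
rewrite -[(o * b)%g]invgK invgM E !invgM invgK -!mulgA; congr (_ * _)%g.
by rewrite !mulgA; congr (_ * _)%g; apply: AA; [exact: AV|exact: SA].
Qed.

End WavefrontCore.

Local Open Scope group_scope.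

Theorem theorem2p1 (R : realType) (n : nat) (G : topGroupType)
    (atlas : set (chart R n G)) (c : chart R n G)
    (K A : set G) (k p a : {vspace 'rV[R]_n})
    (Phi : set 'Hom(subvs_of a, R^o)) (C : set G) :
  semisimple_lie_group atlas ->
  connected [set: G] ->
  ~ compact [set: G] ->
  finite_set (@group_center G) ->
  atlas c -> chart_dom c 1 ->
  cartan_decomposition c K A k p Phi ->
  closed_subset_of (closed_chamber c A Phi) C ->
  positive_distance_from_walls c Phi C ->
  let M := centralizer_in K A in
  forall U1 U2 V : set G,
    nbhd1_in K U1 -> nbhd1_in K U2 -> nbhd1_in A V ->
    exists2 O : set G, nbhs (1 : G) O &
      forall k1 b k2 : G, K k1 -> C b -> K k2 ->
        let g := k1 * b * k2 in
        let W := ([set k1] *s U1) *s ([set b] *s V *s M) *s ([set k2] *s U2) in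
        ([set g] *s O `<=` W) /\ (O *s [set g] `<=` W).
Proof.
move=> [GL _] _ ncpt _ atc c1 CD [F _ CF] CD0 M U1 U2 V [_ NU1] [_ NU2] [_ NV].
have [[[[K1 KB] Kc _] _] _ _ _ _] := CD.
have KV g : K g -> K g^-1 by move=> Kg; rewrite -[g^-1]mul1g; exact: KB.
have [B [d CdP]] := mul_bound_exists GL atc c1.
have [P Pu eP] := joint_eigenbasis GL atc c1 CdP ncpt CD.
have CA : C `<=` A by rewrite CF => g [[]].
(* [w k2 = k2 (k2^-1 w k2)]: the right factor must remain in [U2] after conjugation by any element
   of [K]. *)
have [N2 N21 N2P] := compact_conj_nbhs Kc NU2.
have NN : nbhs (1 : G) ([set g | K g -> U1 g] `&` [set g | A g -> V g] `&` N2).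
  by apply: filterI N21; apply: filterI; [exact: NU1|exact: NV].
have [T T1 TP] := wavefront_chamber GL atc c1 CdP ncpt CD Pu eP CA CD0 NN.
(* [g o = k1 (b (k2 o k2^-1)) k2] and [o g = k1 ((k1^-1 o k1) b) k2]: the perturbation reaches [b]
   conjugated by an element of [K]. *)
have [T' T'1 T'P] := compact_conj_nbhs Kc T1.
exists T' => // k1 b k2 Kk1 Cb Kk2 g W.
have M1 : M 1 by split=> // h _; rewrite mul1g mulg1.
have WP u v w : K u -> A v -> K w -> U1 u -> V v -> N2 w ->
    W (k1 * (u * b * v * w) * k2).
  move=> Ku Av Kw U1u Vv N2w.
  exists (k1 * u * (b * v * 1)).
    exists (k1 * u); first by exists k1 => //; exists u.
    exists (b * v * 1) => //; exists (b * v); last by exists 1.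
    by exists b => //; exists v.
  exists (k2 * (k2^-1 * w * k2^-1^-1)).
    exists k2 => //; exists (k2^-1 * w * k2^-1^-1) => //.
    apply: (N2P _ _ (KV _ Kk2) N2w).
    apply: (KB); last exact: KV.
    by rewrite -[w]invgK; apply: (KB); exact: KV.
  by rewrite invgK !mulgA mulgK mulg1.
split=> [_ [_ -> [h Th <-]]|_ [h Th [_ -> <-]]].
- have [[u [v [w [[Ku [[/(_ Ku) ? _] _]] [Av [[_ /(_ Av) ?] _]] [Kw [_ ?]] E]]]] _] :=
    TP _ _ Cb (T'P _ _ Kk2 Th).
  suff -> : g * h = k1 * (u * b * v * w) * k2 by exact: WP.
  by rewrite -E /g !mulgA mulgVK.
- have [_ [u [v [w [[Ku [[/(_ Ku) ? _] _]] [Av [[_ /(_ Av) ?] _]] [Kw [_ ?]] E]]]]] :=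
    TP _ _ Cb (T'P _ _ (KV _ Kk1) Th).
  suff -> : h * g = k1 * (u * b * v * w) * k2 by exact: WP.
  by rewrite -E /g invgK !mulgA mulgV mul1g.
Qed.
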